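(* For any integer $m\ge9$, any $q\ge1$ and any probability density $f$ on $\mathbb R^d$ with $\|f\|_\infty\le\alpha_m^{-1}$, $$\mathbb E_f\bigg\{\sup_{\vec h\in\mathcal H^d_m}\Big(\big|\widehat U_{\vec h}-\mathbb E_f[\widehat U_{\vec h}]\big|-U_{\vec h}(f)\Big)_+^q\bigg\}\le\Lambda^*_q(U)\,[2\ln(m)]^d\,m^{-4q},$$ where $\Lambda^*_q(U)=2^{q-1}\Lambda_q(U)+\Gamma(q+1)[8\varpi_U]^q$.
   Context: $X_1,\dots,X_m,Y_1,\dots,Y_m$ ($d\ge1$) are i.i.d. random vectors in $\mathbb R^d$ with density $f$; $\mathbb E_f$ is expectation under their joint law; $(a)_+=\max(a,0)$; $\Gamma$ is the gamma function; $\mathrm 1_A$ is the indicator of $A$. $U:\mathbb R^d\to\mathbb R$ is a symmetric bounded function supported on a given cube $(-t,t)^d$, $t>0$; $\varpi_U=1\vee\sup_{p\in[1,\infty]}\|U\|_p$. For $\vec h\in(0,1]^d$: $V_{\vec h}=\prod_{j=1}^dh_j$, $U_{\vec h}(x)=V_{\vec h}^{-1}U(x_1/h_1,\dots,x_d/h_d)$ for $x\in\mathbb R^d$, and $\widehat U_{\vec h}=\frac1{m^2}\sum_{i,j=1}^mU_{\vec h}(Y_i-X_j)$. $\alpha_m\downarrow0$ is an a priori chosen sequence with $\alpha_m\ln(m)\ge1$ and $\alpha_m\le1/3$ for the values of $m$ considered. $\mathfrak H^d=\{\vec h\in(0,1]^d:m^2V_{\vec h}\ge\ln(m)\}$; $\mathcal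 H^d_m=\mathfrak H^d\cap\{e^{-k}:k=1,\dots,2\lfloor\ln(m)\rfloor\}^d$; $\mathfrak H^d_*=\{\vec h\in\mathfrak H^d:mV_{\vec h}\le\alpha_m^2\}$, $\bar{\mathfrak H}^d_*=\mathfrak H^d\setminus\mathfrak H^d_*$. With $s=12q+2$: $$\Upsilon_{\vec h}(m)=10\ln(m)\,\mathrm 1_{\bar{\mathfrak H}^d_*}(\vec h)+\tfrac{17\ln(m)}{|\ln(mV_{\vec h})|}\mathrm 1_{\mathfrak H^d_*}(\vec h),$$ $$J_{\vec h}(f)=\int_{\mathbb R^d}\!\int_{\mathbb R^d}|U_{\vec h}(y-z)|f(y)f(z)\,dy\,dz,\qquad W_{\vec h}(f)=\sup_{x\in\mathbb R^d}\int_{\mathbb R^d}|U_{\vec h}(y-x)|f(y)\,dy,$$ and the quantity $U_{\vec h}(f)$ (not to be confused with the function $U_{\vec h}(\cdot)$ on $\mathbb R^d$) is $$U_{\vec h}(f)=\Big[\tfrac{16sW_{\vec h}(f)J_{\vec h}(f)\ln(m)}{m}\Big]^{1/2}+\Big[\tfrac{16s\varpi_UJ_{\vec h}(f)\ln(m)}{m^2V_{\vec h}}\Big]^{1/2}+\tfrac{23sW_{\vec h}(f)\ln(m)}{m}+\tfrac{\Upsilon_{\vec h}(m)s^2\varpi_U\ln(m)}{m^2V_{\vec h}}.$$ $$\Lambda_q(U)=2^{q+1}\varpi_U^q\Big(1+2^{2q-1}[1+2^q\Gamma(q+1)]+2^{2q-2}\Gamma(q+1)\Big[2^{-1}\big(3\sqrt{12q+2}\big)^q+\big(28(6q+1)\big)^q\Big]\Big).$$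 *)

(* Defs.v *)
From HB Require Import structures.
From mathcomp Require Import all_boot all_order all_algebra.
From mathcomp Require Import all_classical all_reals all_analysis.

Set Implicit Arguments.
Unset Strict Implicit.
Unset Printing Implicit Defensive.

Import Order.TTheory GRing.Theory Num.Theory.
Import numFieldNormedType.Exports.

Local Open Scope classical_set_scope.
Local Open Scope ring_scope.

(* R^d is d.-tuple R: tuples, unlike 'rV[R]_d, carry the product (that is,
   Borel) sigma-algebra in the library.  Lebesgue measure on d.-tuple R is the
   image of lebesgue_measure \x ... \x lebesgue_measure, built by recursion on
   the dimension; lebesgue_tuple_box gives its values on boxes. *)
Section lebesgue_tuple.
Context {R : realType}.

Definition cons_pair n (p : measurableTypeR R * n.-tuple R) : n.+1.-tuple R :=
  [tuple of (p.1 : R) :: p.2].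

Lemma measurable_cons_pair n : measurable_fun setT (@cons_pair n).
Proof. exact: measurable_cons. Qed.

Section step.
Variables (n : nat) (mu : {sigma_finite_measure set (n.-tuple R) -> \bar R}).

Definition lebesgue_cons : set (n.+1.-tuple R) -> \bar R :=
  pushforward (@lebesgue_measure R \x mu)%E (@cons_pair n).

Let preimage_cons_pair (A : set (n.+1.-tuple R)) :
  measurable A -> measurable (@cons_pair n @^-1` A).
Proof.
move=> mA; rewrite -[X in measurable X]setTI.
exact: (@measurable_cons_pair n measurableT _ mA).
Qed.

Let lebesgue_cons0 : lebesgue_cons set0 = 0%E.
Proof. by rewrite /lebesgue_cons /pushforward preimage_set0 measure0. Qed.

Let lebesgue_cons_ge0 A : (0 <= lebesgue_cons A)%E.
Proof. by rewrite /lebesgue_cons /pushforward measure_ge0. Qed.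

Let lebesgue_cons_sigma_additive : semi_sigma_additive lebesgue_cons.
Proof.
move=> F mF tF mUF; rewrite /lebesgue_cons /pushforward preimage_bigcup.
apply: measure_semi_sigma_additive => [k||]; first exact: preimage_cons_pair.
- apply/trivIsetP => /= i j _ _ ij; rewrite -preimage_setI.
  by move/trivIsetP : tF => /(_ _ _ _ _ ij) ->//; rewrite preimage_set0.
- by rewrite -preimage_bigcup; exact: preimage_cons_pair.
Qed.

HB.instance Definition _ := isMeasure.Build _ _ _ lebesgue_cons
  lebesgue_cons0 lebesgue_cons_ge0 lebesgue_cons_sigma_additive.

Lemma lebesgue_cons_sigma_finite : sigma_finite setT lebesgue_cons.
Proof.
have /sigma_finiteP[F [TF ndF Foo]] := sigma_finiteT (@lebesgue_measure R).
have /sigma_finiteP[G [TG ndG Goo]] := sigma_finiteT mu.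
pose unc (x : n.+1.-tuple R) : measurableTypeR R * n.-tuple R :=
  (thead x, [tuple of behead x]).
have uncK p : unc (cons_pair p) = p.
  case: p => a b; rewrite /unc /cons_pair/=.
  by congr pair; apply: val_inj.
have munc : measurable_fun setT unc.
  apply/measurable_fun_pairP; split => /=; last exact: measurable_behead.
  exact: (measurable_tnth ord0).
exists (fun k => unc @^-1` (F k `*` G k)).
  apply/esym; rewrite -subTset => x _.
  have [i _ Fi] : (\bigcup_k F k) (unc x).1 by rewrite -TF.
  have [j _ Gj] : (\bigcup_k G k) (unc x).2 by rewrite -TG.
  exists (maxn i j) => //; split.
  - by move: Fi; exact/subsetPset/ndF/leq_maxl.
  - by move: Gj; exact/subsetPset/ndG/leq_maxr.
move=> k; have [mF Fk] := Foo k; have [mG Gk] := Goo k; split.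
  by rewrite -[_ @^-1` _]setTI; apply: munc => //; exact: measurableX.
rewrite /lebesgue_cons /pushforward.
rewrite (_ : _ @^-1` _ = F k `*` G k); last first.
  rewrite -comp_preimage (_ : unc \o @cons_pair n = id)//.
  by apply/funext => p; exact: uncK.
by rewrite product_measure1E// lte_mul_pinfty// ge0_fin_numE.
Qed.

HB.instance Definition _ := Measure_isSigmaFinite.Build _ _ _
  lebesgue_cons lebesgue_cons_sigma_finite.

End step.

Fixpoint lebesgue_tuple (n : nat) :
    {sigma_finite_measure set (n.-tuple R) -> \bar R} :=
  if n is n'.+1 then lebesgue_cons (lebesgue_tuple n') else \d_([tuple]).

Lemma lebesgue_tuple_box n (A : 'I_n -> set R) :
  (forall i, measurable (A i)) ->
  lebesgue_tuple n [set x | forall i, A i (tnth x i)] =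
  (\prod_(i < n) @lebesgue_measure R (A i))%E.
Proof.
elim: n A => [|n IH] A mA /=.
  rewrite big_ord0 diracE mem_set//; by case.
rewrite big_ord_recl -IH => [|i]; last exact: mA.
have mB : measurable [set x : n.-tuple R | forall i, A (lift ord0 i) (tnth x i)].
  rewrite (_ : mkset _ = \bigcap_(i in [set: 'I_n])
      (fun x : n.-tuple R => tnth x i) @^-1` A (lift ord0 i)).
    apply: fin_bigcap_measurable => // i _.
    by rewrite -[_ @^-1` _]setTI; apply: measurable_tnth.
  by apply/seteqP; split => x xA i => [_|]; [exact: xA|exact: (xA i I)].
rewrite -(product_measure1E (@lebesgue_measure R) (lebesgue_tuple n) (mA ord0) mB).
rewrite /lebesgue_cons /pushforward; congr (product_measure1 _ _ _).
apply/seteqP; split => [[a b]/= H|[a b]/= [Aa Ab] i].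
  split; first by have := H ord0; rewrite tnth0.
  by move=> i; have := H (lift ord0 i); rewrite tnthS.
by case: (unliftP ord0 i) => [j|] ->; rewrite ?tnthS ?tnth0.
Qed.

End lebesgue_tuple.

Section setting.
Context {R : realType} {d : nat}.
Notation Rd := (d.-tuple R).
Notation leb := (@lebesgue_tuple R d).

Definition probability_density (f : Rd -> R) : Prop :=
  [/\ measurable_fun setT f, forall x, 0 <= f x
    & (\int[leb]_x (f x)%:E)%E = 1%:E].

Definition symmetric_kernel (U : Rd -> R) : Prop :=
  forall x, U [tuple - tnth x j | j < d] = U x.

Definition supported_on_cube (t : R) (U : Rd -> R) : Prop :=
  forall x, U x != 0 -> forall j, - t < tnth x j < t.

(* 1 \/ sup_{p in [1, +oo]} ||U||_p; 'N[_]_+oo is the essential supremum. *)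
Definition varpi (U : Rd -> R) : R :=
  fine (maxe 1%:E
    (ereal_sup [set 'N[leb]_p[EFin \o U] | p in [set p | 1%:E <= p]]))%E.

Definition vol (h : Rd) : R := \prod_(j < d) tnth h j.

Definition scaled (U : Rd -> R) (h x : Rd) : R :=
  (vol h)^-1 * U [tuple tnth x j / tnth h j | j < d].

Definition vsub (x y : Rd) : Rd := [tuple tnth x j - tnth y j | j < d].

Definition Uhat (m : nat) (U : Rd -> R) (h : Rd) (x y : 'I_m -> Rd) : R :=
  (m%:R ^+ 2)^-1 * \sum_(i < m) \sum_(j < m) scaled U h (vsub (y i) (x j)).

Definition frakH (m : nat) : set Rd :=
  [set h | (forall j, 0 < tnth h j <= 1) /\ ln m%:R <= m%:R ^+ 2 * vol h].

Definition calH (m : nat) : set Rd :=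
  frakH m `&` [set h | forall j, exists2 k : nat,
    (1 <= k <= 2 * Num.truncn (ln m%:R : R))%N & tnth h j = expR (- k%:R)].

Definition frakH_star (alpha : nat -> R) (m : nat) : set Rd :=
  frakH m `&` [set h | m%:R * vol h <= alpha m ^+ 2].

Definition Upsilon (alpha : nat -> R) (m : nat) (h : Rd) : R :=
  10 * ln m%:R * \1_(frakH m `\` frakH_star alpha m) h
  + 17 * ln m%:R / `|ln (m%:R * vol h)| * \1_(frakH_star alpha m) h.

Definition J (U f : Rd -> R) (h : Rd) : R :=
  \int[leb]_y \int[leb]_z (`|scaled U h (vsub y z)| * f y * f z).

Definition W (U f : Rd -> R) (h : Rd) : R :=
  sup (range (fun x => \int[leb]_y (`|scaled U h (vsub y x)| * f y))).

Definition Umajorant (alpha : nat -> R) (m : nat) (q : R) (U f : Rd -> R)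
    (h : Rd) : R :=
  let s := 12 * q + 2 in
  Num.sqrt (16 * s * W U f h * J U f h * ln m%:R / m%:R)
  + Num.sqrt (16 * s * varpi U * J U f h * ln m%:R / (m%:R ^+ 2 * vol h))
  + 23 * s * W U f h * ln m%:R / m%:R
  + Upsilon alpha m h * s ^+ 2 * varpi U * ln m%:R / (m%:R ^+ 2 * vol h).

Definition Gamma (a : R) : R :=
  \int[lebesgue_measure]_(t in `]0, +oo[) (t `^ (a - 1) * expR (- t)).

Definition Lambda (q : R) (U : Rd -> R) : R :=
  2 `^ (q + 1) * varpi U `^ q *
  (1 + 2 `^ (2 * q - 1) * (1 + 2 `^ q * Gamma (q + 1))
     + 2 `^ (2 * q - 2) * Gamma (q + 1) *
       (2^-1 * (3 * Num.sqrt (12 * q + 2)) `^ q + (28 * (6 * q + 1)) `^ q)).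

Definition Lambda_star (q : R) (U : Rd -> R) : R :=
  2 `^ (q - 1) * Lambda q U + Gamma (q + 1) * (8 * varpi U) `^ q.

End setting.

Section random_vectors.
Context {R : realType} {d : nat} {dO : measure_display}
  {Omega : measurableType dO} (P : probability Omega R).

Definition has_density (X : {RV P >-> d.-tuple R}) (f : d.-tuple R -> R) :
    Prop :=
  forall A, measurable A ->
    distribution P X A = (\int[lebesgue_tuple d]_(x in A) (f x)%:E)%E.

(* The product rule over subfamilies is the case where some A i are setT. *)
Definition mutually_independent (I : finType)
    (Z : I -> {RV P >-> d.-tuple R}) : Prop :=
  forall A : I -> set (d.-tuple R), (forall i, measurable (A i)) ->
    P (\bigcap_(i in [set: I]) (Z i @^-1` A i)) =
    (\prod_(i : I) P (Z i @^-1` A i))%E.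

Definition iid_pair (m : nat) (X Y : 'I_m -> {RV P >-> d.-tuple R})
    (f : d.-tuple R -> R) : Prop :=
  [/\ mutually_independent
        (fun k : 'I_m + 'I_m => match k with inl i => X i | inr i => Y i end),
      forall i, has_density (X i) f & forall i, has_density (Y i) f].

(* calH m is finite, and real [sup] is 0 on the empty set, the right value for
   a supremum of nonnegative quantities when calH m is empty. *)
Definition sup_deviation (alpha : nat -> R) (m : nat) (q : R)
    (U f : d.-tuple R -> R) (X Y : 'I_m -> {RV P >-> d.-tuple R})
    (w : Omega) : R :=
  let Uh h w' := Uhat U h (fun i => X i w') (fun i => Y i w') in
  sup [set Num.max (`|Uh h w - fine 'E_P[Uh h]| - Umajorant alpha m q U f h) 0
             `^ q | h in calH m].

End random_vectors.

(* Main.v *)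
(* For a fixed bandwidth h, truncate the kernel to a bounded k and condition on
   the X-sample x = (x_1, ..., x_m).  With G_x(y) = sum_j k(x_j, y) and
   b(x) = E k(x, Y), the centred double sum splits into
   sum_i (G_x(Y_i) - E G_x(Y)), a sum of conditionally independent terms, and
   m sum_j (b(x_j) - E b), to which Bernstein's inequality applies directly.
   For the first part one truncates at the event A_x(Y_i) <= tau, where
   A_x(y) = sum_j |k(x_j, y)| has, for fixed y, Poisson-like tails; this is
   where the two regimes of Upsilon come from.  The conditional variance of the
   truncated terms is at most E [A_x(Y)^2; A_x(Y) <= tau], whose off-diagonal
   part grows along x_1, x_2, ... by increments bounded by tau W with
   conditional means at most W sum_j E |k(x_j, Y)|, so an exponential
   supermartingale controls it.  Each event is given probability about
   m^(-6q); on the complement the deviation is below the majorant, and off it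
   the trivial bound 2 varpi / V_h = O(m^2) costs only a factor m^(2q).  A union
   bound over the at most (2 ln m)^d bandwidths concludes. *)
Require Import Defs.
From HB Require Import structures.
From mathcomp Require Import all_boot all_order all_algebra.
From mathcomp Require Import all_classical all_reals all_analysis.
From mathcomp Require Import measurable_realfun ess_sup_inf ring lra.
Set Implicit Arguments.
Unset Strict Implicit.
Unset Printing Implicit Defensive.
Import Order.TTheory GRing.Theory Num.Theory.
Import numFieldNormedType.Exports.
Local Open Scope classical_set_scope.
Local Open Scope ring_scope.

(** * Product measures on tuples *)

(** Write [B = varpi / V_h]. Conditionally on the first sample, [G_x(Y_i)] is bounded only by [m B],
    far too much for the linear term of Bernstein's inequality; [tau] replaces that bound. The same
    cut keeps the increments of the conditional variance below [tau W]; without it they would be of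
    size up to [m B W]. Its price is a bias, the mean of [A_x(Y)] beyond [tau], which the
    exponential moment controlling the exceedances also bounds. All tails run at [exp (-u)] with
    [u = (6q + 1) ln m], so that [s ln m = 2 u] for [s = 12q + 2]; the extra [ln m] in [u] pays for
    the factor [m] of the union over the [Y_i]. The Poisson-like mean is [m W / B]. In general the
    Chernoff exponent is of order [1 / B] and [tau] of order [m W + B u]. When [m V_h <= alpha_m^2],
    the bound on [f] makes that mean at most [sqrt (m V_h)], an exponent of order [|ln (m V_h)| / B]
    becomes affordable, and [tau] drops to order [B u / |ln (m V_h)|]. *)

Section power_probability.
Context {dT : measure_display} {T : measurableType dT} {R : realType}.
Variable mu : probability T R.

Definition tuple_cons n (p : T * n.-tuple T) : n.+1.-tuple T :=
  [the n.+1.-tuple T of p.1 :: p.2].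

Lemma measurable_tuple_cons n : measurable_fun setT (@tuple_cons n).
Proof. exact: measurable_cons. Qed.

HB.instance Definition _ n :=
  isMeasurableFun.Build _ _ _ _ (@tuple_cons n) (@measurable_tuple_cons n).

(** The law of [n] independent draws. The newest draw sits at the head, so integrating out the head
    first is conditioning on the past, held in the tail. *)
Fixpoint power (n : nat) : probability (n.-tuple T) R :=
  if n is n'.+1 then distribution (mu \x power n')%E (@tuple_cons n')
  else \d_([tuple]).

Lemma ge0_integral_powerS n (F : n.+1.-tuple T -> \bar R) :
  measurable_fun [set: n.+1.-tuple T] F -> (forall t, 0 <= F t)%E ->
  (\int[power n.+1]_t F t =
   \int[power n]_t \int[mu]_x F [the n.+1.-tuple T of x :: t])%E.
Proof.
move=> mF F0; rewrite /= ge0_integral_distribution//.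
rewrite fubini_tonelli2//.
- by apply: measurableT_comp => //; exact: measurable_tuple_cons.
- by move=> p; exact: F0.
Qed.

Definition box n (A : 'I_n -> set T) : set (n.-tuple T) :=
  [set t | forall i, A i (tnth t i)].

Lemma measurable_box n (A : 'I_n -> set T) :
  (forall i, measurable (A i)) -> measurable (box A).
Proof.
move=> mA.
rewrite (_ : box A = \bigcap_(i in [set: 'I_n])
    (fun x : n.-tuple T => tnth x i) @^-1` A i).
  apply: fin_bigcap_measurable => // i _.
  by rewrite -[_ @^-1` _]setTI; apply: measurable_tnth.
by apply/seteqP; split => x xA i => [_|]; [exact: xA|exact: (xA i I)].
Qed.

Lemma power_box n (A : 'I_n -> set T) :
  (forall i, measurable (A i)) -> power n (box A) = (\prod_(i < n) mu (A i))%E.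
Proof.
elim: n A => [|n IH] A mA /=.
  by rewrite big_ord0 diracE mem_set//; case.
rewrite big_ord_recl -IH => [|i]; last exact: mA.
have mB := measurable_box (fun i : 'I_n => mA (lift ord0 i)).
rewrite -(product_measure1E mu (power n) (mA ord0) mB).
rewrite /distribution /pushforward; congr (product_measure1 _ _ _).
apply/seteqP; split => [[a b]/= H|[a b]/= [Aa Ab] i].
  split; first by have := H ord0; rewrite tnth0.
  by move=> i; have := H (lift ord0 i); rewrite tnthS.
by case: (unliftP ord0 i) => [j|] ->; rewrite ?tnthS ?tnth0.
Qed.

Lemma measurable_tupleE n :
  @measurable _ (n.-tuple T) = <<s [set box A | A in
    [set A : 'I_n -> set T | forall i, measurable (A i)]] >>.
Proof.
apply/seteqP; split; last first.
  apply: smallest_sub; first exact: sigma_algebra_measurable.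
  by move=> _ [A mA <-]; exact: measurable_box.
apply: smallest_sub; first exact: smallest_sigma_algebra.
move=> B; rewrite -bigcup_seq/= => -[i _ [A mA <-]].
apply: sub_sigma_algebra; exists (fun j => if j == i then A else setT).
  by move=> j /=; case: ifP.
apply/seteqP; split => t /=.
  by move=> /(_ i); rewrite eqxx.
by move=> [_ Ai] j; case: eqP => // ->.
Qed.

(** Boxes form a generating family closed under intersection. The factor [c] is there because
    [joint_power_unique] applies this to a measure restricted to a fixed set in the other factor,
    whose total mass is not 1. *)
Lemma power_unique n (nu : {measure set (n.-tuple T) -> \bar R}) (c : R) :
  0 <= c ->
  (forall A : 'I_n -> set T, (forall i, measurable (A i)) ->
    nu (box A) = (c%:E * \prod_(i < n) mu (A i))%E) ->
  forall X, measurable X -> nu X = (c%:E * power n X)%E.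
Proof.
move=> c0 nuE X mX.
have boxE := @measurable_tupleE n.
pose m2 : {measure set (n.-tuple T) -> \bar R} := mscale (NngNum c0) (power n).
have boxT : box (fun=> setT) = [set: n.-tuple T] by apply/seteqP; split.
apply: (@measure_unique _ R (n.-tuple T) _ (fun=> setT) boxE _ _ _ nu m2) => //.
- move=> _ _ [A mA <-] [B mB <-]; exists (fun i => A i `&` B i).
    by move=> i; exact: measurableI.
  apply/seteqP; split=> t /=.
    by move=> AB; split=> i; have [] := AB i.
  by move=> [At Bt] i; split; [exact: At|exact: Bt].
- by move=> i; rewrite -boxT; exists (fun=> setT).
- by apply/seteqP; split => // t _; exists 0%N.
- by move=> _ [A mA <-]; rewrite nuE//= /mscale/= power_box.
- move=> _; rewrite -boxT nuE//.
  rewrite big1 ?mule1 ?ltry// => i _.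
  exact: probability_setT.
Qed.

(** The product rule is extended one factor at a time: with a box fixed on the left, the measure in
    the right factor is a multiple of [power p]; then an arbitrary measurable set is fixed on the
    right and the left factor is treated in the same way. *)
Lemma joint_power_unique n p
    (nu : {measure set (n.-tuple T * p.-tuple T) -> \bar R}) :
  (forall (A : 'I_n -> set T) (B : 'I_p -> set T),
     (forall i, measurable (A i)) -> (forall i, measurable (B i)) ->
     nu (box A `*` box B) =
       (\prod_(i < n) mu (A i) * \prod_(i < p) mu (B i))%E) ->
  forall X, measurable X -> nu X = (power n \x power p)%E X.
Proof.
move=> nuE X mX; apply/esym; apply: product_measure_unique => // A B mA mB.
have prodfin k (C : 'I_k -> set T) : (forall i, measurable (C i)) ->
    exists2 c : R, 0 <= c & (\prod_(i < k) mu (C i))%E = c%:E.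
  move=> mC; exists (fine (\prod_(i < k) mu (C i))%E).
    by rewrite fine_ge0// prode_ge0.
  rewrite fineK// -power_box// fin_num_measure//; exact: measurable_box.
have stepB (C : 'I_n -> set T) : (forall i, measurable (C i)) ->
    nu (box C `*` B) = (\prod_(i < n) mu (C i) * power p B)%E.
  move=> mC; have [c c0 cE] := prodfin _ _ mC; rewrite cE.
  have mbC := measurable_box mC.
  pose nu1' : {measure set (p.-tuple T) -> \bar R} :=
    pushforward (mrestr nu (measurableX mbC measurableT)) snd.
  pose nu1 := nu1' measurable_snd.
  have nu1E D : measurable D -> nu1 D = nu (box C `*` D).
    move=> mD; rewrite /nu1/nu1'/= /pushforward/= /mrestr; congr (nu _).
    by apply/seteqP; split => -[x y]//= []//= ? [].
  rewrite -nu1E//; apply: power_unique => // D mD.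
  rewrite nu1E; last exact: measurable_box.
  by rewrite nuE// cE.
have [b b0 bE] : exists2 b : R, 0 <= b & (power p B = b%:E)%E.
  exists (fine (power p B)); first by rewrite fine_ge0.
  by rewrite fineK// fin_num_measure.
rewrite [X in (_ * X)%E]bE muleC.
pose nu2' : {measure set (n.-tuple T) -> \bar R} :=
  pushforward (mrestr nu (measurableX measurableT mB)) fst.
pose nu2 := nu2' measurable_fst.
have nu2E D : measurable D -> nu2 D = nu (D `*` B).
  move=> mD; rewrite /nu2/nu2'/= /pushforward/= /mrestr; congr (nu _).
  by apply/seteqP; split => -[x y]//= []//= ? [].
rewrite -nu2E//; apply: power_unique => //.
move=> C mC; rewrite nu2E; last exact: measurable_box.
by rewrite stepB// bE muleC.
Qed.

End power_probability.

(** * Joint law of the two samples *)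

Section joint_law.
Context {R : realType} {d : nat} {dO : measure_display}
  {Omega : measurableType dO} (P : probability Omega R) (m : nat).
Variables (mu : probability (d.-tuple R) R).
Variables (X Y : 'I_m -> {RV P >-> d.-tuple R}).
Hypothesis XYi : mutually_independent
  (fun k : 'I_m + 'I_m => match k with inl i => X i | inr i => Y i end).
Hypothesis Xmu : forall i A, measurable A -> distribution P (X i) A = mu A.
Hypothesis Ymu : forall i A, measurable A -> distribution P (Y i) A = mu A.

Definition sample (Z : 'I_m -> {RV P >-> d.-tuple R}) (w : Omega) :
  m.-tuple (d.-tuple R) := [tuple Z i w | i < m].

Lemma measurable_sample Z : measurable_fun setT (sample Z).
Proof.
apply/measurable_fun_tnthP => i; rewrite (_ : _ \o _ = Z i)//.
by apply/funext => w /=; rewrite tnth_mktuple.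
Qed.

Definition sample2 (w : Omega) := (sample X w, sample Y w).

Lemma measurable_sample2 : measurable_fun setT sample2.
Proof. by apply/measurable_fun_pairP; split; exact: measurable_sample. Qed.

HB.instance Definition _ :=
  isMeasurableFun.Build _ _ _ _ sample2 measurable_sample2.

(** Mutual independence is the product rule on pairs of boxes, so the tail estimates can be made on
    the product of two powers of [mu] instead of on [Omega]. *)
Lemma sample2_law A : measurable A ->
  distribution P sample2 A = (power mu m \x power mu m)%E A.
Proof.
apply: joint_power_unique => B C mB mC.
pose BC (k : 'I_m + 'I_m) := match k with inl i => B i | inr i => C i end.
have E : sample2 @^-1` (box B `*` box C) = \bigcap_(k in [set: 'I_m + 'I_m])
    ((match k with inl i => X i | inr i => Y i end : {RV P >-> d.-tuple R})
      @^-1` BC k).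
  apply/seteqP; split => w /=.
    move=> [wB wC] [i|i] _ /=.
      by have := wB i; rewrite tnth_mktuple.
    by have := wC i; rewrite tnth_mktuple.
  move=> wBC; split=> i /=; rewrite tnth_mktuple.
    exact: (wBC (inl i) I).
  exact: (wBC (inr i) I).
rewrite -[LHS]/(P (sample2 @^-1` (box B `*` box C))) E.
rewrite XYi; last by case=> i; [exact: mB|exact: mC].
rewrite big_sumType/=; congr (_ * _)%E; apply: eq_bigr => i _.
  exact: Xmu.
exact: Ymu.
Qed.

Definition sample1 (i j : 'I_m) (w : Omega) := (X j w, Y i w).

Lemma measurable_sample1 i j : measurable_fun setT (sample1 i j).
Proof. by apply/measurable_fun_pairP; split. Qed.

HB.instance Definition _ i j :=
  isMeasurableFun.Build _ _ _ _ (sample1 i j) (measurable_sample1 i j).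

(** The product rule with all sets but two equal to [setT]. It gives the mean of a single summand
    and shows that clipping changes it only on a null event. *)
Lemma sample1_law i j A : measurable A ->
  distribution P (sample1 i j) A = (mu \x mu)%E A.
Proof.
move=> mA; apply/esym; apply: product_measure_unique => // B C mB mC.
pose BC (k : 'I_m + 'I_m) := match k with
  | inl k => if k == j then B else setT | inr k => if k == i then C else setT end.
have E : sample1 i j @^-1` (B `*` C) = \bigcap_(k in [set: 'I_m + 'I_m])
    ((match k with inl i => X i | inr i => Y i end : {RV P >-> d.-tuple R})
      @^-1` BC k).
  apply/seteqP; split => w /=.
    move=> [wB wC] [k|k] _ /=.
      by case: eqP => // ->.
    by case: eqP => // ->.
  move=> wBC; split=> /=.
    by have := wBC (inl j) I; rewrite /BC eqxx.
  by have := wBC (inr i) I; rewrite /BC eqxx.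
rewrite -[LHS]/(P (sample1 i j @^-1` (B `*` C))) E.
rewrite XYi; last by case=> k /=; case: ifP.
rewrite big_sumType/= (bigD1 j)//= big1 => [|k kj]; last first.
  by rewrite (negbTE kj) preimage_setT probability_setT.
rewrite (bigD1 i)//= big1 => [|k ki]; last first.
  by rewrite (negbTE ki) preimage_setT probability_setT.
by rewrite !eqxx !mule1 -(Xmu j)// -(Ymu i).
Qed.

End joint_law.

(** * Exponential moments and tail bounds *)

(** Squaring [1 - y/2 <= expR (-y/2)] gives [expR y * (1 - y/2)^2 <= 1], so it suffices that the
    quadratic times [(1 - y/2)^2] is at least 1. The excess over 1 is [y^2/4 * (1 - 3y + y^2)],
    which is nonnegative for [y <= 1/3], however negative [y] is. *)
Lemma expR_le_quad {R : realType} (y : R) : y <= 3^-1 ->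
  expR y <= 1 + y + y ^+ 2.
Proof.
move=> y3; have e0 := expR_ge1Dx (- (y / 2)).
have h0 : 0 < 1 - y / 2 by lra.
have E : expR y * expR (- (y / 2)) ^+ 2 = 1.
  rewrite expr2 -!expRD -[RHS]expR0; congr expR; lra.
have H : expR y * (1 - y / 2) ^+ 2 <= 1.
  rewrite -[leRHS]E ler_wpM2l ?expR_ge0// ler_pXn2r// ?nnegrE ?expR_ge0//.
  exact: ltW.
have P : 1 <= (1 + y + y ^+ 2) * (1 - y / 2) ^+ 2.
  rewrite (_ : _ * _ = 1 + y ^+ 2 / 4 * (1 - 3 * y + y ^+ 2)); last by field.
  by rewrite lerDl mulr_ge0// ?divr_ge0 ?sqr_ge0//; have := sqr_ge0 y; lra.
by rewrite -(ler_pM2r (exprn_gt0 2 h0)); exact: le_trans P.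
Qed.

Lemma expR_le_chord {R : realType} (b y : R) : 0 < b -> 0 <= y <= b ->
  expR y <= 1 + y * ((expR b - 1) / b).
Proof.
move=> b0 /andP[y0 yb].
have t01 : 0 <= y / b <= 1 
  by rewrite ler_pdivrMr// mul1r yb andbT divr_ge0// ltW.
have := @convex_expR R (Itv01 (andP t01).1 (andP t01).2) b 0.
rewrite !convRE/= /unstable.onem expR0 mulr0 addr0 divfK ?gt_eqF// mulr1.
by move=> /le_trans; apply; rewrite le_eqVlt; apply/orP; left; apply/eqP; lra.
Qed.

Section bounded_measurable.
Context {dT : measure_display} {T : measurableType dT} {R : realType}.
Implicit Types phi psi : T -> R.

(** Under a probability measure this class is integrable, and it is stable under the operations
    below and under partial integration ([bdm_int]). Once the kernel is clipped, the integrands of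
    the concentration argument stay in it, so real integrals can be handled algebraically. *)
Definition bounded_measurable phi :=
  measurable_fun setT phi /\ exists M : R, forall x, `|phi x| <= M.

Lemma bdm_cst (c : R) : bounded_measurable (fun=> c).
Proof. by split; [exact: measurable_cst|exists `|c|]. Qed.

Lemma bdmD phi psi : bounded_measurable phi -> bounded_measurable psi ->
  bounded_measurable (fun x => phi x + psi x).
Proof.
move=> [mf [M hM]] [mg [N hN]]; split; first exact: measurable_funD.
by exists (M + N) => x; rewrite (le_trans (ler_normD _ _))// lerD.
Qed.

Lemma bdmN phi : bounded_measurable phi -> bounded_measurable (fun x => - phi x).
Proof.
move=> [mf [M hM]]; split; first exact: measurableT_comp.
by exists M => x; rewrite normrN.
Qed.

Lemma bdmB phi psi : bounded_measurable phi -> bounded_measurable psi ->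
  bounded_measurable (fun x => phi x - psi x).
Proof. by move=> h1 h2; apply: bdmD => //; exact: bdmN. Qed.

Lemma bdmM phi psi : bounded_measurable phi -> bounded_measurable psi ->
  bounded_measurable (fun x => phi x * psi x).
Proof.
move=> [mf [M hM]] [mg [N hN]]; split; first exact: measurable_funM.
by exists (M * N) => x; rewrite normrM ler_pM.
Qed.

Lemma bdm_norm phi : bounded_measurable phi ->
  bounded_measurable (fun x => `|phi x|).
Proof.
move=> [mf [M hM]]; split; first exact: measurableT_comp.
by exists M => x; rewrite normr_id.
Qed.

Lemma bdm_sum (I : Type) (s : seq I) (phi : I -> T -> R) :
  (forall i, bounded_measurable (phi i)) ->
  bounded_measurable (fun x => \sum_(i <- s) phi i x).
Proof.
move=> h; elim: s => [|i s IH].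
  by under eq_fun do rewrite big_nil; exact: bdm_cst.
by under eq_fun do rewrite big_cons; exact: bdmD.
Qed.

Lemma bdm_ge0_le phi (M : R) : measurable_fun setT phi ->
  (forall x, 0 <= phi x <= M) -> bounded_measurable phi.
Proof.
move=> mf h; split => //; exists M => x.
by have /andP[h0 h1] := h x; rewrite ger0_norm.
Qed.

Variable mu : probability T R.

Lemma bdm_integrable phi : bounded_measurable phi ->
  mu.-integrable setT (EFin \o phi).
Proof.
move=> [mf [M hM]]; apply: measurable_bounded_integrable => //.
  exact: le_lt_trans (probability_le1 mu measurableT) (ltry 1).
exists M; split; first exact: num_real.
by move=> y My x _; exact: le_trans (hM x) (ltW My).
Qed.

Lemma bdm_EFin phi : bounded_measurable phi ->
  (\int[mu]_x (phi x)%:E)%E = (\int[mu]_x phi x)%:E.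
Proof.
move=> h; rewrite /Rintegral fineK//.
exact: integrable_fin_num (bdm_integrable h).
Qed.

Lemma bdm_le phi psi : bounded_measurable phi -> bounded_measurable psi ->
  (forall x, phi x <= psi x) -> \int[mu]_x phi x <= \int[mu]_x psi x.
Proof. by move=> /bdm_integrable h1 /bdm_integrable h2 h; apply: le_Rintegral. Qed.

Lemma bdm_intcst (c : R) : \int[mu]_x c = c.
Proof.
rewrite /Rintegral integral_cst// [X in (_ * X)%E](_ : _ = 1%E) ?mule1//.
exact: probability_setT.
Qed.

Lemma bdm_intD phi psi : bounded_measurable phi -> bounded_measurable psi ->
  \int[mu]_x (phi x + psi x) = \int[mu]_x phi x + \int[mu]_x psi x.
Proof. by move=> /bdm_integrable h1 /bdm_integrable h2; rewrite RintegralD. Qed.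

Lemma bdm_intB phi psi : bounded_measurable phi -> bounded_measurable psi ->
  \int[mu]_x (phi x - psi x) = \int[mu]_x phi x - \int[mu]_x psi x.
Proof. by move=> /bdm_integrable h1 /bdm_integrable h2; rewrite RintegralB. Qed.

Lemma bdm_intZ (c : R) phi : bounded_measurable phi ->
  \int[mu]_x (c * phi x) = c * \int[mu]_x phi x.
Proof. by move=> /bdm_integrable h1; rewrite RintegralZl. Qed.

Lemma bdm_int_sum (I : Type) (s : seq I) (phi : I -> T -> R) :
  (forall i, bounded_measurable (phi i)) ->
  \int[mu]_x (\sum_(i <- s) phi i x) = \sum_(i <- s) \int[mu]_x phi i x.
Proof.
move=> h; elim: s => [|i s IH].
  by under eq_Rintegral do rewrite big_nil; rewrite bdm_intcst big_nil.
under eq_Rintegral do rewrite big_cons.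
by rewrite bdm_intD//; [rewrite IH big_cons|exact: bdm_sum].
Qed.

Lemma bdm_int_ge0 phi : (forall x, 0 <= phi x) -> 0 <= \int[mu]_x phi x.
Proof. by move=> h; apply: Rintegral_ge0 => x _; exact: h. Qed.

Lemma bdm_int_le_cst phi (M : R) : bounded_measurable phi ->
  (forall x, phi x <= M) -> \int[mu]_x phi x <= M.
Proof.
by move=> h hM; rewrite -[leRHS]bdm_intcst; apply: bdm_le => //; exact: bdm_cst.
Qed.

Lemma bdm_int_norm phi : bounded_measurable phi ->
  `|\int[mu]_x phi x| <= \int[mu]_x `|phi x|.
Proof. by move=> h; apply: le_normr_Rintegral => //; exact: bdm_integrable. Qed.

(** Bernstein's exponential moment without centring: integrate [expR_le_quad], then use
    [1 + x <= expR x]. The raw second moment stands in for the variance. *)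
Lemma mgf_le_quad phi (B v lam : R) : measurable_fun setT phi ->
  (forall x, `|phi x| <= B) -> \int[mu]_x phi x ^+ 2 <= v ->
  0 <= lam -> lam * B <= 3^-1 ->
  (\int[mu]_x (expR (lam * phi x))%:E <=
   (expR (lam * \int[mu]_x phi x + lam ^+ 2 * v))%:E)%E.
Proof.
move=> mphi phiB phiv lam0 lamB.
have bphi : bounded_measurable phi by split => //; exists B.
have bphi2 : bounded_measurable (fun x => phi x ^+ 2) by exact: bdmM.
have b1 : bounded_measurable (fun x => 1 + lam * phi x).
  by apply: bdmD; [exact: bdm_cst|apply: bdmM => //; exact: bdm_cst].
have b2 : bounded_measurable (fun x => lam ^+ 2 * phi x ^+ 2).
  by apply: bdmM => //; exact: bdm_cst.
apply: (@le_trans _ _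
   (\int[mu]_x (1 + lam * phi x + lam ^+ 2 * phi x ^+ 2)%:E)%E).
  apply: ge0_le_integral => //.
  - apply/measurable_EFinP; apply: measurableT_comp => //.
    exact: measurable_funM.
  - by apply/measurable_EFinP; apply: (bdmD b1 b2).1.
  move=> x _; rewrite lee_fin -exprMn; apply: expR_le_quad.
  apply: le_trans lamB; apply: ler_wpM2l => //.
  exact: le_trans (ler_norm _) (phiB x).
rewrite bdm_EFin; last exact: bdmD.
rewrite bdm_intD// bdm_intD//; last 2 first.
- exact: bdm_cst.
- by apply: bdmM => //; exact: bdm_cst.
rewrite bdm_intcst !bdm_intZ// lee_fin -addrA.
apply: le_trans (expR_ge1Dx _).
by rewrite lerD2l lerD2l ler_wpM2l// sqr_ge0.
Qed.

(** Convexity puts the exponential below its chord on [[0, lam * B]]. The bound is the exponential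
    moment of [B] times a Poisson variable of mean [e / B], which makes it sharp for large exponents
    too. *)
Lemma mgf_le_chord phi (B e lam : R) : measurable_fun setT phi -> 0 < B ->
  (forall x, 0 <= phi x <= B) -> \int[mu]_x phi x <= e -> 0 < lam ->
  (\int[mu]_x (expR (lam * phi x))%:E <=
   (expR (e * ((expR (lam * B) - 1) / B)))%:E)%E.
Proof.
move=> mphi B0 phiB phie lam0.
have bphi : bounded_measurable phi by exact: (bdm_ge0_le mphi phiB).
set c := (expR (lam * B) - 1) / B.
have c0 : 0 <= c.
  apply: divr_ge0; last exact: ltW.
  by rewrite subr_ge0 -[leLHS]expR0 ler_expR mulr_ge0// ltW.
have b1 : bounded_measurable (fun x => c * phi x).
  by apply: bdmM => //; exact: bdm_cst.
apply: (@le_trans _ _ (\int[mu]_x (1 + c * phi x)%:E)%E).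
  apply: ge0_le_integral => //.
  - apply/measurable_EFinP; apply: measurableT_comp => //.
    exact: measurable_funM.
  - by apply/measurable_EFinP; apply: (bdmD (bdm_cst 1) b1).1.
  move=> x _; have /andP[p0 pB] := phiB x; rewrite lee_fin.
  apply: le_trans (expR_le_chord (b := lam * B) _ _) _; first exact: mulr_gt0.
    by rewrite ler_pM2l// pB andbT mulr_ge0// ltW.
  rewrite lerD2l le_eqVlt; apply/orP; left; apply/eqP; rewrite /c; field.
  by rewrite !gt_eqF.
rewrite bdm_EFin; last by apply: bdmD => //; exact: bdm_cst.
rewrite bdm_intD//; last exact: bdm_cst.
rewrite bdm_intcst bdm_intZ// lee_fin.
apply: le_trans (expR_ge1Dx _).
by rewrite lerD2l mulrC ler_wpM2r.
Qed.

End bounded_measurable.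

Lemma measure_cover2 {dS : measure_display} {S : measurableType dS}
    {R : realType} (nu : {measure set S -> \bar R}) (A B C : set S)
    (b c : \bar R) :
  measurable A -> measurable B -> measurable C -> A `<=` B `|` C ->
  (nu B <= b)%E -> (nu C <= c)%E -> (nu A <= b + c)%E.
Proof.
move=> mA mB mC ABC hb hc; apply: le_trans (leeD hb hc).
apply: le_trans (measureU2 _ mB mC).
by apply: le_measure => //; rewrite inE//; exact: measurableU.
Qed.

Lemma measurable_gt_set {dS : measure_display} {S : measurableType dS}
    {R : realType} (F : S -> R) (c : R) :
  measurable_fun setT F -> measurable [set x | c < F x].
Proof.
move=> mF; rewrite (_ : mkset _ = F @^-1` `]c, +oo[); last first.
  by apply/seteqP; split => x /=; rewrite in_itv/= andbT.
by rewrite -[_ @^-1` _]setTI; apply: mF.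
Qed.

Section tail_bounds.
Context {dS : measure_display} {S : measurableType dS} {R : realType}.
Variable nu : probability S R.

Lemma exp_markov (F : S -> R) (u : R) (A : set S) :
  measurable_fun setT F -> measurable A ->
  (\int[nu]_x (expR (F x))%:E <= 1)%E -> (forall x, A x -> u <= F x) ->
  (nu A <= (expR (- u))%:E)%E.
Proof.
move=> mF mA F1 AF.
have mexp : measurable_fun setT (fun x => (expR (F x))%:E).
  by apply/measurable_EFinP; exact: measurableT_comp.
rewrite -[A]setIT -(integral_indic nu measurableT mA).
apply: (@le_trans _ _ (\int[nu]_x ((expR (- u))%:E * (expR (F x))%:E))%E).
  apply: ge0_le_integral => //.
  - by apply/measurable_EFinP; exact: measurable_indic.
  - by apply: emeasurable_funM => //; exact: measurable_cst.
  move=> x _; rewrite -EFinM lee_fin -expRD indicE.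
  have [/[!inE] Ax|_] := boolP (x \in A); last exact: expR_ge0.
  by rewrite -expR0 ler_expR addrC subr_ge0; exact: AF.
rewrite ge0_integralZl_EFin ?expR_ge0//.
by rewrite -[leRHS]mule1 lee_pmul2l// lte_fin expR_gt0.
Qed.

Lemma markov_ge0 (F : S -> \bar R) (c e : R) (A : set S) :
  measurable_fun setT F -> measurable A -> (forall x, 0 <= F x)%E -> 0 < c ->
  (\int[nu]_x F x <= e%:E)%E -> (forall x, A x -> c%:E <= F x)%E ->
  (nu A <= (e / c)%:E)%E.
Proof.
move=> mF mA F0 c0 Fe AF.
rewrite -[A]setIT -(integral_indic nu measurableT mA).
rewrite EFinM lee_pdivlMr//.
apply: le_trans Fe; rewrite muleC -ge0_integralZl_EFin//; last 2 first.
- by apply/measurable_EFinP; exact: measurable_indic.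
- exact: ltW.
apply: ge0_le_integral => //.
- by move=> x _; rewrite -EFinM lee_fin; apply: mulr_ge0 => //; exact: ltW.
- by apply: emeasurable_funM; [exact: measurable_cst|
    apply/measurable_EFinP; exact: measurable_indic].
move=> x _; rewrite indicE; have [/[!inE] Ax|_] := boolP (x \in A).
  by rewrite mule1; exact: AF.
by rewrite mule0.
Qed.

End tail_bounds.

Section power_tails.
Context {dT : measure_display} {T : measurableType dT} {R : realType}.
Variable mu : probability T R.

(** The last hypothesis says that [expR (F _)] is a supermartingale along the draws; stating it for
    every past [s] dispenses with filtrations and conditional expectations. Tonelli then integrates
    out the draws, newest first. *)
Lemma power_supermartingale (F : seq T -> R) n :
  F [::] = 0 ->
  (forall n, measurable_fun setT (fun t : n.-tuple T => F t)) ->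
  (forall s, \int[mu]_x (expR (F (x :: s)))%:E <= (expR (F s))%:E)%E ->
  (\int[power mu n]_t (expR (F t))%:E <= 1)%E.
Proof.
move=> F0 mF FS.
have mexp k : measurable_fun setT (fun t : k.-tuple T => (expR (F t))%:E).
  by apply/measurable_EFinP; exact: (measurableT_comp _ (mF k)).
elim: n => [|n IH].
  rewrite /= integral_dirac//; last exact: mexp.
  by rewrite F0 expR0 mule1 probability_le1.
rewrite ge0_integral_powerS//; apply: le_trans IH.
apply: ge0_le_integral => //.
- by move=> t _; apply: integral_ge0 => x _; rewrite lee_fin expR_ge0.
- apply: (@measurable_fun_fubini_tonelli_G _ _ _ _ _ mu
    (fun p : T * n.-tuple T => (expR (F (p.1 :: p.2)))%:E)).
    apply: (measurableT_comp (mexp n.+1)); exact: measurable_tuple_cons.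
  by move=> p; rewrite lee_fin expR_ge0.
- exact: mexp.
- by move=> t _; exact: FS.
Qed.

Lemma measurable_tuple_sum n (phi : T -> R) : measurable_fun setT phi ->
  measurable_fun setT (fun t : n.-tuple T => \sum_(x <- t) phi x).
Proof.
move=> mphi; under eq_fun do rewrite big_tuple.
by apply: measurable_sum => i; apply: measurableT_comp => //;
  exact: measurable_tnth.
Qed.

(** Independent increments: the supermartingale whose steps are [lam * phi x - c]. *)
Lemma power_sum_mgf n (phi : T -> R) (lam c : R) : measurable_fun setT phi ->
  (\int[mu]_x (expR (lam * phi x))%:E <= (expR c)%:E)%E ->
  (\int[power mu n]_t (expR (lam * (\sum_(x <- t) phi x) - n%:R * c))%:E
    <= 1)%E.
Proof.
move=> mphi phic.
pose F (s : seq T) := \sum_(x <- s) (lam * phi x - c).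
have FE (t : n.-tuple T) : F t = lam * (\sum_(x <- t) phi x) - n%:R * c.
  rewrite /F sumrB -mulr_sumr; congr (_ - _).
  by rewrite big_const_seq count_predT size_tuple iter_addr_0 mulr_natl.
under eq_integral do rewrite -FE.
apply: power_supermartingale => [|k|s].
- by rewrite /F big_nil.
- apply: measurable_tuple_sum; apply: measurable_funB => //.
  exact: measurable_funM.
- rewrite /F.
  under eq_integral do
    rewrite big_cons -addrA (addrC (- c)) addrC expRD EFinM.
  rewrite ge0_integralZl_EFin ?expR_ge0//; last first.
    by apply/measurable_EFinP; apply: measurableT_comp => //;
      exact: measurable_funM.
  set E := \sum_(_ <- _) _.
  rewrite [in leRHS](_ : expR E = expR (E - c) * expR c); last first.
    by rewrite -expRD subrK.
  rewrite EFinM lee_pmul2l//.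
  by rewrite lte_fin expR_gt0.
Qed.

(** If [n v lam^2 <= u] and [lam] times the threshold is at least [2 u], the Chernoff exponent is at
    least [u]. The square root in the threshold supplies [2 u] for the optimal [lam], and [8 B u]
    supplies it for the capped value [1 / (4 B)]. *)
Lemma bernstein_tail n (phi : T -> R) (B v u : R) (A : set (n.-tuple T)) :
  (0 < n)%N -> 0 < B -> 0 < v -> 0 < u ->
  measurable_fun setT phi -> (forall x, `|phi x| <= B) ->
  \int[mu]_x phi x ^+ 2 <= v -> measurable A ->
  (forall t, A t -> 2 * Num.sqrt (n%:R * v * u) + 8 * B * u <
     \sum_(x <- t) phi x - n%:R * \int[mu]_x phi x) ->
  (power mu n A <= (expR (- u))%:E)%E.
Proof.
move=> n0 B0 v0 u0 mphi phiB phiv mA AP.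
have nv0 : 0 < n%:R * v by rewrite mulr_gt0// ltr0n.
(* [lam] is the optimal [sqrt (u / (n v))], capped so that [lam B <= 1/4]. *)
have [lam [lam0 lamB lamv lamx]] : exists lam, [/\ 0 < lam, lam * B <= 4^-1,
    n%:R * v * lam ^+ 2 <= u &
    2 * u <= lam * (2 * Num.sqrt (n%:R * v * u) + 8 * B * u)].
  have [h|h] := leP (n%:R * v) (16 * B ^+ 2 * u).
    exists (4 * B)^-1; split.
    - by rewrite invr_gt0; lra.
    - by rewrite invfM divfK// gt_eqF.
    - rewrite exprVn ler_pdivrMr ?exprn_gt0//; last by lra.
      by rewrite (_ : u * _ = 16 * B ^+ 2 * u)//; ring.
    - rewrite mulrDr (_ : _ * (8 * B * u) = 2 * u); last first.
        by field; rewrite gt_eqF.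
      rewrite lerDr mulr_ge0// ?mulr_ge0 ?sqrtr_ge0// invr_ge0; lra.
  pose r := Num.sqrt (n%:R * v * u).
  have r0 : 0 < r by rewrite sqrtr_gt0 mulr_gt0.
  have rr : r ^+ 2 = n%:R * v * u by rewrite sqr_sqrtr// ltW// mulr_gt0.
  exists (u / r); split.
  - exact: divr_gt0.
  - rewrite mulrAC ler_pdivrMr// ler_pdivlMl//.
    rewrite -(@ler_pXn2r _ 2)// ?nnegrE; last 2 first.
    + by rewrite !mulr_ge0// ltW.
    + exact: ltW.
    rewrite rr (_ : (4 * _) ^+ 2 = 16 * B ^+ 2 * u * u); last by ring.
    by rewrite ler_pM2r// ltW.
  - rewrite exprMn exprVn rr.
    rewrite (_ : _ * _ = u)//; field.
    by rewrite !gt_eqF//= ltr0n.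
  - rewrite -/r mulrDr (_ : u / r * (2 * r) = 2 * u); last first.
      by field; rewrite gt_eqF.
    by rewrite lerDl; apply: mulr_ge0; [exact/ltW/divr_gt0|
      rewrite !mulr_ge0// ltW].
have mgf := mgf_le_quad mphi phiB phiv (ltW lam0) (le_trans lamB _).
have {}mgf := power_sum_mgf n mphi (mgf ltac:(lra)).
apply: (exp_markov _ mA mgf) => [|t At].
  apply: measurable_funB => //; apply: measurable_funM => //.
  exact: measurable_tuple_sum.
have := AP t At; set S := \sum_(_ <- _) _; set e := \int[mu]_x _.
rewrite -(ltr_pM2l lam0) => /(le_lt_trans lamx) H.
rewrite (_ : _ - _ = lam * (S - n%:R * e) - n%:R * v * lam ^+ 2); last by ring.
lra.
Qed.

Lemma bernstein_tail2 n (phi : T -> R) (B v u : R) :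
  (0 < n)%N -> 0 < B -> 0 < v -> 0 < u ->
  measurable_fun setT phi -> (forall x, `|phi x| <= B) ->
  \int[mu]_x phi x ^+ 2 <= v ->
  (power mu n [set t | (2 * Num.sqrt (n%:R * v * u) + 8 * B * u <
     `|\sum_(x <- t) phi x - n%:R * \int[mu]_x phi x|)%R]
   <= (2 * expR (- u))%:E)%E.
Proof.
move=> n0 B0 v0 u0 mphi phiB phiv.
set c := 2 * _ + _; set e := \int[mu]_x phi x.
have mS : measurable_fun setT
    (fun t : n.-tuple T => \sum_(x <- t) phi x - n%:R * e).
  by apply: measurable_funB => //; exact: measurable_tuple_sum.
rewrite mulr2n mulrDl mul1r EFinD.
have bphi : bounded_measurable phi by split => //; exists B.
apply: (@measure_cover2 _ _ _ _ _
  [set t : n.-tuple T | c < \sum_(x <- t) phi x - n%:R * e]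
  [set t : n.-tuple T | c < - (\sum_(x <- t) phi x - n%:R * e)]).
- by apply: measurable_gt_set; exact: measurableT_comp.
- exact: measurable_gt_set.
- by apply: measurable_gt_set; exact: measurableT_comp.
- move=> t /=; rewrite ltr_normr => /orP[]; [by left|by right].
- apply: (bernstein_tail n0 B0 v0 u0 mphi phiB phiv) => //.
  exact: measurable_gt_set.
- apply: (bernstein_tail (phi := fun x => - phi x) n0 B0 v0 u0) => //.
  + exact: measurableT_comp.
  + by move=> x; rewrite normrN.
  + by under eq_Rintegral do rewrite sqrrN.
  + by apply: measurable_gt_set; exact: measurableT_comp.
  + move=> t /=; rewrite sumrN -mulN1r.
    under [in X in _ -> X]eq_Rintegral do rewrite -mulN1r.
    by rewrite bdm_intZ// !mulN1r mulrN opprB opprK [- _ + _]addrC.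
Qed.

(** The exponent [lam] is left to the caller: [1 / (4 w)] for the row sums, and the regime-dependent
    [th] for exceeding [tau]. *)
Lemma chord_tail n (phi : T -> R) (B e lam u c : R) :
  0 < B -> measurable_fun setT phi -> (forall x, 0 <= phi x <= B) ->
  \int[mu]_x phi x <= e -> 0 < lam ->
  u + n%:R * e * ((expR (lam * B) - 1) / B) <= lam * c ->
  (power mu n [set t | (c < \sum_(x <- t) phi x)%R] <= (expR (- u))%:E)%E.
Proof.
move=> B0 mphi phiB phie lam0 uc.
have mgf := mgf_le_chord mphi B0 phiB phie lam0.
have {}mgf := power_sum_mgf n mphi mgf.
apply: (exp_markov _ _ mgf) => [||t /=].
- apply: measurable_funB => //; apply: measurable_funM => //.
  exact: measurable_tuple_sum.
- apply: measurable_gt_set; exact: measurable_tuple_sum.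
- rewrite -(ltr_pM2l lam0); set S := \sum_(_ <- _) _ => H; lra.
Qed.

End power_tails.

(** * Concentration of the two-sample sum *)

Section parametrized_integrals.
Context {dS dT : measure_display} {S : measurableType dS} {T : measurableType dT}
  {R : realType}.

Lemma bdm_comp (g : S -> T) (phi : T -> R) : measurable_fun setT g ->
  bounded_measurable phi -> bounded_measurable (fun x => phi (g x)).
Proof.
move=> mg [mphi [M hM]]; split; first exact: measurableT_comp.
by exists M => x; exact: hM.
Qed.

Lemma bdm_int (mu : probability T R) (h : S * T -> R) :
  bounded_measurable h ->
  bounded_measurable (fun s => \int[mu]_y h (s, y)).
Proof.
move=> [mh [M hM]].
have bh s : bounded_measurable (fun y => h (s, y)).
  by split; [exact: measurableT_comp|exists M => y; exact: hM].
split.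
(* Adding [M] makes the integrand nonnegative, so that measurability of the partial integral follows
   from Tonelli; the constant is subtracted afterwards. *)
- have mhM : measurable_fun setT (fun p : S * T => (h p + M)%:E).
    by apply/measurable_EFinP; apply: measurable_funD.
  have hM0 p : (0 <= (h p + M)%:E)%E.
    by rewrite lee_fin -lerBlDr sub0r; have := hM p; rewrite ler_norml => /andP[].
  have := @measurable_fun_fubini_tonelli_F _ _ S T R mu _ mhM hM0.
  move=> /(measurableT_comp (fine_measurable measurableT)) mF.
  rewrite (_ : (fun s => _) =
    (fun s => fine (\int[mu]_y (h (s, y) + M)%:E)%E - M)); last first.
    apply/funext => s; rewrite bdm_EFin; last exact: bdmD (bh s) (bdm_cst M).
    by rewrite bdm_intD ?bdm_intcst//=; [rewrite addrK|exact: bdm_cst].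
  by apply: measurable_funB => //; exact: mF.
- exists M => s; apply: (le_trans (bdm_int_norm mu (bh s))) => /=.
  by apply: bdm_int_le_cst => //; exact: bdm_norm.
Qed.

Lemma integral_int_swap (mu : probability S R) (nu : probability T R)
    (h : S * T -> R) : bounded_measurable h ->
  \int[mu]_x \int[nu]_y h (x, y) = \int[nu]_y \int[mu]_x h (x, y).
Proof.
move=> bh.
have bh1 x : bounded_measurable (fun y => h (x, y)).
  by case: bh => mh [M hM]; split; [exact: measurableT_comp|exists M].
have bh2 y : bounded_measurable (fun x => h (x, y)).
  by case: bh => mh [M hM]; split; [exact: measurableT_comp|exists M].
have ih : (mu \x nu)%E.-integrable setT (EFin \o h).
  exact: (@bdm_integrable _ _ _ (mu \x nu)%E h bh).
rewrite /Rintegral; congr fine.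
transitivity (\int[mu]_x \int[nu]_y (EFin \o h) (x, y))%E.
  by apply: eq_integral => x _; rewrite bdm_EFin//; exact: bh1.
rewrite (Fubini ih).
by apply: eq_integral => y _; rewrite bdm_EFin//; exact: bh2.
Qed.

Lemma product_le_xsection (mu : probability S R) (nu : probability T R)
    (A : set (S * T)) (c : R) : measurable A ->
  (forall x, nu [set y | A (x, y)] <= c%:E)%E -> ((mu \x nu) A <= c%:E)%E.
Proof.
move=> mA Ac; rewrite /product_measure1.
apply: (@le_trans _ _ (\int[mu]_x (cst c%:E x))%E); last first.
  rewrite integral_cst// [X in (_ * X)%E](_ : _ = 1%E) ?mule1//.
  exact: probability_setT.
apply: ge0_le_integral => //.
- exact: measurable_fun_xsection.
move=> x _ /=; rewrite (_ : xsection A x = [set y | A (x, y)])//.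
by apply/seteqP; split => y /=; rewrite /xsection/= inE.
Qed.

End parametrized_integrals.

Lemma product_le_ysection {dS dT : measure_display} {S : measurableType dS}
    {T : measurableType dT} {R : realType}
    (mu : probability S R) (nu : probability T R)
    (A : set (S * T)) (c : R) : measurable A ->
  (forall y, mu [set x | A (x, y)] <= c%:E)%E -> ((mu \x nu) A <= c%:E)%E.
Proof.
move=> mA Ac.
rewrite -[A]setIT -(integral_indic _ measurableT mA).
have mI : measurable_fun setT (fun p : S * T => (\1_A p)%:E : \bar R).
  by apply/measurable_EFinP; exact: measurable_indic.
have I0 (p : S * T) : (0 <= (\1_A p)%:E :> \bar R)%E by rewrite lee_fin.
rewrite (@fubini_tonelli2 _ _ S T R mu nu _ mI I0).
apply: (@le_trans _ _ (\int[nu]_x (cst c%:E x))%E); last first.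
  rewrite integral_cst// [X in (_ * X)%E](_ : _ = 1%E) ?mule1//.
  exact: probability_setT.
apply: ge0_le_integral => //.
- by move=> y _; apply: integral_ge0 => x _; exact: I0.
- exact: (@measurable_fun_fubini_tonelli_G _ _ S T R mu _ mI I0).
move=> y _ /=; rewrite /fubini_G.
have mAy : measurable [set x | A (x, y)].
  rewrite (_ : mkset _ = ysection A y); first exact: measurable_ysection.
  by apply/seteqP; split => x /=; rewrite /ysection/= inE.
rewrite (_ : (fun x => _) = (fun x => (\1_[set x | A (x, y)] x)%:E)).
  rewrite integral_indic// setIT; exact: Ac.
by apply/funext => x; rewrite !indicE; congr (_%:R%:E).
Qed.

Lemma bdm_tuple_sum {dS dT : measure_display} {S : measurableType dS}
    {T : measurableType dT} {R : realType} (k : T * S -> R) n :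
  bounded_measurable k ->
  bounded_measurable (fun p : n.-tuple T * S => \sum_(x <- p.1) k (x, p.2)).
Proof.
move=> bk; under eq_fun do rewrite big_tuple.
apply: bdm_sum => i.
apply: (bdm_comp (g := fun p : n.-tuple T * S => (tnth p.1 i, p.2)) _ bk).
apply/measurable_fun_pairP; split; last exact: measurable_snd.
exact: (measurableT_comp (measurable_tnth i) measurable_fst).
Qed.

Lemma bdm_tuple_sumr {dS dT : measure_display} {S : measurableType dS}
    {T : measurableType dT} {R : realType} (k : S * T -> R) n :
  bounded_measurable k ->
  bounded_measurable (fun p : S * n.-tuple T => \sum_(y <- p.2) k (p.1, y)).
Proof.
move=> bk; under eq_fun do rewrite big_tuple.
apply: bdm_sum => i.
apply: (bdm_comp (g := fun p : S * n.-tuple T => (p.1, tnth p.2 i)) _ bk).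
apply/measurable_fun_pairP; split; first exact: measurable_fst.
exact: (measurableT_comp (measurable_tnth i) measurable_snd).
Qed.

Lemma bdm_expR {dS : measure_display} {S : measurableType dS} {R : realType}
    (phi : S -> R) :
  bounded_measurable phi -> bounded_measurable (fun x => expR (phi x)).
Proof.
move=> [mphi [M hM]]; split; first exact: measurableT_comp.
exists (expR M) => x; rewrite ger0_norm ?expR_ge0// ler_expR.
exact: le_trans (ler_norm _) (hM x).
Qed.

Lemma measureU_le {dS : measure_display} {S : measurableType dS}
    {R : realType} (nu : {measure set S -> \bar R}) (B C : set S) (b c : R) :
  measurable B -> measurable C ->
  (nu B <= b%:E)%E -> (nu C <= c%:E)%E -> (nu (B `|` C) <= (b + c)%:E)%E.
Proof.
by move=> mB mC; rewrite EFinD; apply: measure_cover2 => //; exact: measurableU.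
Qed.

(** * Tail bound for a bounded kernel: [B] bounds [|k|], [w] its row and column means, [j] its total
    mean *)

Section two_sample_concentration.
Context {dT : measure_display} {T : measurableType dT} {R : realType}.
Variables (mu : probability T R) (k : T * T -> R) (B w j tau u : R).
Hypotheses (B_gt0 : 0 < B) (w_gt0 : 0 < w) (j_gt0 : 0 < j)
  (tau_gt0 : 0 < tau) (u_gt0 : 0 < u).
Hypothesis mk : measurable_fun setT k.
Hypothesis kB : forall p, `|k p| <= B.

Definition absk (p : T * T) : R := `|k p|.
Definition row_abs (x : T) : R := \int[mu]_y absk (x, y).
Definition row_mean (x : T) : R := \int[mu]_y k (x, y).
Definition total_abs : R := \int[mu]_x row_abs x.
Definition total_mean : R := \int[mu]_x row_mean x.

Hypothesis row_w : forall x, row_abs x <= w.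
Hypothesis col_w : forall y, \int[mu]_x absk (x, y) <= w.
Hypothesis total_j : total_abs <= j.

Lemma bdm_k : bounded_measurable k.
Proof. by split => //; exists B. Qed.

Lemma bdm_absk : bounded_measurable absk.
Proof. exact: bdm_norm bdm_k. Qed.

Lemma bdm_kr x : bounded_measurable (fun y => k (x, y)).
Proof. exact: bdm_comp (pair1_measurable x) bdm_k. Qed.

Lemma bdm_abskr x : bounded_measurable (fun y => absk (x, y)).
Proof. exact: bdm_comp (pair1_measurable x) bdm_absk. Qed.

Lemma bdm_abskl y : bounded_measurable (fun x => absk (x, y)).
Proof. exact: bdm_comp (pair2_measurable y) bdm_absk. Qed.

Lemma bdm_row_abs : bounded_measurable row_abs.
Proof. exact: bdm_int bdm_absk. Qed.

Lemma bdm_row_mean : bounded_measurable row_mean.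
Proof. exact: bdm_int bdm_k. Qed.

Lemma row_abs_ge0 x : 0 <= row_abs x.
Proof. by apply: bdm_int_ge0 => y; exact: normr_ge0. Qed.

Lemma row_meanE x : `|row_mean x| <= row_abs x.
Proof. exact: bdm_int_norm (bdm_kr x). Qed.

Definition Gsum (s : seq T) (y : T) : R := \sum_(x <- s) k (x, y).
Definition Asum (s : seq T) (y : T) : R := \sum_(x <- s) absk (x, y).
Definition rowsum (s : seq T) : R := \sum_(x <- s) row_abs x.

Definition below (z : R) : R := (z <= tau)%R%:R.

Lemma Asum_ge0 s y : 0 <= Asum s y.
Proof. by apply: sumr_ge0 => x _; exact: normr_ge0. Qed.

Lemma rowsum_ge0 s : 0 <= rowsum s.
Proof. by apply: sumr_ge0 => x _; exact: row_abs_ge0. Qed.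

Lemma Gsum_le s y : `|Gsum s y| <= Asum s y.
Proof. exact: ler_norm_sum. Qed.

Lemma bdm_Gsum s : bounded_measurable (Gsum s).
Proof. by apply: bdm_sum => x; exact: bdm_kr. Qed.

Lemma bdm_Asum s : bounded_measurable (Asum s).
Proof. by apply: bdm_sum => x; exact: bdm_abskr. Qed.

Lemma int_Asum s : \int[mu]_y Asum s y = rowsum s.
Proof. by rewrite bdm_int_sum// => x; exact: bdm_abskr. Qed.

Lemma int_Gsum s : \int[mu]_y Gsum s y = \sum_(x <- s) row_mean x.
Proof. by rewrite bdm_int_sum// => x; exact: bdm_kr. Qed.

Lemma below01 z : 0 <= below z <= 1.
Proof. by rewrite /below; case: (z <= tau)%R; rewrite /= lexx ler01. Qed.

Lemma bdm_below dS (S : measurableType dS) (phi : S -> R) :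
  measurable_fun setT phi -> bounded_measurable (fun s => below (phi s)).
Proof.
move=> mphi; apply: (@bdm_ge0_le _ _ _ _ 1) => [|s]; last exact: below01.
rewrite (_ : (fun s => _) = \1_(phi @^-1` `]-oo, tau])).
  apply: measurable_indic; rewrite -[_ @^-1` _]setTI; exact: mphi.
apply/funext => s; rewrite /below indicE; congr ((nat_of_bool _)%:R).
by apply/idP/idP => [h|/[!inE]/=]; rewrite ?inE/= ?in_itv.
Qed.

(** Half of what the off-diagonal part of the truncated second moment gains when [x] joins [s]. The
    indicator bears on [Asum s] alone: it can only decrease as the sequence grows, so earlier
    increments need no correction. *)
Definition cross (s : seq T) (x : T) : R :=
  \int[mu]_y (Asum s y * below (Asum s y) * absk (x, y)).

Fixpoint cross_sum (s : seq T) : R :=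
  if s is x :: s' then cross_sum s' + cross s' x else 0.

(** The sum of the bounds of [int_cross] on the conditional means of the increments of [cross_sum];
    each depends only on the draws already made. *)
Fixpoint compensator (s : seq T) : R :=
  if s is x :: s' then compensator s' + w * rowsum s' else 0.

Lemma bdm_Asum_below s :
  bounded_measurable (fun y => Asum s y * below (Asum s y)).
Proof.
by apply: bdmM; [exact: bdm_Asum|exact: bdm_below (bdm_Asum s).1].
Qed.

Lemma bdm_cross_integrand s :
  bounded_measurable (fun p : T * T =>
    Asum s p.2 * below (Asum s p.2) * absk p).
Proof.
apply: bdmM bdm_absk.
exact: (bdm_comp (g := @snd T T) measurable_snd (bdm_Asum_below s)).
Qed.

Lemma cross_bound s x : 0 <= cross s x <= tau * w.
Proof.
have h y : 0 <= Asum s y * below (Asum s y) <= tau.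
  rewrite /below; have := Asum_ge0 s y; case: (leP (Asum s y) tau) => /= h h0.
    by rewrite mulr1 h0.
  by rewrite mulr0 lexx ltW.
apply/andP; split.
  apply: bdm_int_ge0 => y; apply: mulr_ge0 (normr_ge0 _).
  by have /andP[] := h y.
apply: (@le_trans _ _ (\int[mu]_y (tau * absk (x, y)))).
  apply: bdm_le.
  - by apply: bdmM; [exact: bdm_Asum_below|exact: bdm_abskr].
  - by apply: bdmM; [exact: bdm_cst|exact: bdm_abskr].
  - move=> y; apply: ler_wpM2r; first exact: normr_ge0.
    by have /andP[] := h y.
rewrite bdm_intZ; last exact: bdm_abskr.
by rewrite ler_pM2l//; exact: row_w.
Qed.

(** Fubini puts the integral over [x] inside, where the column bound gives [w]; the indicator is
    then bounded by 1. Rows thus control the size of an increment and columns its conditional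
    mean. *)
Lemma int_cross s : \int[mu]_x cross s x <= w * rowsum s.
Proof.
rewrite /cross (@integral_int_swap _ _ T T R mu mu _ (bdm_cross_integrand s)).
rewrite -int_Asum -bdm_intZ; last exact: bdm_Asum.
apply: bdm_le.
- have := bdm_comp (g := fun p : T * T => (p.2, p.1)) _ (bdm_cross_integrand s).
  move=> /(_ (@measurable_swap _ _ T T)) /(bdm_int mu); exact.
- by apply: bdmM; [exact: bdm_cst|exact: bdm_Asum].
move=> y /=; rewrite bdm_intZ; last exact: bdm_abskl.
rewrite mulrC; apply: ler_pM.
- by apply: bdm_int_ge0 => x; exact: normr_ge0.
- by apply: mulr_ge0; [exact: Asum_ge0|have /andP[] := below01 (Asum s y)].
- exact: col_w.
- rewrite -[leRHS]mulr1 ler_wpM2l ?Asum_ge0//.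
  by have /andP[] := below01 (Asum s y).
Qed.

(* The diagonal part of the square is bounded by [B * rowsum s], the
   off-diagonal part is [2 * cross_sum s]. *)
Lemma int_Asum_sq s :
  \int[mu]_y (Asum s y ^+ 2 * below (Asum s y)) <= B * rowsum s + 2 * cross_sum s.
Proof.
have bsq s' : bounded_measurable (fun y => Asum s' y ^+ 2 * below (Asum s' y)).
  apply: bdmM; last exact: bdm_below (bdm_Asum s').1.
  by apply: bdmM; exact: bdm_Asum.
elim: s => [|x s IH].
  rewrite /rowsum big_nil /= !mulr0 addr0.
  under eq_Rintegral do rewrite /Asum big_nil expr0n/= mul0r.
  by rewrite bdm_intcst.
pose c y := Asum s y * below (Asum s y) * absk (x, y).
have bc : bounded_measurable c.
  by apply: bdmM; [exact: bdm_Asum_below|exact: bdm_abskr].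
have b2c : bounded_measurable (fun y => 2 * c y).
  by apply: bdmM => //; exact: bdm_cst.
have bBk : bounded_measurable (fun y => B * absk (x, y)).
  by apply: bdmM; [exact: bdm_cst|exact: bdm_abskr].
apply: (@le_trans _ _ (\int[mu]_y (Asum s y ^+ 2 * below (Asum s y)
   + 2 * c y + B * absk (x, y)))).
  apply: bdm_le => //; first by apply: bdmD => //; exact: bdmD.
  move=> y; rewrite /c {1 2}/Asum !big_cons -/(Asum s y).
  have A0 := Asum_ge0 s y; have k0 : 0 <= absk (x, y) by exact: normr_ge0.
  have kB' : absk (x, y) <= B by exact: kB.
  rewrite /below; set A := Asum s y in A0 *; set z := absk (x, y) in k0 kB' *.
  have zz : z * z <= B * z by exact: ler_wpM2r.
  (* Beyond [tau] the left side is 0. Below it [A <= tau] as well, and [(z + A)^2] is expanded with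
     [z^2 <= B z]. *)
  case: (leP (z + A) tau) => /= h; last first.
    rewrite mulr0.
    have b0 : 0 <= (A <= tau)%R%:R :> R by case: (A <= tau)%R.
    rewrite addr_ge0 ?(mulr_ge0 (ltW B_gt0))//.
    by rewrite addr_ge0// !mulr_ge0.
  have -> : A <= tau by apply: le_trans h; rewrite lerDr.
  rewrite !mulr1 sqrrD expr2; lra.
rewrite bdm_intD//; last by apply: bdmD.
rewrite bdm_intD// !bdm_intZ//; last exact: bdm_abskr.
rewrite /rowsum big_cons /= -/(rowsum s) -/(cross s x) -/(row_abs x).
move: IH; set I1 := \int[mu]_y _ => IH; lra.
Qed.

Lemma compensator_le s : compensator s <= (size s)%:R * w * rowsum s.
Proof.
elim: s => [|x s IH] /=; first by rewrite !mul0r.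
have h0 := row_abs_ge0 x; have h1 := rowsum_ge0 s.
rewrite /rowsum big_cons -/(rowsum s).
apply: le_trans (lerD IH (lexx _)) _.
rewrite -natr1 (_ : _ + _ = ((size s)%:R + 1) * w * rowsum s); last by ring.
rewrite ler_wpM2l//; last by rewrite lerDr.
by rewrite mulr_ge0// ?ltW// addr_ge0.
Qed.

Lemma measurable_rowsum n :
  measurable_fun setT (fun t : n.-tuple T => rowsum t).
Proof. exact: measurable_tuple_sum bdm_row_abs.1. Qed.

(** [cross_sum] and [compensator] live on sequences, while measurability makes sense for each
    length; it is proved by induction on the length, splitting a tuple measurably into head and
    tail. *)
Lemma measurable_tuple_rec (F : seq T -> R) (H : seq T -> T -> R) :
  (forall x s, F (x :: s) = F s + H s x) ->
  (forall n, measurable_fun setT (fun p : n.-tuple T * T => H p.1 p.2)) ->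
  forall n, measurable_fun setT (fun t : n.-tuple T => F t).
Proof.
move=> FH mH; elim=> [|n IH].
  rewrite (_ : (fun t => _) = cst (F [::])); first exact: measurable_cst.
  by apply/funext => t; rewrite tuple0.
rewrite (_ : (fun t => _) = (fun t : n.+1.-tuple T =>
    F [tuple of behead t] + H [tuple of behead t] (thead t))); last first.
  by apply/funext => t; rewrite {1}(tuple_eta t) /= FH.
have mb : measurable_fun setT (fun t : n.+1.-tuple T => [tuple of behead t]).
  exact: measurable_behead.
apply: measurable_funD; first exact: (measurableT_comp IH mb).
apply: (measurableT_comp (mH n)
  (g := fun t : n.+1.-tuple T => ([tuple of behead t], thead t))).
apply/measurable_fun_pairP; split => //=; exact: (measurable_tnth ord0).
Qed.

Lemma measurable_cross_sum n : measurable_fun setT (fun t : n.-tuple T => cross_sum t).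
Proof.
apply: (@measurable_tuple_rec cross_sum cross) => // {}n.
pose h (q : (n.-tuple T * T) * T) :=
  Asum q.1.1 q.2 * below (Asum q.1.1 q.2) * absk (q.1.2, q.2).
suff bh : bounded_measurable h by exact: (bdm_int mu bh).1.
have bA : bounded_measurable
    (fun q : (n.-tuple T * T) * T => Asum q.1.1 q.2).
  apply: (bdm_comp (g := fun q : (n.-tuple T * T) * T => (q.1.1, q.2)) _
    (bdm_tuple_sum n bdm_absk)).
  apply/measurable_fun_pairP; split; last exact: measurable_snd.
  exact: (measurableT_comp measurable_fst measurable_fst).
apply: bdmM; first by apply: bdmM => //; exact: bdm_below bA.1.
apply: (bdm_comp (g := fun q : (n.-tuple T * T) * T => (q.1.2, q.2)) _
  bdm_absk).
apply/measurable_fun_pairP; split; last exact: measurable_snd.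
exact: (measurableT_comp measurable_snd measurable_fst).
Qed.

Lemma measurable_compensator n :
  measurable_fun setT (fun t : n.-tuple T => compensator t).
Proof.
apply: (@measurable_tuple_rec compensator (fun s _ => w * rowsum s)) => // {}n.
apply: measurable_funM => //.
exact: (measurableT_comp (@measurable_rowsum n) measurable_fst).
Qed.

(** For a variable in [[0, b]] and [lam = 1 / (4 b)], the chord slope [(expR (lam * b) - 1) / b] is
    at most [5/4 * lam]. This is the origin of the factor 5/4 in front of means and of the term
    [4 b u] in the tails built on it. *)
Lemma expR_quarter : expR 4^-1 - 1 <= 5 / 16 :> R.
Proof. have := @expR_le_quad R 4^-1; lra. Qed.

(** One step adds [th * cross s x], a variable in [[0, th * (tau * w)]] with [th * (tau * w) = 1/4];
    by the chord bound its exponential moment is at most that of the step of [5/4 * compensator]. *)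
Lemma cross_sum_mgf n :
  (\int[power mu n]_t (expR ((4 * (tau * w))^-1 *
      (cross_sum t - 5 / 4 * compensator t)))%:E <= 1)%E.
Proof.
have tw0 : 0 < tau * w by exact: mulr_gt0.
pose th := (4 * (tau * w))^-1.
have th0 : 0 < th by rewrite invr_gt0; lra.
pose F (s : seq T) := th * (cross_sum s - 5 / 4 * compensator s).
apply: (@power_supermartingale _ _ _ mu F) => [|k'|s].
- by rewrite /F /= mulr0 subrr mulr0.
- apply: measurable_funM => //; apply: measurable_funB.
    exact: measurable_cross_sum.
  apply: measurable_funM => //; exact: measurable_compensator.
- have mc : measurable_fun setT (cross s).
    exact: (bdm_int mu (bdm_cross_integrand s)).1.
  have := mgf_le_chord mc tw0 (cross_bound s) (int_cross s) th0.
  have -> : th * (tau * w) = 4^-1 by rewrite /th; field; rewrite !gt_eqF.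
  move=> cm; pose d := th * (5 / 4 * (w * rowsum s)).
  have {}cm : (\int[mu]_x (expR (th * cross s x))%:E <= (expR d)%:E)%E.
    apply: le_trans cm _; rewrite lee_fin ler_expR.
    have ws0 : 0 <= w * rowsum s by rewrite mulr_ge0 ?rowsum_ge0// ltW.
    rewrite (_ : d = w * rowsum s * (5 / 16 / (tau * w))); last first.
      by rewrite /d /th; field; rewrite !gt_eqF.
    by rewrite ler_wpM2l// ler_wpM2r ?expR_quarter// invr_ge0 ltW.
  have FE x : (expR (F (x :: s)))%:E =
      ((expR (F s - d))%:E * (expR (th * cross s x))%:E)%E.
    by rewrite -EFinM -expRD; congr (expR _)%:E; rewrite /F /d /=; ring.
  under eq_integral do rewrite FE.
  rewrite ge0_integralZl_EFin ?expR_ge0//; last first.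
    apply/measurable_EFinP; apply: measurableT_comp => //.
    exact: measurable_funM.
  rewrite [in leRHS](_ : expR (F s) = expR (F s - d) * expR d); last first.
    by rewrite -expRD subrK.
  by rewrite EFinM lee_pmul2l// lte_fin expR_gt0.
Qed.

Lemma cross_sum_tail n :
  (power mu n [set t : n.-tuple T |
     (5 / 4 * compensator t + 4 * tau * w * u < cross_sum t)%R] <= (expR (- u))%:E)%E.
Proof.
have tw0 : 0 < tau * w by exact: mulr_gt0.
have mq := @measurable_cross_sum n; have mc := @measurable_compensator n.
have m54 : measurable_fun setT (fun t : n.-tuple T => 5 / 4 * compensator t).
  exact: measurable_funM.
apply: (@exp_markov _ _ _ (power mu n) (fun t : n.-tuple T =>
    (4 * (tau * w))^-1 * (cross_sum t - 5 / 4 * compensator t)) u _ _ _ (cross_sum_mgf n))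
  => [||t /= h].
- by apply: measurable_funM => //; exact: measurable_funB.
- rewrite (_ : mkset _ = [set t : n.-tuple T |
     4 * tau * w * u < cross_sum t - 5 / 4 * compensator t]).
    by apply: measurable_gt_set; exact: measurable_funB.
  by apply/seteqP; split=> t /=; rewrite ltrBrDl.
- rewrite ler_pdivlMl; first by rewrite mulrA; lra.
  by lra.
Qed.

Lemma rowsum_tail n :
  (power mu n [set t : n.-tuple T |
     (5 / 4 * n%:R * j + 4 * w * u < rowsum t)%R]
   <= (expR (- u))%:E)%E.
Proof.
apply: (chord_tail (B := w) (e := j) (lam := (4 * w)^-1)) => //.
- exact: bdm_row_abs.1.
- by move=> x; rewrite row_abs_ge0 row_w.
- by rewrite invr_gt0 mulr_gt0.
- have -> : (4 * w)^-1 * w = 4^-1 by field; rewrite gt_eqF.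
  have -> : (4 * w)^-1 * (5 / 4 * n%:R * j + 4 * w * u) =
    u + n%:R * j * (5 / 16 / w) by field; rewrite gt_eqF.
  rewrite lerD2l ler_wpM2l//; first by rewrite mulr_ge0// ltW.
  by rewrite ler_wpM2r ?expR_quarter// invr_ge0 ltW.
Qed.

(** The variance proxy [w * j] comes from [row_mean x ^+ 2 <= w * row_abs x]. *)
Lemma row_mean_tail n : (0 < n)%N ->
  (power mu n [set t : n.-tuple T |
     (2 * Num.sqrt (n%:R * (w * j) * u) + 8 * w * u <
      `|\sum_(x <- t) row_mean x - n%:R * total_mean|)%R]
   <= (2 * expR (- u))%:E)%E.
Proof.
move=> n0; apply: bernstein_tail2 => //.
- exact: mulr_gt0.
- exact: bdm_row_mean.1.
- by move=> x; apply: le_trans (row_meanE x) (row_w x).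
- apply: (@le_trans _ _ (w * total_abs)); last by rewrite ler_pM2l.
  rewrite -bdm_intZ; last exact: bdm_row_abs.
  apply: bdm_le.
  + by apply: bdmM; exact: bdm_row_mean.
  + by apply: bdmM; [exact: bdm_cst|exact: bdm_row_abs].
  + move=> x; rewrite -real_normK ?num_real// expr2 ler_pM//.
      exact: le_trans (row_meanE x) (row_w x).
    exact: row_meanE.
Qed.

(** * Exceeding the level [tau]; [tauP] is the Chernoff condition at exponent [th] *)

Variables (n : nat) (th : R).
Hypotheses (n_gt0 : (0 < n)%N) (th_gt0 : 0 < th) (th_tau : 1 <= th * tau).
Hypothesis tauP : u + n%:R * (w * ((expR (th * B) - 1) / B)) <= th * tau.

Lemma bdm_Asum2 :
  bounded_measurable (fun p : n.-tuple T * T => Asum p.1 p.2).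
Proof. exact: bdm_tuple_sum bdm_absk. Qed.

Lemma bdm_Asuml y : bounded_measurable (fun t : n.-tuple T => Asum t y).
Proof. exact: bdm_comp (pair2_measurable y) bdm_Asum2. Qed.

Lemma absk01 y x : 0 <= absk (x, y) <= B.
Proof. by rewrite normr_ge0 kB. Qed.

(** For fixed [y], [Asum] is a sum of independent variables in [[0, B]] of mean at most [w]. The
    bound is kept as an exponential moment because [bias_tail] has to control the size of the excess
    as well as its probability. *)
Lemma Asum_mgf y :
  \int[power mu n]_t expR (th * (Asum t y - tau)) <= expR (- u).
Proof.
have ma : measurable_fun setT (fun x => absk (x, y)) by exact: (bdm_abskl y).1.
have h := mgf_le_chord ma B_gt0 (fun x => absk01 y x) (col_w y) th_gt0.
have {}h := power_sum_mgf n ma h.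
have bA := bdm_Asuml y.
have bl c : bounded_measurable (fun t : n.-tuple T => th * Asum t y - c).
  by apply: bdmB; [apply: bdmM => //|]; exact: bdm_cst.
move: h; rewrite bdm_EFin; last by apply: bdm_expR; exact: bl.
rewrite lee_fin => h.
rewrite -[leRHS]mulr1; apply: le_trans (ler_wpM2l (expR_ge0 _) h).
rewrite -bdm_intZ; last by apply: bdm_expR; exact: bl.
apply: bdm_le.
- apply: bdm_expR; apply: bdmM; first exact: bdm_cst.
  by apply: bdmB => //; exact: bdm_cst.
- by apply: bdmM; [exact: bdm_cst|apply: bdm_expR; exact: bl].
move=> t; rewrite -expRD ler_expR -/(Asum t y); move: tauP; lra.
Qed.

(** The event is that some [y] of the second sample, here frozen as [s], has [Asum t y > tau]. A
    positive sum of indicators is jointly measurable in both samples and lends itself to induction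
    on [s]. *)
Lemma exceed_tail (s : seq T) :
  (power mu n [set t : n.-tuple T |
     (0 < \sum_(y <- s) (1 - below (Asum t y)))%R]
   <= ((size s)%:R * expR (- u))%:E)%E.
Proof.
have mb y : measurable_fun setT (fun t : n.-tuple T => 1 - below (Asum t y)).
  by apply: measurable_funB => //; exact: (bdm_below (bdm_Asuml y).1).1.
have ms s' : measurable_fun setT
    (fun t : n.-tuple T => \sum_(y <- s') (1 - below (Asum t y))).
  by apply: measurable_sum => y; exact: mb.
elim: s => [|y s IH].
  rewrite (_ : mkset _ = set0) ?measure0 ?mul0r//.
  by apply/seteqP; split => t //=; rewrite big_nil ltxx.
rewrite /= -natr1 mulrDl mul1r addrC EFinD.
apply: (measure_cover2 _ _ _ _ _ IH (B := [set t : n.-tuple T | tau < Asum t y])).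
- exact: measurable_gt_set.
- exact: measurable_gt_set (bdm_Asuml y).1.
- exact: measurable_gt_set.
- move=> t /=; rewrite big_cons /below.
  have [h|h] := ltP tau (Asum t y); first by left.
  by rewrite subrr add0r; right.
apply: (chord_tail (B := B) (e := w) (lam := th)) => //.
- exact: (bdm_abskl y).1.
- by move=> x; exact: absk01.
- by rewrite -mulrA.
Qed.

(** It dominates the change that truncation makes in the conditional mean of [Gsum s], see
    [int_truncated_bias]. *)
Definition bias (s : seq T) : R :=
  \int[mu]_y (Asum s y * (1 - below (Asum s y))).

Lemma bdm_bias : bounded_measurable (fun t : n.-tuple T => bias t).
Proof.
apply: (bdm_int mu (h := fun p : n.-tuple T * T =>
  Asum p.1 p.2 * (1 - below (Asum p.1 p.2)))).
apply: bdmM; first exact: bdm_Asum2.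
by apply: bdmB; [exact: bdm_cst|exact: bdm_below bdm_Asum2.1].
Qed.

(** Markov's inequality, the mean of [bias] being at most [tau * expR (- u)]. The bias enters the
    deviation [n] times, so the threshold [tau / n] costs a single [tau], and the probability is of
    the same order as in [exceed_tail]. *)
Lemma bias_tail :
  (power mu n [set t : n.-tuple T | (tau / n%:R < bias t)%R]
   <= (n%:R * expR (- u))%:E)%E.
Proof.
have nR : 0 < n%:R :> R by rewrite ltr0n.
rewrite (_ : n%:R * expR (- u) = tau * expR (- u) / (tau / n%:R)); last first.
  by field; rewrite !gt_eqF.
have above0 s y : 0 <= 1 - below (Asum s y).
  by rewrite subr_ge0; have /andP[] := below01 (Asum s y).
apply: (@markov_ge0 _ _ _ (power mu n) (fun t => (bias t)%:E)).
- by apply/measurable_EFinP; exact: bdm_bias.1.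
- exact: measurable_gt_set bdm_bias.1.
- move=> t; rewrite lee_fin; apply: bdm_int_ge0 => y.
  by rewrite mulr_ge0// Asum_ge0.
- exact: divr_gt0.
- rewrite (bdm_EFin _ bdm_bias) lee_fin.
  have be : bounded_measurable (fun p : n.-tuple T * T =>
      tau * expR (th * (Asum p.1 p.2 - tau))).
    apply: bdmM; first exact: bdm_cst.
    apply: bdm_expR; apply: bdmM; first exact: bdm_cst.
    by apply: bdmB; [exact: bdm_Asum2|exact: bdm_cst].
  apply: (@le_trans _ _ (\int[power mu n]_t \int[mu]_y
      (tau * expR (th * (Asum t y - tau))))).
    apply: bdm_le; [exact: bdm_bias|exact: (bdm_int mu be)|move=> t].
    have bt := bdm_comp (pair1_measurable t) be.
    apply: bdm_le => [|//|y].
      apply: bdmM; first exact: bdm_Asum.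
      by apply: bdmB; [exact: bdm_cst|exact: bdm_below (bdm_Asum t).1].
    rewrite /below; set A := Asum t y; have A0 : 0 <= A by exact: Asum_ge0.
    case: (leP A tau) => /= h.
      by rewrite subrr mulr0 mulr_ge0 ?expR_ge0// ltW.
    (* [A / tau <= exp (A / tau - 1)] and [theta tau >= 1]. *)
    rewrite subr0 mulr1 -ler_pdivrMl// mulrC.
    apply: le_trans (_ : 1 + (A / tau - 1) <= _); first by rewrite addrC subrK.
    apply: le_trans (expR_ge1Dx _) _; rewrite ler_expR.
    rewrite (_ : A / tau - 1 = (A - tau) / tau); last by field; rewrite gt_eqF.
    rewrite mulrC; apply: ler_wpM2r; first by rewrite subr_ge0 ltW.
    by rewrite -(ler_pM2r tau_gt0) mulVf ?gt_eqF.
  rewrite (integral_int_swap _ _ be); apply: bdm_int_le_cst.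
    have := bdm_comp (g := fun p : T * n.-tuple T => (p.2, p.1)) _ be.
    by move=> /(_ (@measurable_swap _ _ _ _)) /(bdm_int (power mu n)).
  move=> y /=; rewrite bdm_intZ; last first.
    apply: bdm_expR; apply: bdmM; first exact: bdm_cst.
    by apply: bdmB; [exact: bdm_Asuml|exact: bdm_cst].
  by rewrite ler_pM2l//; exact: Asum_mgf.
- by move=> t /= h; rewrite lee_fin ltW.
Qed.

(** The cut is governed by [Asum] and not by [|Gsum|]: [Asum] is a sum of nonnegative terms,
    increasing with the sample, as the chord bound and the recursion for [cross_sum] require. *)
Definition truncated (s : seq T) (y : T) : R := Gsum s y * below (Asum s y).

Lemma bdm_truncated2 :
  bounded_measurable (fun p : n.-tuple T * T => truncated p.1 p.2).
Proof.
apply: bdmM; first exact: bdm_tuple_sum bdm_k.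
exact: bdm_below bdm_Asum2.1.
Qed.

Lemma bdm_truncated (s : seq T) : bounded_measurable (truncated s).
Proof.
by apply: bdmM; [exact: bdm_Gsum|exact: bdm_below (bdm_Asum s).1].
Qed.

Lemma truncated_le s y : `|truncated s y| <= tau.
Proof.
rewrite /truncated normrM /below; have := Gsum_le s y.
case: (leP (Asum s y) tau) => /= h hG; last by rewrite normr0 mulr0 ltW.
by rewrite normr1 mulr1 (le_trans hG).
Qed.

Lemma int_truncated_sq s :
  \int[mu]_y truncated s y ^+ 2 <= B * rowsum s + 2 * cross_sum s.
Proof.
apply: le_trans (int_Asum_sq s); apply: bdm_le.
- by apply: bdmM; exact: bdm_truncated.
- apply: bdmM; last exact: bdm_below (bdm_Asum s).1.
  by apply: bdmM; exact: bdm_Asum.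
move=> y; rewrite /truncated exprMn; apply: ler_pM; rewrite ?sqr_ge0//.
- by rewrite -real_normK ?num_real// ler_pXn2r ?nnegrE ?Asum_ge0 ?Gsum_le.
- by rewrite /below; case: (Asum s y <= tau)%R; rewrite /= ?expr1n ?expr0n.
Qed.

Lemma int_truncated_bias s :
  `|\int[mu]_y truncated s y - \sum_(x <- s) row_mean x| <= bias s.
Proof.
have bG := bdm_Gsum s; have bt := bdm_truncated s.
rewrite -int_Gsum -bdm_intB//.
apply: le_trans (bdm_int_norm _ _) _; first exact: bdmB.
apply: bdm_le; first by apply: bdm_norm; exact: bdmB.
  apply: bdmM; first exact: bdm_Asum.
  by apply: bdmB; [exact: bdm_cst|exact: bdm_below (bdm_Asum s).1].
move=> y; have := Gsum_le s y; have := below01 (Asum s y).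
rewrite /truncated => /andP[b0 b1] hG.
rewrite (_ : _ - _ = - (Gsum s y * (1 - below (Asum s y)))); last by ring.
by rewrite normrN normrM ler_pM// ger0_norm// subr_ge0.
Qed.

Definition rowsum_bound : R := 5 / 4 * n%:R * j + 4 * w * u.
Definition cross_sum_bound : R :=
  5 / 4 * (n%:R * w * rowsum_bound) + 4 * tau * w * u.
Definition variance_bound : R := B * rowsum_bound + 2 * cross_sum_bound.
(** The first two terms are Bernstein's for the truncated sum given the first sample, [tau] is [n]
    times the bias threshold, and the last line is [n] times the fluctuation of the row means. *)
Definition deviation_bound : R :=
  2 * Num.sqrt (n%:R * variance_bound * u) + 8 * tau * u + tau
  + n%:R * (2 * Num.sqrt (n%:R * (w * j) * u) + 8 * w * u).

(** Six exceptional events. [E1], [E2], [E4], [E5] concern the first sample only, [E3] is estimated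
    with the second sample frozen, and [E6] with the first one frozen. *)
Lemma two_sample_tail :
  ((power mu n \x power mu n) [set z : n.-tuple T * n.-tuple T |
     (deviation_bound <
      `|\sum_(y <- z.2) Gsum z.1 y - n%:R ^+ 2 * total_mean|)%R]
   <= ((6 + 2 * n%:R) * expR (- u))%:E)%E.
Proof.
have nR : 0 < n%:R :> R by rewrite ltr0n.
have S0 : 0 < rowsum_bound.
  by rewrite /rowsum_bound addr_gt0// !mulr_gt0.
have Q0 : 0 < cross_sum_bound by rewrite /cross_sum_bound addr_gt0// !mulr_gt0.
have v0 : 0 < variance_bound by rewrite /variance_bound addr_gt0// !mulr_gt0.
set e := expR (- u).
pose tt := (n.-tuple T * n.-tuple T)%type.
pose E1 := [set z : tt | rowsum_bound < rowsum z.1].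
pose E2 := [set z : tt |
  2 * Num.sqrt (n%:R * (w * j) * u) + 8 * w * u <
      `|\sum_(x <- z.1) row_mean x - n%:R * total_mean|].
pose E3 := [set z : tt | 0 < \sum_(y <- z.2) (1 - below (Asum z.1 y))].
pose E4 := [set z : tt | tau / n%:R < bias z.1].
pose E5 := [set z : tt | 5 / 4 * compensator z.1 + 4 * tau * w * u < cross_sum z.1].
(* The intersection keeps only first samples whose conditional second moment obeys its bound; the
   other sections are empty, so conditional Bernstein covers every section. *)
pose E6 := [set z : tt |
   2 * Num.sqrt (n%:R * variance_bound * u) + 8 * tau * u <
     `|\sum_(y <- z.2) truncated z.1 y - n%:R * \int[mu]_y truncated z.1 y|]
  `&` ~` [set z : tt | variance_bound < \int[mu]_y truncated z.1 y ^+ 2].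
have mfst (F : seq T -> R) (c : R) :
    measurable_fun setT (fun t : n.-tuple T => F t) ->
    measurable [set z : tt | c < F z.1].
  move=> mF; apply: (measurable_gt_set (F := fun z : tt => F z.1)).
  exact: (measurableT_comp mF measurable_fst).
have mrow : measurable_fun setT
    (fun t : n.-tuple T => `|\sum_(x <- t) row_mean x - n%:R * total_mean|).
  apply: measurableT_comp => //; apply: measurable_funB => //.
  exact: measurable_tuple_sum bdm_row_mean.1.
have mqc : measurable_fun setT
    (fun t : n.-tuple T => cross_sum t - 5 / 4 * compensator t).
  apply: measurable_funB; first exact: measurable_cross_sum.
  by apply: measurable_funM => //; exact: measurable_compensator.
have mE1 : measurable E1 by apply: mfst; exact: measurable_rowsum.
have mE2 : measurable E2.
  exact: (mfst (fun s => `|\sum_(x <- s) row_mean x - n%:R * total_mean|)).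
have mE3 : measurable E3.
  apply: measurable_gt_set.
  apply: (bdm_tuple_sumr n (k := fun p : n.-tuple T * T =>
    1 - below (Asum p.1 p.2)) _).1.
  by apply: bdmB; [exact: bdm_cst|exact: bdm_below bdm_Asum2.1].
have mE4 : measurable E4 by apply: mfst; exact: bdm_bias.1.
have mE5 : measurable E5.
  rewrite (_ : E5 = [set z : tt |
      4 * tau * w * u < cross_sum z.1 - 5 / 4 * compensator z.1]).
    exact: (mfst (fun s => cross_sum s - 5 / 4 * compensator s)).
  by apply/seteqP; split=> z /=; rewrite /E5/= ltrBrDl.
have mE6 : measurable E6.
  apply: measurableI.
    apply: measurable_gt_set; apply: measurableT_comp => //.
    apply: measurable_funB; first exact: (bdm_tuple_sumr n bdm_truncated2).1.
    apply: measurable_funM => //.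
    exact: (measurableT_comp (bdm_int mu bdm_truncated2).1 measurable_fst).
  apply: measurableC; apply: (mfst (fun s => \int[mu]_y truncated s y ^+ 2)).
  have bh : bounded_measurable
      (fun p : n.-tuple T * T => truncated p.1 p.2 ^+ 2).
    by apply: bdmM; exact: bdm_truncated2.
  exact: (bdm_int mu bh).1.
have mdev : measurable [set z : tt | deviation_bound <
    `|\sum_(y <- z.2) Gsum z.1 y - n%:R ^+ 2 * total_mean|].
  apply: measurable_gt_set; apply: measurableT_comp => //.
  apply: measurable_funB => //.
  exact: (bdm_tuple_sumr n (bdm_tuple_sum n bdm_k)).1.
(* One summand per event, from [E1] to [E6]; the factors 2 come from two-sided bounds, the factors
   [n] from [E3] and [E4]. *)
have -> : (6 + 2 * n%:R) * e =
    e + (2 * e + (n%:R * e + (n%:R * e + (e + 2 * e)))) by ring.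
apply: (@le_trans _ _ ((power mu n \x power mu n)%E
    (E1 `|` (E2 `|` (E3 `|` (E4 `|` (E5 `|` E6))))))).
  apply: le_measure; rewrite ?inE//.
    by do 5 (apply: measurableU => //).
  move=> [t s] /= dev; rewrite /E1 /E2 /E3 /E4 /E5 /E6/=.
  have [h1|h1] := ltP rowsum_bound (rowsum t); first by left.
  right; set dm := `|_ - _ * total_mean|.
  have [h2|h2] := ltP _ dm; first by left.
  right; have [h3|h3] := ltP 0 (\sum_(y <- s) (1 - below (Asum t y))).
    by left.
  right; have [h4|h4] := ltP (tau / n%:R) (bias t); first by left.
  right; have [h5|h5] := ltP _ (cross_sum t); first by left.
  right.
  have vt : \int[mu]_y truncated t y ^+ 2 <= variance_bound.
    apply: le_trans (int_truncated_sq t) _; rewrite /variance_bound.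
    rewrite lerD ?ler_pM2l//; apply: le_trans h5 _.
    rewrite /cross_sum_bound lerD2r ler_pM2l//.
    apply: le_trans (compensator_le t) _; rewrite size_tuple.
    by rewrite ler_wpM2l// mulr_ge0// ltW.
  split; last by apply/negP; rewrite -leNgt.
  (* Off [E3] a sum of nonnegative terms is at most 0, so every indicator equals 1 and truncation
     changes nothing at this pair of samples. *)
  have sumE : \sum_(y <- s) Gsum t y = \sum_(y <- s) truncated t y.
    have : all (fun y => below (Asum t y) == 1) s.
      have b1 y : 0 <= 1 - below (Asum t y).
        by rewrite subr_ge0; have /andP[] := below01 (Asum t y).
      elim: (s : seq T) h3 => [//|y s' IH]; rewrite big_cons /= => h.
      have h' : 0 <= \sum_(y <- s') (1 - below (Asum t y)) by exact: sumr_ge0.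
      have := b1 y => h''.
      rewrite IH; last by lra.
      by rewrite andbT eq_le; apply/andP; split; lra.
    elim: (s : seq T) => [|y s' IH]; first by rewrite !big_nil.
    by rewrite /= !big_cons /truncated => /andP[/eqP -> /IH ->]; rewrite mulr1.
  move: dev; rewrite sumE /deviation_bound.
  set M := \int[mu]_y truncated t y; set rm := \sum_(x <- t) row_mean x in dm h2 *.
  set sm := \sum_(y <- s) truncated t y; set r5 := 2 * Num.sqrt _.
  set r2 := 2 * Num.sqrt _ in h2 * => dev.
  rewrite -(ltrD2r (tau + n%:R * (r2 + 8 * w * u))).
  apply: lt_le_trans (_ : `|sm - n%:R ^+ 2 * total_mean| <= _).
    by rewrite [ltLHS]addrA.
  (* Conditional fluctuation, truncation bias, fluctuation of the row means: the last two are
     already bounded, so the first must be large. *)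
  rewrite (_ : sm - _ = (sm - n%:R * M) +
     (n%:R * (M - rm) + n%:R * (rm - n%:R * total_mean))); last by ring.
  apply: le_trans (ler_normD _ _) _; rewrite lerD2l.
  apply: le_trans (ler_normD _ _) _; rewrite !normrM (ger0_norm (ltW nR)).
  rewrite lerD//; last by rewrite ler_pM2l.
  rewrite -ler_pdivlMl// mulrC; apply: le_trans h4; exact: int_truncated_bias.
apply: measureU_le => //; first by do 4 (apply: measurableU => //).
  by apply: product_le_ysection => // y; exact: rowsum_tail.
apply: measureU_le => //; first by do 3 (apply: measurableU => //).
  by apply: product_le_ysection => // y; exact: row_mean_tail.
apply: measureU_le => //; first by do 2 (apply: measurableU => //).
  apply: product_le_ysection => // s; rewrite -[X in X%:R](size_tuple s).
  exact: exceed_tail.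
apply: measureU_le => //; first by apply: measurableU.
  by apply: product_le_ysection => // y; exact: bias_tail.
apply: measureU_le => //.
  by apply: product_le_ysection => // y; exact: cross_sum_tail.
apply: product_le_xsection => // t.
have [vt|vt] := ltP variance_bound (\int[mu]_y truncated t y ^+ 2).
  rewrite (_ : mkset _ = set0) ?measure0 ?lee_fin ?mulr_ge0 ?expR_ge0//.
  by apply/seteqP; split => // s /= [_]; apply.
apply: le_trans (bernstein_tail2 n_gt0 tau_gt0 v0 u_gt0 (bdm_truncated t).1
  (truncated_le t) vt).
apply: le_measure; rewrite ?inE; last by move=> s [].
  rewrite (_ : mkset _ = xsection E6 t); first exact: measurable_xsection.
  by apply/seteqP; split => s /=; rewrite /xsection/= inE.
apply: measurable_gt_set; apply: measurableT_comp => //.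
apply: measurable_funB => //; exact: measurable_tuple_sum (bdm_truncated t).1.
Qed.

End two_sample_concentration.

(** * Densities, affine changes of variables and norms *)

Section density.
Context {dT : measure_display} {T : measurableType dT} {R : realType}.
Variables (nu mu : {measure set T -> \bar R}) (f : T -> R).
Hypothesis mf : measurable_fun setT f.
Hypothesis f0 : forall x, 0 <= f x.
Hypothesis muE : forall A, measurable A -> mu A = (\int[nu]_(x in A) (f x)%:E)%E.
Local Open Scope ereal_scope.

Import HBNNSimple.

Let mfE : measurable_fun setT (EFin \o f).
Proof. exact/measurable_EFinP. Qed.

Let density_nnsfun (g : {nnsfun T >-> R}) :
  \int[mu]_x (g x)%:E = \int[nu]_x ((g x)%:E * (f x)%:E).
Proof.
under [LHS]eq_integral do rewrite fimfunE -fsumEFin//.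
rewrite [LHS]ge0_integral_fsum//; last 2 first.
- by move=> r; exact/measurable_EFinP/measurableT_comp.
- by move=> n x _; rewrite EFinM nnfun_muleindic_ge0.
under [RHS]eq_integral.
  move=> x _; rewrite muleC fimfunE -fsumEFin// ge0_mule_fsumr; last first.
    by move=> r; rewrite EFinM nnfun_muleindic_ge0.
  over.
rewrite [RHS]ge0_integral_fsum//; last 2 first.
- move=> r; apply: emeasurable_funM => //.
  by apply/measurable_EFinP; do 2 apply/measurableT_comp => //.
- move=> n x _; apply: mule_ge0; first by rewrite lee_fin.
  by rewrite EFinM nnfun_muleindic_ge0.
apply: eq_fsbigr => r _.
have mA : measurable (g @^-1` [set r]) by exact: measurable_sfunP.
rewrite !integralZl_indic_nnsfun//= integral_indic// setIT muE//.
rewrite [in LHS]integral_mkcond.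
under [RHS]eq_integral do rewrite EFinM muleCA.
have [r0|r0] := leP 0%R r.
  rewrite ge0_integralZl_EFin//; last 2 first.
  - by move=> x _; rewrite mule_ge0 ?lee_fin.
  - apply: emeasurable_funM => //; apply/measurable_EFinP.
    exact: measurable_indic.
  congr (_ * _); apply: eq_integral => x _; rewrite patchE indicE.
  by case: (x \in _); rewrite ?mule1 ?mule0.
have -> : g @^-1` [set r] = set0.
  apply/seteqP; split=> x //= gx.
  by have : (0 <= g x)%R by []; rewrite gx leNgt r0.
rewrite [in LHS]integral0_eq ?mule0; last first.
  by move=> x _; rewrite patchE in_set0.
rewrite integral0_eq// => x _; by rewrite indic0 mule0 mule0.
Qed.

Lemma ge0_integral_density (phi : T -> \bar R) :
  measurable_fun setT phi -> (forall x, 0 <= phi x) ->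
  \int[mu]_x phi x = \int[nu]_x (phi x * (f x)%:E).
Proof.
move=> mphi phi0.
pose g := nnsfun_approx measurableT mphi.
have gphi x : phi x = limn (fun n => (g n x)%:E).
  by apply/esym/cvg_lim => //; exact: cvg_nnsfun_approx.
transitivity (limn (fun n => \int[mu]_x (g n x)%:E)).
  rewrite -monotone_convergence//=; last 3 first.
  - by move=> n; exact/measurable_EFinP.
  - by move=> n x _; rewrite lee_fin.
  - by move=> x _ a b ab; rewrite lee_fin; exact/lefP/nd_nnsfun_approx.
  by apply: eq_integral => x _; rewrite gphi.
transitivity (limn (fun n => \int[nu]_x ((g n x)%:E * (f x)%:E))).
  by congr (limn _); apply/funext => n; exact: density_nnsfun.
rewrite -monotone_convergence//=; last 3 first.
- by move=> n; apply: emeasurable_funM => //; exact/measurable_EFinP.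
- by move=> n x _; rewrite mule_ge0 ?lee_fin.
- move=> x _ a b ab; rewrite lee_wpmul2r ?lee_fin//.
  exact/lefP/nd_nnsfun_approx.
apply: eq_integral => x _; apply/cvg_lim => //.
apply: cvgeZr => //; first exact: cvg_nnsfun_approx.
Qed.

End density.

Section affine.
Context {R : realType}.

(** The rescaled image measure gives every half-open interval its length, which characterizes
    Lebesgue measure. *)
Lemma lebesgue_measure_affine (h a : R) (A : set (measurableTypeR R)) :
  0 < h -> measurable A ->
  (@lebesgue_measure R ((fun y : R => (y - a) / h)%R @^-1` A) =
   h%:E * @lebesgue_measure R A)%E.
Proof.
move=> h0 mA.
pose g : measurableTypeR R -> measurableTypeR R := fun y : R => (y - a) / h.
have mg : measurable_fun setT g.
  by apply: measurable_funM => //; exact: measurable_funB.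
have hi0 : 0 <= h^-1 by rewrite invr_ge0 ltW.
pose nu' : {measure set (measurableTypeR R) -> \bar R} :=
  mscale (NngNum hi0) (pushforward (@lebesgue_measure R) g).
pose nu := nu' mg.
have nuE B : nu B = (h^-1%:E * @lebesgue_measure R (g @^-1` B))%E by [].
have E : @lebesgue_measure R A = nu A.
  apply: lebesgue_measure_unique => // _ [[x y] _ <-] /=.
  rewrite nuE (_ : g @^-1` _ = `]h * x + a, h * y + a]%classic); last first.
    apply/seteqP; split => z /=; rewrite /g !in_itv/= ltr_pdivlMr// ler_pdivrMr//;
      rewrite ltrBrDr lerBlDr mulrC (mulrC y); exact.
  rewrite !lebesgue_measure_itv/= !lte_fin ltrD2r ltr_pM2l//.
  case: ifPn => _; last by rewrite mule0.
  rewrite -!EFinB -EFinM; congr (_%:E); field; exact: lt0r_neq0.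
by rewrite E nuE muleA -EFinM mulfV ?gt_eqF// mul1e.
Qed.

Definition tuple_affine d (h a y : d.-tuple R) : d.-tuple R :=
  [tuple (tnth y j - tnth a j) / tnth h j | j < d].

Lemma measurable_tuple_affine d (h a : d.-tuple R) :
  measurable_fun setT (tuple_affine h a).
Proof.
apply/measurable_fun_tnthP => i.
rewrite (_ : _ \o _ = (fun y : d.-tuple R => (tnth y i - tnth a i) / tnth h i)).
  apply: measurable_funM => //; apply: measurable_funB => //.
  exact: measurable_tnth.
by apply/funext => y /=; rewrite tnth_mktuple.
Qed.

Lemma lebesgue_tuple_unique d (nu : {measure set (d.-tuple R) -> \bar R}) :
  (forall A : 'I_d -> set (measurableTypeR R), (forall i, measurable (A i)) ->
    nu (box A) = (\prod_(i < d) @lebesgue_measure R (A i))%E) ->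
  forall X, measurable X -> nu X = lebesgue_tuple d X.
Proof.
move=> nuE X mX.
have boxE := @measurable_tupleE _ (measurableTypeR R) d.
have lebE (A : 'I_d -> set (measurableTypeR R)) : (forall i, measurable (A i)) ->
    lebesgue_tuple d (box A) = (\prod_(i < d) @lebesgue_measure R (A i))%E.
  by move=> mA; exact: lebesgue_tuple_box.
pose I k : set (measurableTypeR R) := `](- k%:R), k%:R]%classic.
pose g k : set (d.-tuple R) := box (fun=> I k).
apply: (@measure_unique _ R _ _ g boxE _ _ _ nu (lebesgue_tuple d)) => //.
- move=> _ _ [A mA <-] [B mB <-]; exists (fun i => A i `&` B i).
    by move=> i; exact: measurableI.
  apply/seteqP; split=> t /=.
    by move=> AB; split=> i; have [] := AB i.
  by move=> [At Bt] i; split; [exact: At|exact: Bt].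
- by move=> k; exists (fun=> I k) => //= _; exact: measurable_itv.
- apply/seteqP; split => // t _.
  (* The cubes exhaust the space; a sum over the coordinates serves as an index above all of
     them. *)
  exists (\sum_(i < d) (Num.truncn `|tnth t i|).+1)%N => // i.
  rewrite /I /= in_itv/=.
  have h : `|tnth t i| < (\sum_(i < d) (Num.truncn `|tnth t i|).+1)%N%:R.
    apply: lt_le_trans (truncnS_gt _) _.
    by rewrite ler_nat (bigD1 i)//= leq_addr.
  have := ltr_normlP _ _ h => -[h1 h2].
  by rewrite ltrNl h1 ltW.
- by move=> _ [A mA <-]; rewrite nuE//; exact/esym/lebE.
- move=> k; rewrite nuE; last by move=> _; exact: measurable_itv.
  rewrite ltey_eq; apply/orP; left.
  apply: (big_ind (fun x : \bar R => x \is a fin_num)) => // [x y|i _].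
    exact: fin_numM.
  by rewrite lebesgue_measure_itv/=; case: ifP.
Qed.

Lemma vol_gt0 d (h : d.-tuple R) : (forall j, 0 < tnth h j) -> 0 < vol h.
Proof. by move=> h0; apply: prodr_gt0. Qed.

Lemma lebesgue_tuple_affine d (h a : d.-tuple R) (A : set (d.-tuple R)) :
  (forall j, 0 < tnth h j) -> measurable A ->
  (lebesgue_tuple d (tuple_affine h a @^-1` A) =
   (vol h)%:E * lebesgue_tuple d A)%E.
Proof.
move=> h0 mA; have v0 := vol_gt0 h0.
have hi0 : 0 <= (vol h)^-1 by rewrite invr_ge0 ltW.
pose nu' : {measure set (d.-tuple R) -> \bar R} :=
  mscale (NngNum hi0) (pushforward (lebesgue_tuple d) (tuple_affine h a)).
pose nu := nu' (@measurable_tuple_affine d h a).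
have nuE B : nu B =
  ((vol h)^-1%:E * lebesgue_tuple d (tuple_affine h a @^-1` B))%E by [].
have E : nu A = lebesgue_tuple d A.
  apply: lebesgue_tuple_unique => // C mC.
  have mC' i : measurable
      ((fun y : R => (y - tnth a i) / tnth h i) @^-1` C i : set (measurableTypeR R)).
    rewrite -[_ @^-1` _]setTI.
    have : measurable_fun [set: measurableTypeR R]
      ((fun y : R => (y - tnth a i) / tnth h i) : _ -> measurableTypeR R).
      by apply: measurable_funM => //; exact: measurable_funB.
    exact.
  rewrite nuE (_ : _ @^-1` _ =
    [set y | forall i, ((fun y : R => (y - tnth a i) / tnth h i) @^-1` C i) (tnth y i)]).
    rewrite [X in (_ * X)%E](lebesgue_tuple_box mC').
    under eq_bigr do rewrite lebesgue_measure_affine//.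
    rewrite big_split/= muleA (_ : (\prod_(i < d) (tnth h i)%:E)%E = (vol h)%:E).
      by rewrite -EFinM mulVf ?gt_eqF// mul1e.
    by rewrite prodEFin.
  by apply/seteqP; split => y /= H i; have := H i; rewrite tnth_mktuple.
by rewrite -E nuE muleA -EFinM mulfV ?gt_eqF// mul1e.
Qed.

Lemma ge0_integral_affine d (h a : d.-tuple R) (F : d.-tuple R -> \bar R) :
  (forall j, 0 < tnth h j) -> measurable_fun setT F -> (forall x, 0 <= F x)%E ->
  (\int[lebesgue_tuple d]_y F (tuple_affine h a y) =
   (vol h)%:E * \int[lebesgue_tuple d]_y F y)%E.
Proof.
move=> h0 mF F0; have v0 := vol_gt0 h0.
have mg := @measurable_tuple_affine d h a.
rewrite -(ge0_integral_pushforward mg _ measurableT mF)//.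
have vn : 0 <= vol h by exact: ltW.
transitivity (\int[mscale (NngNum vn) (lebesgue_tuple d)]_y F y)%E.
  by apply: eq_measure_integral => A mA _; exact: lebesgue_tuple_affine.
by rewrite ge0_integral_mscale.
Qed.

End affine.

(** * The norms of the kernel behind [varpi] *)

Section varpi.
Context {R : realType} {d : nat}.
Notation leb := (@lebesgue_tuple R d).

(** The norm of exponent [+oo] unfolds to the essential supremum only on a space of positive
    measure; the unit cube has measure 1. *)
Lemma lebesgue_tuple_setT_gt0 : (0 < leb [set: d.-tuple R])%E.
Proof.
pose A (i : 'I_d) : set (measurableTypeR R) := `[0, 1]%classic.
have mA i : measurable (A i) by exact: measurable_itv.
have A1 : leb (box A) = 1%E.
  rewrite [LHS](lebesgue_tuple_box mA) big1// => i _.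
  by rewrite /A lebesgue_measure_itv/= lte_fin ltr01 oppr0 adde0.
apply: (@lt_le_trans _ _ 1%E) => //; rewrite -A1.
by apply: le_measure; rewrite ?inE//; exact: measurable_box.
Qed.

Lemma ae_le_Lnormy (F : d.-tuple R -> R) (c : R) :
  measurable_fun setT F -> ('N[leb]_+oo[EFin \o F] <= c%:E)%E ->
  leb [set x | c < `|F x|] = 0%E.
Proof.
move=> mF; rewrite unlock /= lebesgue_tuple_setT_gt0 => Fc.
have /ae_le_measureP : (\forall x \ae leb, (abse \o (EFin \o F)) x <= c%:E)%E.
  exact/ess_supP.
have mE : measurable_fun setT (abse \o (EFin \o F)).
  by apply: measurableT_comp => //; exact/measurable_EFinP.
move=> /(_ mE) <-; congr (leb _).
by apply/seteqP; split => x /=; rewrite in_itv/= lte_fin andbT.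
Qed.

Variables (U : d.-tuple R -> R) (t M : R).
Hypothesis mU : measurable_fun setT U.
Hypothesis UM : forall x, `|U x| <= M.
Hypothesis U_supp : supported_on_cube t U.

Lemma Lnorm_bounded : exists K : R, forall p, (1%:E <= p)%E ->
  ('N[leb]_p[EFin \o U] <= K%:E)%E.
Proof.
pose A (i : 'I_d) : set (measurableTypeR R) := `]- t, t[%classic.
have mA i : measurable (A i) by exact: measurable_itv.
have mbA : measurable (box A) by exact: measurable_box.
have [c c0 cE] : exists2 c : R, 0 <= c & leb (box A) = c%:E.
  have h : leb (box A) \is a fin_num.
    rewrite [X in X \is a fin_num](lebesgue_tuple_box mA).
    apply: (big_ind (fun x : \bar R => x \is a fin_num)) => // [x y|i _].
      exact: fin_numM.
    by rewrite lebesgue_measure_itv/=; case: ifP.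
  exists (fine (leb (box A))); first exact: fine_ge0.
  by rewrite fineK.
pose M1 := Num.max 1 M; pose c1 := Num.max 1 c.
have M11 : 1 <= M1 by rewrite le_max lexx.
have c11 : 1 <= c1 by rewrite le_max lexx.
have K1 : 1 <= M1 * c1 by rewrite mulr_ege1.
exists (M1 * c1) => -[r||]//; last first.
  move=> _; rewrite unlock /= lebesgue_tuple_setT_gt0; apply/ess_supP.
  apply: nearW => x /=; rewrite lee_fin (le_trans (UM x))//.
  by apply: (@le_trans _ _ M1); [rewrite le_max lexx orbT|
    rewrite ler_peMr//; lra].
rewrite lee_fin => r1; have r0 : 0 < r by lra.
rewrite unlock /=.
have ir0 : 0 <= r^-1 by rewrite invr_ge0 ltW.
apply: (@le_trans _ _ (((M1 * c1) `^ r)%:E `^ r^-1)%E); last first.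
  by rewrite poweR_EFin -powRrM mulfV ?gt_eqF// powRr1//; lra.
apply: gt0_ler_poweR => //.
- by rewrite in_itv/= leey andbT integral_ge0// => x _; exact: poweR_ge0.
- by rewrite in_itv/= leey andbT lee_fin powR_ge0.
have mUr : measurable_fun setT (fun x => (`|(U x)%:E| `^ r)%E).
  apply: (measurableT_comp (measurable_poweR r)).
  by apply: measurableT_comp => //; exact/measurable_EFinP.
have M1r0 : 0 <= M1 `^ r by exact: powR_ge0.
apply: (@le_trans _ _ (\int[leb]_x ((M1 `^ r)%:E * (\1_(box A) x)%:E))%E).
  apply: ge0_le_integral => //.
  - apply: emeasurable_funM => //.
    by apply/measurable_EFinP; exact: measurable_indic.
  move=> x _ /=; rewrite -EFinM lee_fin indicE.
  have [/[!inE] xA|xA] := boolP (x \in box A).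
    rewrite mulr1; apply: ge0_ler_powR; rewrite ?nnegrE//; first exact: ltW.
      by lra.
    by rewrite (le_trans (UM x))// le_max lexx orbT.
  have -> : U x = 0.
    apply/eqP; apply: contraNT xA => /U_supp h; rewrite inE => i.
    by rewrite /A/= ?in_itv/=; exact: h.
  by rewrite normr0 powR0 ?gt_eqF// mulr0.
rewrite ge0_integralZl_EFin//; last first.
  by apply/measurable_EFinP; exact: measurable_indic.
rewrite integral_indic// setIT [X in (_ * X)%E]cE -EFinM lee_fin powRM; [|lra|lra].
rewrite ler_wpM2l//; apply: (@le_trans _ _ c1); first by rewrite le_max lexx orbT.
exact: le1r_powR.
Qed.

(** The last two bounds are the exponents [+oo] and 1 of the supremum. *)
Lemma varpi_bounds : [/\ 1 <= varpi U,
  leb [set x | varpi U < `|U x|] = 0%E &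
  (\int[leb]_x `|(U x)%:E| <= (varpi U)%:E)%E].
Proof.
have [K UK] := Lnorm_bounded.
pose S := [set 'N[leb]_p[EFin \o U] | p in [set p | 1%:E <= p]]%E.
have SK : (ereal_sup S <= K%:E)%E.
  by apply: ge_ereal_sup => _ [p p1 <-]; exact: UK.
pose v := maxe 1%:E (ereal_sup S).
have vE : (varpi U)%:E = v.
  rewrite /varpi -/S -/v fineK// fin_numElt; apply/andP; split.
    by apply: (@lt_le_trans _ _ 1%:E); rewrite ?ltNyr// le_max lexx.
  by rewrite gt_max ltry/= (le_lt_trans SK)// ltry.
have Sv p : (1%:E <= p)%E -> ('N[leb]_p[EFin \o U] <= (varpi U)%:E)%E.
  move=> p1; rewrite vE le_max; apply/orP; right.
  by apply: ereal_sup_ubound; exists p.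
split.
- by rewrite -lee_fin vE le_max lexx.
- by apply: ae_le_Lnormy => //; apply: Sv; rewrite leey.
- by rewrite -Lnorm1; exact: Sv.
Qed.

End varpi.

(** * Comparison with the majorant *)

Lemma sqrtrD_le {R : realType} (x y : R) : 0 <= x -> 0 <= y ->
  Num.sqrt (x + y) <= Num.sqrt x + Num.sqrt y.
Proof.
move=> x0 y0; rewrite -(@ler_pXn2r _ 2)// ?nnegrE ?sqrtr_ge0 ?addr_ge0//.
rewrite sqrrD !sqr_sqrtr ?addr_ge0//.
rewrite -addrA lerD2l lerDr mulrn_wge0// mulr_ge0// sqrtr_ge0.
Qed.

Lemma mul_sqrtr_le {R : realType} (a b x : R) : 0 <= a -> 0 <= x ->
  a ^+ 2 <= b -> a * Num.sqrt x <= Num.sqrt (b * x).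
Proof.
move=> a0 x0 ab; rewrite -{1}(ger0_norm a0) -sqrtr_sqr -sqrtrM ?sqr_ge0//.
by rewrite ler_wsqrtr// ler_wpM2r.
Qed.

(** Here [N = m] and [B = varpi / V_h], and everything is sorted along [sqrt x1], [sqrt x2], [r] and
    [c b]. The coefficient of [sqrt x1] is 18/5 from the variance plus 2 from the row means, and
    [(28/5)^2 <= 32]; that of [sqrt x2] is [sqrt 5]; that of [r] is [81/8 + 16 + 8 <= 46]; that of
    [c b] is [81/10 + 3/2 = 48/5]. The targets 32 and 46 are twice the 16 and 23 of the majorant,
    since [s ln m = 2 u]. *)
Lemma deviation_bound_le {R : realType} (N B w tau u c j S0 v : R) :
  0 < N -> 0 < B -> 0 < w -> 0 < j -> 14 <= u -> 0 < tau ->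
  1 <= c * u -> tau <= 5 / 4 * N * w + c * B * u ->
  S0 = 5 / 4 * N * j + 4 * w * u ->
  v = B * S0 + 2 * (5 / 4 * (N * w * S0) + 4 * tau * w * u) ->
  2 * Num.sqrt (N * v * u) + 8 * tau * u + tau
    + N * (2 * Num.sqrt (N * (w * j) * u) + 8 * w * u)
  <= Num.sqrt (32 * (N ^+ 3 * (w * j * u))) + Num.sqrt (32 * (N ^+ 2 * (B * j * u)))
     + 46 * (N * w * u) + 48 / 5 * c * (B * u ^+ 2).
Proof.
move=> N0 B0 w0 j0 u14 tau0 cu tauP S0E vE'.
have u0 : 0 < u by lra.
pose x1 := N ^+ 3 * (w * j * u); pose x2 := N ^+ 2 * (B * j * u).
pose r := N * w * u; pose b := B * u ^+ 2.
have x10 : 0 < x1 by rewrite /x1 !mulr_gt0// exprn_gt0.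
have x20 : 0 < x2 by rewrite /x2 !mulr_gt0// exprn_gt0.
have r0 : 0 < r by rewrite /r !mulr_gt0.
have b0 : 0 < b by rewrite /b !mulr_gt0// exprn_gt0.
have c0 : 0 < c by rewrite -(pmulr_lgt0 _ u0); lra.
(* [8 u + 1 <= 81/10 u] because [u >= 14]. *)
have tau_r : tau * (8 * u + 1) <= 81 / 8 * r + 81 / 10 * c * b.
  apply: (@le_trans _ _ ((5 / 4 * N * w + c * B * u) * (81 / 10 * u))).
    by apply: ler_pM; lra.
  by rewrite le_eqVlt; apply/orP; left; apply/eqP; rewrite /r /b; field.
(* The remainder is at most [20 r^2 + 12 c r b], using [1 <= c u] for the diagonal contribution; 3/4
   makes the cross term of the square exactly [12 c r b]. A full square passes through the square
   root without loss. *)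
have vE : N * v * u <= 25 / 8 * x1 + 5 / 4 * x2 + (8 * r + 3 / 4 * c * b) ^+ 2.
  have -> : N * v * u = 25 / 8 * x1 + 5 / 4 * x2 +
     (4 * N * B * w * u ^+ 2 + 10 * r ^+ 2 + 8 * r * u * tau).
    by rewrite vE' S0E /x1 /x2 /r; field.
  rewrite lerD2l.
  have h1 : 8 * r * u * tau <= 8 * r * u * (5 / 4 * N * w + c * B * u).
    by rewrite ler_wpM2l// !mulr_ge0// ltW.
  have h2 : 4 * N * B * w * u ^+ 2 <= 4 * N * B * w * u ^+ 2 * (c * u).
    rewrite -[leLHS]mulr1 ler_wpM2l// !mulr_ge0// ?exprn_ge0//; exact: ltW.
  apply: le_trans (lerD (lerD h2 (lexx _)) h1) _.
  rewrite [leLHS](_ : _ = 20 * r ^+ 2 + 12 * c * (r * b)); last first.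
    by rewrite /r /b; field.
  rewrite sqrrD !exprMn.
  have := sqr_ge0 r; have : 0 <= c ^+ 2 * b ^+ 2 by rewrite mulr_ge0 ?sqr_ge0.
  have : 0 <= c * (r * b) by rewrite !mulr_ge0// ltW.
  rewrite !exprMn; lra.
have sE : 2 * Num.sqrt (N * v * u) <=
    18 / 5 * Num.sqrt x1 + 2 * Num.sqrt (5 / 4 * x2) + (16 * r + 3 / 2 * c * b).
  have := ler_wsqrtr vE.
  have A1 : 0 <= 25 / 8 * x1 by lra.
  have A2 : 0 <= 5 / 4 * x2 by lra.
  have cb0 : 0 < c * b by exact: mulr_gt0.
  have A3 : 0 <= 8 * r + 3 / 4 * c * b by lra.
  have := sqrtrD_le (addr_ge0 A1 A2) (sqr_ge0 (8 * r + 3 / 4 * c * b)).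
  rewrite sqrtr_sqr (ger0_norm A3).
  have := sqrtrD_le A1 A2.
  have : Num.sqrt (25 / 8 * x1) <= 9 / 5 * Num.sqrt x1.
    rewrite -[in leRHS](ger0_norm (_ : 0 <= 9 / 5)) -?sqrtr_sqr; last by lra.
    rewrite -sqrtrM ?sqr_ge0// ler_wsqrtr//; lra.
  lra.
have sN : N * Num.sqrt (N * (w * j) * u) <= Num.sqrt x1.
  rewrite (_ : x1 = N ^+ 2 * (N * (w * j) * u)); last by rewrite /x1; ring.
  by apply: mul_sqrtr_le => //; [exact: ltW|rewrite !mulr_ge0// ltW].
have s1 : 28 / 5 * Num.sqrt x1 <= Num.sqrt (32 * x1).
  by apply: mul_sqrtr_le => //; lra.
have s2 : 2 * Num.sqrt (5 / 4 * x2) <= Num.sqrt (32 * x2).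
  apply: le_trans (mul_sqrtr_le (b := 4) _ _ _) _; rewrite ?ler_wsqrtr//; lra.
have cb0 : 0 < c * b by exact: mulr_gt0.
rewrite -/x1 -/x2 -/r -/b mulrDr.
have -> : N * (8 * w * u) = 8 * r by rewrite /r; ring.
move: sE sN s1 s2 tau_r.
set y1 := Num.sqrt x1; set y2 := Num.sqrt (N * v * u).
set y3 := Num.sqrt (32 * x1); set y4 := Num.sqrt (32 * x2).
set y5 := Num.sqrt (5 / 4 * x2); set y6 := Num.sqrt _.
have -> : N * (2 * y6) = 2 * (N * y6) by ring.
lra.
Qed.

Lemma sqrt_add_le {R : realType} (a b c : R) : 0 <= a -> 0 <= b -> 0 <= c ->
  b <= c ^+ 2 -> Num.sqrt (a + b) <= Num.sqrt a + c.
Proof.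
move=> a0 b0 c0 bc; apply: le_trans (sqrtrD_le a0 b0) _.
by rewrite lerD2l -[leRHS](ger0_norm c0) -sqrtr_sqr ler_wsqrtr.
Qed.

(* The tail bound needs positive [W] and [J]; it is applied to [W + e] and
   [J + e], and the loss is absorbed by the last term of the majorant. *)
Lemma perturbation_le {R : realType} (N B W J u e : R) :
  9 <= N -> 0 < B -> 0 <= W <= B -> 0 <= J <= B -> 14 <= u ->
  N ^+ 3 * e = B -> 0 < e ->
  Num.sqrt (32 * (N ^+ 3 * ((W + e) * (J + e) * u)))
    + Num.sqrt (32 * (N ^+ 2 * (B * (J + e) * u))) + 46 * (N * (W + e) * u)
  <= Num.sqrt (32 * (N ^+ 3 * (W * J * u))) + Num.sqrt (32 * (N ^+ 2 * (B * J * u)))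
    + 46 * (N * W * u) + 5 * (B * u).
Proof.
move=> N9 B0 /andP[W0 WB] /andP[J0 JB] u14 eB e0.
have N0 : 0 < N by lra.
have u0 : 0 < u by lra.
have N3 : 81 * N <= N ^+ 3.
  rewrite exprS mulrC; apply: ler_wpM2l; first exact: ltW.
  by rewrite (_ : 81 = 9 ^+ 2); [rewrite ler_pXn2r// ?nnegrE; lra|ring].
have Ne : N * e <= B / 81.
  rewrite -eB -(ler_pM2r (_ : 0 < 81 :> R)) ?ltr0n// divfK; last by rewrite pnatr_eq0.
  by rewrite mulrAC [N * 81]mulrC; apply: ler_wpM2r => //; exact: ltW.
have N2e : N ^+ 2 * e <= B / 9.
  rewrite -eB ler_pdivlMr// (_ : N ^+ 3 * e = N ^+ 2 * e * N); last by ring.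
  by rewrite ler_wpM2l// mulr_ge0 ?exprn_ge0// ltW.
have eB' : e <= B.
  rewrite -eB -[leLHS]mul1r; apply: ler_wpM2r; first exact: ltW.
  by apply: le_trans N3; lra.
have Bu0 : 0 < B * u by exact: mulr_gt0.
have BBu : 0 < B ^+ 2 * u by rewrite mulr_gt0// exprn_gt0.
have BBuu : 14 * (B ^+ 2 * u) <= (B * u) ^+ 2.
  rewrite (_ : (B * u) ^+ 2 = u * (B ^+ 2 * u)); last by ring.
  by rewrite ler_wpM2r// ltW.
have h1 : Num.sqrt (32 * (N ^+ 3 * ((W + e) * (J + e) * u))) <=
    Num.sqrt (32 * (N ^+ 3 * (W * J * u))) + 3 * (B * u).
  rewrite (_ : 32 * (N ^+ 3 * ((W + e) * (J + e) * u)) =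
    32 * (N ^+ 3 * (W * J * u)) + 32 * ((N ^+ 3 * e) * (W + J + e) * u));
    last by ring.
  have WJe : W + J + e <= 3 * B by lra.
  apply: sqrt_add_le; rewrite ?eB.
  - by rewrite !mulr_ge0// ?exprn_ge0// ltW.
  - by rewrite !mulr_ge0// ?addr_ge0// ltW.
  - by rewrite mulr_ge0// ltW.
  - apply: (@le_trans _ _ (32 * (B * (3 * B) * u))).
      rewrite ler_wpM2l// ler_wpM2r//; first exact: ltW.
      by rewrite ler_wpM2l// ltW.
    rewrite exprMn (_ : 32 * _ = 96 * (B ^+ 2 * u)); last by ring.
    lra.
have h2 : Num.sqrt (32 * (N ^+ 2 * (B * (J + e) * u))) <=
    Num.sqrt (32 * (N ^+ 2 * (B * J * u))) + 3 / 5 * (B * u).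
  rewrite (_ : 32 * (N ^+ 2 * (B * (J + e) * u)) =
    32 * (N ^+ 2 * (B * J * u)) + 32 * ((N ^+ 2 * e) * (B * u)));
    last by ring.
  apply: sqrt_add_le.
  - by rewrite !mulr_ge0// ?exprn_ge0// ltW.
  - by rewrite !mulr_ge0// ?exprn_ge0// ltW.
  - by rewrite mulr_ge0// ltW.
  - apply: (@le_trans _ _ (32 * (B / 9 * (B * u)))).
      by rewrite ler_wpM2l// ler_wpM2r// ltW.
    rewrite exprMn (_ : 32 * _ = 32 / 9 * (B ^+ 2 * u)); last by field.
    lra.
have h3 : 46 * (N * (W + e) * u) <= 46 * (N * W * u) + 46 / 81 * (B * u).
  rewrite (_ : 46 * (N * (W + e) * u) = 46 * (N * W * u) + 46 * ((N * e) * u));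
    last by ring.
  rewrite lerD2l (_ : 46 / 81 * _ = 46 * (B / 81 * u)); last by field.
  by rewrite ler_wpM2l// ler_wpM2r// ltW.
(* The three losses add up to [3 + 3/5 + 46/81 <= 5]. *)
lra.
Qed.

(** [e^2 = (e^(1/4))^8 <= (21/16)^8 < 9]. With [q >= 1] this yields [u >= 14], on which the
    numerical comparisons rely. *)
Lemma ln9_ge2 {R : realType} (m : nat) : (9 <= m)%N -> 2 <= ln m%:R :> R.
Proof.
move=> m9; have m9' : 9 <= m%:R :> R by rewrite ler_nat.
rewrite -[leLHS]expRK ler_ln ?posrE ?expR_gt0//; last by lra.
apply: le_trans m9'.
rewrite (_ : 2 = 8%:R * 4^-1 :> R); last by field.
rewrite expRM_natl; have h := @expR_le_quad R 4^-1.
have {}h : expR 4^-1 <= 21 / 16 :> R by lra.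
apply: (@le_trans _ _ ((21 / 16) ^+ 8)).
  by rewrite ler_pXn2r// ?nnegrE ?expR_ge0//; lra.
lra.
Qed.

(** * Choice of the truncation level in the two regimes of [Upsilon] *)

Section majorant.
Context {R : realType} {d : nat}.
Variables (alpha : nat -> R) (m : nat) (q : R) (U f : d.-tuple R -> R)
  (h : d.-tuple R).
Hypothesis m9 : (9 <= m)%N.
Hypothesis q1 : 1 <= q.
Hypothesis alpha0 : 0 < alpha m.
Hypothesis alpha3 : alpha m <= 3^-1.
Hypothesis Hh : frakH m h.
Let N : R := m%:R.
Let L : R := ln m%:R.
Let V := vol h.
Let B := varpi U / V.
Let u := (6 * q + 1) * L.
Hypothesis varpi1 : 1 <= varpi U.
Hypothesis W01 : 0 <= W U f h <= B.
Hypothesis J01 : 0 <= J U f h <= B.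
Hypothesis Walpha : W U f h <= varpi U / alpha m.

Let e := B / N ^+ 3.
Let w := W U f h + e.
Let j := J U f h + e.

(** The first four conditions are what [two_sample_tail] asks of [tau] and [th]. The last one feeds
    [deviation_bound_le], and makes its final term, together with the loss [5 B u] of
    [perturbation_le], fit under the [Upsilon] term of the majorant. *)
Definition levels_spec (tau th : R) :=
  [/\ 0 < tau, 0 < th, 1 <= th * tau,
    u + N * (w * ((expR (th * B) - 1) / B)) <= th * tau &
    exists2 c, 1 <= c * u & tau <= 5 / 4 * N * w + c * B * u /\
      48 / 5 * c * (B * u ^+ 2) + 5 * (B * u) <=
      Upsilon alpha m h * (12 * q + 2) ^+ 2 * L * B].

Let N9 : 9 <= N. Proof. by rewrite ler_nat. Qed.
Let L2 : 2 <= L. Proof. exact: ln9_ge2. Qed.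
Let V0 : 0 < V.
Proof. by apply: prodr_gt0 => i _; have [/(_ i)/andP[]] := Hh. Qed.
Let B0 : 0 < B.
Proof. by apply: divr_gt0 => //; exact: lt_le_trans ltr01 varpi1. Qed.
Let u7 : 7 * L <= u.
Proof. by apply: ler_wpM2r; [move: L2; lra|move: q1; lra]. Qed.
Let e0 : 0 < e. Proof. by rewrite divr_gt0// exprn_gt0//; move: N9; lra. Qed.

(** The exponent [1 / (4 B)] gives the factors 5/4 and 4 of [expR_quarter]. With [c = 4] the cost is
    [192/5 B u^2 + 5 B u], and [Upsilon = 10 ln m] provides [40 B u^2]. *)
Lemma levels_regular : ~ frakH_star alpha m h ->
  levels_spec (5 / 4 * N * w + 4 * B * u) (4 * B)^-1.
Proof.
move=> nstar; have u14 : 14 <= u by move: u7 L2; lra.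
have w0 : 0 < w by rewrite ltr_wpDl//; have /andP[] := W01.
have N0 : 0 < N by move: N9; lra.
have Bu : 0 < B * u by rewrite mulr_gt0//; lra.
have Nw : 0 < N * w by exact: mulr_gt0.
have thE : (4 * B)^-1 * (5 / 4 * N * w + 4 * B * u) = 5 / 16 * (N * w) / B + u.
  by field; rewrite gt_eqF.
have r0 : 0 <= 5 / 16 * (N * w) / B.
  by apply: divr_ge0; [lra|exact: ltW].
split.
- rewrite (_ : _ + _ = 5 / 4 * (N * w) + 4 * (B * u)); [lra|ring].
- by rewrite invr_gt0 mulr_gt0.
- rewrite thE; lra.
- rewrite thE (_ : (4 * B)^-1 * B = 4^-1); last by field; rewrite gt_eqF.
  rewrite addrC lerD2r (_ : _ / B = N * (w * (5 / 16 / B))); last by ring.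
  apply: ler_wpM2l; first exact: ltW.
  apply: ler_wpM2l; first exact: ltW.
  by apply: ler_wpM2r; [rewrite invr_ge0 ltW|exact: expR_quarter].
exists 4; first by lra.
split=> //.
rewrite /Upsilon !indicE (mem_set (_ : (frakH m `\` frakH_star alpha m) h))//.
rewrite memNset// mulr1 mulr0 addr0 -/L.
rewrite (_ : 10 * L * _ * L * B = 40 * (B * u ^+ 2)); last by rewrite /u; ring.
have : 14 * (B * u) <= B * u ^+ 2.
  by rewrite expr2 (mulrA B) mulrC ler_wpM2l// ltW.
lra.
Qed.

(** With [l = |ln (N V)|], the bound [W <= varpi / alpha] gives [N W / B <= N V / alpha]; multiplied
    by [expR (l / 2)] it becomes at most [sqrt (N V) / alpha <= 1], by definition of [frakH_star].
    The perturbation [e] contributes at most 1 more, hence the [u + 2] in [tau]. [Upsilon] provides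
    [68 B u^2 / l] against [768/35 B u^2 / l + 5 B u]. *)
Lemma levels_star : frakH_star alpha m h ->
  levels_spec (2 * B * (u + 2) / `|ln (N * V)|) (`|ln (N * V)| / (2 * B)).
Proof.
move=> star; have u14 : 14 <= u by move: u7 L2; lra.
have [_ NVa] := star; rewrite -/N -/V in NVa.
have N0 : 0 < N by move: N9; lra.
have NV0 : 0 < N * V by exact: mulr_gt0.
have NV1 : N * V <= 9^-1.
  apply: le_trans NVa _; rewrite (_ : 9^-1 = 3^-1 ^+ 2 :> R); last by field.
  by rewrite ler_pXn2r// ?nnegrE ltW.
have lnNV : ln (N * V) < 0 by rewrite ln_lt0// NV0/=; lra.
have absE : `|ln (N * V)| = - ln (N * V) by rewrite ltr0_norm.
set l := `|_| in absE *; have l0 : 0 < l by rewrite absE oppr_gt0.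
(* From [m^2 V >= ln m >= 1]; it keeps [l] below [ln m], hence [7 l <= u]. *)
have NVL : N^-1 <= N * V.
  have [_] := Hh; rewrite -/N -/V -/L => H.
  rewrite -[leLHS]mul1r ler_pdivrMr// mulrAC -expr2.
  by apply: le_trans H; move: L2; lra.
have lL : l <= L.
  by rewrite absE lerNl -lnV ?posrE// ler_ln ?posrE ?invr_gt0.
have l7 : 7 * l <= u by apply: le_trans u7; rewrite ler_pM2l.
have w0 : 0 < w by rewrite ltr_wpDl//; have /andP[] := W01.
have thtau : l / (2 * B) * (2 * B * (u + 2) / l) = u + 2.
  by field; rewrite !gt_eqF.
have thB : l / (2 * B) * B = l / 2 by field; rewrite gt_eqF.
(* [exp (l / 2) = (N V) ^ (-1/2)] beats the Poisson mean [N w / B]. *)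
pose E := expR (l / 2).
have E0 : 0 < E by exact: expR_gt0.
have EE : E ^+ 2 * (N * V) = 1.
  rewrite /E expr2 -expRD -splitr absE expRN lnK ?posrE// mulVf// gt_eqF//.
have EN : E <= N.
  rewrite -(@ler_pXn2r _ 2)// ?nnegrE ?(ltW E0) ?(ltW N0)//.
  have : E ^+ 2 * N^-1 <= 1 by rewrite -EE ler_wpM2l// exprn_ge0// ltW.
  rewrite ler_pdivrMr// mul1r => /le_trans; apply.
  by rewrite expr2 ler_peMr// ?(ltW N0)//; move: N9; lra.
have NWE : N * W U f h / B * E <= 1.
  have h1 : N * W U f h / B <= N * V / alpha m.
    have vp0 : 0 < varpi U by exact: lt_le_trans ltr01 varpi1.
    rewrite (_ : N * W U f h / B = N * V * (W U f h / varpi U)); last first.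
      by rewrite /B; field; rewrite !gt_eqF.
    apply: ler_wpM2l; first exact: ltW.
    by rewrite ler_pdivrMr// mulrC.
  have h2 : (N * V / alpha m * E) ^+ 2 <= 1.
    rewrite (_ : _ ^+ 2 = (E ^+ 2 * (N * V)) * (N * V / alpha m ^+ 2));
      last by field; rewrite gt_eqF.
    by rewrite EE mul1r ler_pdivrMr ?exprn_gt0// mul1r.
  apply: le_trans (_ : N * V / alpha m * E <= 1).
    by rewrite ler_wpM2r// ltW.
  rewrite -(@ler_pXn2r _ 2)// ?nnegrE ?expr1n//.
  by rewrite !mulr_ge0// ?invr_ge0// ltW.
have NeE : N * e / B * E <= 1.
  rewrite /e (_ : _ / B = (N ^+ 2)^-1); last by field; rewrite !gt_eqF.
  rewrite mulrC ler_pdivrMr ?exprn_gt0// mul1r; apply: le_trans EN _.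
  by rewrite expr2 ler_peMr// ?(ltW N0)//; move: N9; lra.
split.
- apply: divr_gt0 => //; apply: mulr_gt0; [exact: mulr_gt0|lra].
- by rewrite divr_gt0// mulr_gt0.
- by rewrite thtau; lra.
- rewrite thtau thB lerD2l -/E.
  apply: (@le_trans _ _ (N * w / B * E)).
    rewrite (_ : N * w / B * E = N * (w * (E / B))); last by ring.
    apply: ler_wpM2l; first exact: ltW.
    apply: ler_wpM2l; first exact: ltW.
    by apply: ler_wpM2r; [rewrite invr_ge0 ltW|lra].
  rewrite (_ : _ * E = N * W U f h / B * E + N * e / B * E); last first.
    by rewrite /w; ring.
  lra.
(* [u >= 14] gives [u + 2 <= 8/7 u], so [tau <= 2 * 8/7 * B u / l]. *)
exists (16 / 7 / l).
  by rewrite mulrAC ler_pdivlMr// mul1r; move: l7 l0; lra.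
split.
  apply: (@le_trans _ _ (16 / 7 / l * B * u)); last first.
    by rewrite lerDr !mulr_ge0// ltW.
  rewrite (_ : 16 / 7 / l * B * u = 2 * B * (8 / 7 * u) / l); last first.
    by field; rewrite gt_eqF.
  apply: ler_wpM2r; first by rewrite invr_ge0 ltW.
  by apply: ler_wpM2l; [rewrite mulr_ge0// ltW|lra].
rewrite /Upsilon !indicE.
rewrite (memNset (_ : ~ (frakH m `\` frakH_star alpha m) h)); last first.
  by move=> [_]; apply.
rewrite mem_set// mulr0 add0r mulr1 -/L -/N -/V -/l.
rewrite (_ : 17 * L / l * _ * L * B = 68 * (B * u ^+ 2) / l); last first.
  by rewrite /u; field; rewrite gt_eqF.
rewrite ler_pdivlMr// mulrDl.
rewrite (_ : 48 / 5 * (16 / 7 / l) * (B * u ^+ 2) * l =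
    768 / 35 * (B * u ^+ 2)); last by field; rewrite gt_eqF.
have Bu : 0 < B * u by rewrite mulr_gt0//; lra.
have : 7 * (B * u * l) <= B * u ^+ 2.
  rewrite (_ : B * u ^+ 2 = B * u * u); last by ring.
  by rewrite (_ : 7 * _ = B * u * (7 * l)); [rewrite ler_pM2l|ring].
have : 0 < B * u * l by rewrite mulr_gt0.
rewrite (_ : 5 * (B * u) * l = 5 * (B * u * l)); last by ring.
lra.
Qed.

Lemma deviation_le_majorant tau th S0 v : levels_spec tau th ->
  S0 = 5 / 4 * N * j + 4 * w * u ->
  v = B * S0 + 2 * (5 / 4 * (N * w * S0) + 4 * tau * w * u) ->
  2 * Num.sqrt (N * v * u) + 8 * tau * u + tau
    + N * (2 * Num.sqrt (N * (w * j) * u) + 8 * w * u)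
  <= N ^+ 2 * Umajorant alpha m q U f h.
Proof.
move=> [tau0 th0 _ _ [c cu [tauP cUps]]] S0E vE.
have u14 : 14 <= u by move: u7 L2; lra.
have N0 : 0 < N by move: N9; lra.
have w0 : 0 < w by rewrite ltr_wpDl//; have /andP[] := W01.
have j0 : 0 < j by rewrite ltr_wpDl//; have /andP[] := J01.
apply: le_trans (deviation_bound_le N0 B0 w0 j0 u14 tau0 cu tauP S0E vE) _.
have eB : N ^+ 3 * e = B by rewrite /e mulrC divfK// gt_eqF// exprn_gt0.
have := perturbation_le N9 B0 W01 J01 u14 eB e0.
rewrite -/w -/j => pert.
(* This identity matches the constants of the majorant with those of the tail bound: 16 becomes 32
   and 23 becomes 46. *)
have sL : (12 * q + 2) * L = 2 * u by rewrite /u; ring.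
rewrite /Umajorant /= -/N -/L -/V.
have NN4 : 0 <= (N ^+ 2) ^+ 2 by rewrite !exprn_ge0// ltW.
have NsqrtE x : N ^+ 2 * Num.sqrt x = Num.sqrt ((N ^+ 2) ^+ 2 * x).
  by rewrite sqrtrM// sqrtr_sqr ger0_norm// exprn_ge0// ltW.
rewrite 3![N ^+ 2 * (_ + _)]mulrDr !NsqrtE.
rewrite (_ : (N ^+ 2) ^+ 2 * (16 * (12 * q + 2) * W U f h * J U f h * L / N)
  = 32 * (N ^+ 3 * (W U f h * J U f h * u))); last first.
  rewrite (_ : 16 * (12 * q + 2) * W U f h * J U f h * L =
    16 * (W U f h * J U f h) * ((12 * q + 2) * L)); last by ring.
  by rewrite sL; field; rewrite gt_eqF.
rewrite (_ : (N ^+ 2) ^+ 2 *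
  (16 * (12 * q + 2) * varpi U * J U f h * L / (N ^+ 2 * V))
  = 32 * (N ^+ 2 * (B * J U f h * u))); last first.
  rewrite (_ : 16 * (12 * q + 2) * varpi U * J U f h * L =
    16 * (varpi U * J U f h) * ((12 * q + 2) * L)); last by ring.
  by rewrite sL /B; field; rewrite !gt_eqF.
rewrite (_ : N ^+ 2 * (23 * (12 * q + 2) * W U f h * L / N) =
   46 * (N * W U f h * u)); last first.
  rewrite (_ : 23 * (12 * q + 2) * W U f h * L =
    23 * W U f h * ((12 * q + 2) * L)); last by ring.
  by rewrite sL; field; rewrite gt_eqF.
rewrite (_ : N ^+ 2 * (Upsilon alpha m h * (12 * q + 2) ^+ 2 * varpi U * L /
    (N ^+ 2 * V)) = Upsilon alpha m h * (12 * q + 2) ^+ 2 * L * B); last first.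
  by rewrite /B; field; rewrite !gt_eqF.
move: pert cUps.
set a1 := Num.sqrt _; set a2 := Num.sqrt _; set a3 := Num.sqrt _.
set a4 := Num.sqrt _; set a5 := Upsilon _ _ _ * _ * _ * _.
lra.
Qed.

End majorant.

(** * Reduction to the clipped kernel *)

Section kernel.
Context {R : realType} {d : nat}.
Notation leb := (@lebesgue_tuple R d).
Variables (U f : d.-tuple R -> R) (h : d.-tuple R) (M c : R).
Hypothesis h0 : forall i, 0 < tnth h i.
Hypothesis mU : measurable_fun setT U.
Hypothesis UM : forall x, `|U x| <= M.
Hypothesis U_sym : symmetric_kernel U.
Hypothesis varpi1 : 1 <= varpi U.
Hypothesis U_ae : leb [set x | varpi U < `|U x|] = 0%E.
Hypothesis U_L1 : (\int[leb]_x `|(U x)%:E| <= (varpi U)%:E)%E.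
Hypothesis mf : measurable_fun setT f.
Hypothesis f0 : forall x, 0 <= f x.
Hypothesis f_ae : leb [set x | c < `|f x|] = 0%E.
Hypothesis c0 : 0 <= c.
Variable mu : probability (d.-tuple R) R.
Hypothesis muE : forall A, measurable A -> mu A = (\int[leb]_(x in A) (f x)%:E)%E.

Definition kern (U : d.-tuple R -> R) (p : d.-tuple R * d.-tuple R) : R :=
  scaled U h (vsub p.2 p.1).

(* [U] is bounded by [varpi U] only almost everywhere; its clipped version is
   bounded everywhere and gives the same integrals. *)
Definition clip (x : d.-tuple R) : R :=
  if `|U x| <= varpi U then U x else 0.

Lemma kernE U' p : kern U' p = (vol h)^-1 * U' (tuple_affine h p.1 p.2).
Proof.
rewrite /kern /scaled; congr (_ * U' _); apply: eq_from_tnth => i.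
by rewrite !tnth_mktuple.
Qed.

Let V0 : 0 < vol h. Proof. exact: vol_gt0. Qed.

Lemma measurable_kern U' : measurable_fun setT U' -> measurable_fun setT (kern U').
Proof.
move=> mU'; rewrite (_ : kern U' = fun p => (vol h)^-1 * U' (tuple_affine h p.1 p.2)).
  apply: measurable_funM => //; apply: measurableT_comp => //.
  apply/measurable_fun_tnthP => i.
  rewrite (_ : _ \o _ = (fun p : d.-tuple R * d.-tuple R =>
    (tnth p.2 i - tnth p.1 i) / tnth h i)).
    apply: measurable_funM => //; apply: measurable_funB.
      exact: (measurableT_comp (measurable_tnth i) measurable_snd).
    exact: (measurableT_comp (measurable_tnth i) measurable_fst).
  by apply/funext => p /=; rewrite tnth_mktuple.
by apply/funext => p; rewrite kernE.
Qed.

Lemma measurable_clip : measurable_fun setT clip.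
Proof.
apply: measurable_fun_ifT => //.
by apply: measurable_fun_ler => //; exact: measurableT_comp.
Qed.

Lemma clip_le x : `|clip x| <= varpi U.
Proof.
rewrite /clip; case: ifP => // _; rewrite normr0.
exact: le_trans ler01 varpi1.
Qed.

Lemma kern_bound U' K p : (forall x, `|U' x| <= K) -> `|kern U' p| <= K / vol h.
Proof.
move=> UK; rewrite kernE normrM gtr0_norm ?invr_gt0// mulrC.
by rewrite ler_wpM2r// invr_ge0 ltW.
Qed.

Lemma kern_sym U' x y : symmetric_kernel U' -> kern U' (x, y) = kern U' (y, x).
Proof.
move=> Us; rewrite !kernE -Us; congr (_ * U' _); apply: eq_from_tnth => i.
by rewrite !tnth_mktuple/= -mulNr opprB.
Qed.

Lemma clip_sym : symmetric_kernel clip.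
Proof. by move=> x; rewrite /clip U_sym. Qed.

Lemma mu_null A : measurable A -> leb A = 0%E -> mu A = 0%E.
Proof.
move=> mA A0; rewrite muE//; apply: null_set_integral => //.
by apply/measurable_EFinP; exact: measurable_funTS.
Qed.

(** For fixed [x] the two kernels differ only inside the affine preimage of the null set where [|U|]
    exceeds [varpi U]; this preimage is Lebesgue null, hence null for [mu]. *)
Lemma kern_clip_null x : mu [set y | kern U (x, y) != kern clip (x, y)] = 0%E.
Proof.
pose A := [set z | varpi U < `|U z|].
have mA : measurable A by apply: measurable_gt_set; exact: measurableT_comp.
have mg := @measurable_tuple_affine R d h x.
have mgA : measurable (tuple_affine h x @^-1` A).
  by rewrite -[_ @^-1` _]setTI; apply: mg.
have gA0 : mu (tuple_affine h x @^-1` A) = 0%E.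
  by apply: mu_null => //; rewrite lebesgue_tuple_affine// U_ae mule0.
apply: (subset_measure0 _ mgA) => //.
  rewrite (_ : mkset _ = [set y | 0 < `|kern U (x, y) - kern clip (x, y)|]).
    apply: measurable_gt_set; apply: measurableT_comp => //.
    by apply: measurable_funB; apply: measurableT_comp (pair1_measurable x);
      apply: measurable_kern => //; exact: measurable_clip.
  by apply/seteqP; split=> y /=; rewrite normr_gt0 subr_eq0.
move=> y /=; rewrite !kernE /clip /A /=.
by case: leP => //; rewrite eqxx.
Qed.

Lemma kern_ae_eq x (g : R -> R) :
  ae_eq mu setT (fun y => (g (kern U (x, y)))%:E)
                (fun y => (g (kern clip (x, y)))%:E).
Proof.
exists [set y | kern U (x, y) != kern clip (x, y)]; split.
- rewrite (_ : mkset _ = [set y | 0 < `|kern U (x, y) - kern clip (x, y)|]).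
    apply: measurable_gt_set; apply: measurableT_comp => //.
    by apply: measurable_funB; apply: measurableT_comp (pair1_measurable x);
      apply: measurable_kern => //; exact: measurable_clip.
  by apply/seteqP; split=> y /=; rewrite normr_gt0 subr_eq0.
- exact: kern_clip_null.
- move=> y /= ky; apply/eqP => E; apply: ky => _; by rewrite E.
Qed.

Let mk := measurable_kern mU.
Let mk' := measurable_kern measurable_clip.
Let k'B p := @kern_bound clip (varpi U) p clip_le.

Lemma row_meanE_clip x : row_mean mu (kern U) x = row_mean mu (kern clip) x.
Proof.
rewrite /row_mean /Rintegral; congr fine.
have mkx : measurable_fun setT (fun y => (kern U (x, y))%:E).
  by apply/measurable_EFinP; exact: measurableT_comp.
have mkx' : measurable_fun setT (fun y => (kern clip (x, y))%:E).
  by apply/measurable_EFinP; exact: measurableT_comp.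
apply: ae_eq_integral => //; exact: (kern_ae_eq x id).
Qed.

Lemma row_absE x : (row_abs mu (kern clip) x)%:E =
  (\int[leb]_y (`|kern U (x, y)| * f y)%:E)%E.
Proof.
rewrite -bdm_EFin; last exact: (bdm_abskr mk' k'B x).
have mkx : measurable_fun setT (fun y => (`|kern U (x, y)|)%:E).
  by apply/measurable_EFinP; apply: measurableT_comp => //;
    exact: measurableT_comp.
have mkx' : measurable_fun setT (fun y => (`|kern clip (x, y)|)%:E).
  by apply/measurable_EFinP; apply: measurableT_comp => //;
    exact: measurableT_comp.
transitivity (\int[mu]_y (`|kern U (x, y)|)%:E)%E.
  apply/esym; apply: ge0_ae_eq_integral => //.
    by move=> y _; rewrite lee_fin; exact: normr_ge0.
  exact: (kern_ae_eq x (fun z => `|z|)).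
rewrite (ge0_integral_density mf f0 muE)//.
Qed.

Lemma row_absE' x : row_abs mu (kern clip) x =
  \int[leb]_y (`|scaled U h (vsub y x)| * f y).
Proof. by rewrite /Rintegral -row_absE. Qed.

(** Symmetry of [U] turns column means into row means, so a single [w] bounds both. *)
Lemma col_abs y :
  \int[mu]_x absk (kern clip) (x, y) = row_abs mu (kern clip) y.
Proof.
apply: eq_Rintegral => x _; rewrite /absk kern_sym//; exact: clip_sym.
Qed.

Lemma row_abs_le x : row_abs mu (kern clip) x <= varpi U / vol h.
Proof. exact: bdm_int_le_cst (bdm_abskr mk' k'B x) (fun y => k'B (x, y)). Qed.

(** Bounding [f] by [c] almost everywhere leaves [c] times the integral of the scaled kernel, in
    which the affine change of variables cancels the volume: what remains is the L1 norm of [U]. *)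
Lemma row_abs_le_density x : row_abs mu (kern clip) x <= varpi U * c.
Proof.
rewrite -lee_fin row_absE.
have mkx : measurable_fun setT (fun y => `|kern U (x, y)|).
  by apply: measurableT_comp => //; exact: measurableT_comp.
apply: (@le_trans _ _ (\int[leb]_y (c%:E * (`|kern U (x, y)|)%:E))%E).
  apply: ae_ge0_le_integral => //.
  - by move=> y _; rewrite lee_fin mulr_ge0.
  - by apply/measurable_EFinP; exact: measurable_funM.
  - by move=> y _; rewrite -EFinM lee_fin mulr_ge0.
  - by apply: emeasurable_funM => //; exact/measurable_EFinP.
  exists [set x | c < `|f x|]; split => //.
    by apply: measurable_gt_set; exact: measurableT_comp.
  move=> y /=; apply: contra_notP => /negP; rewrite -leNgt => fc _.
  rewrite -EFinM lee_fin mulrC; apply: ler_wpM2r => //.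
  exact: le_trans (ler_norm _) fc.
rewrite ge0_integralZl_EFin//; last exact/measurable_EFinP.
pose F z := ((vol h)^-1 * `|U z|)%:E.
have mF : measurable_fun setT F.
  apply/measurable_EFinP; apply: measurable_funM => //.
  exact: measurableT_comp.
have F0 z : (0 <= F z)%E by rewrite lee_fin mulr_ge0// invr_ge0 ltW.
under eq_integral => y _.
  rewrite kernE normrM (gtr0_norm (x := _^-1)) ?invr_gt0// -/(F (tuple_affine h x y)).
  over.
rewrite ge0_integral_affine//.
rewrite /F; under eq_integral do rewrite EFinM.
rewrite ge0_integralZl_EFin ?invr_ge0 ?(ltW V0)//; last first.
  by apply/measurable_EFinP; exact: measurableT_comp.
rewrite [X in (_ * X)%E]muleA -EFinM mulfV ?gt_eqF// mul1e mulrC EFinM.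
by apply: lee_wpmul2l => //; rewrite lee_fin.
Qed.

Lemma row_abs_le_W x : row_abs mu (kern clip) x <= W U f h.
Proof.
apply: ub_le_sup; last by exists x => //; rewrite -row_absE'.
(* A real [sup] is an upper bound only of a set that is bounded above. *)
by exists (varpi U / vol h) => _ [y _ <-]; rewrite -row_absE' row_abs_le.
Qed.

Lemma W_le K : (forall x, row_abs mu (kern clip) x <= K) -> W U f h <= K.
Proof.
move=> rK; apply: ge_sup.
  (* Nonemptiness of the range; [h] serves as an arbitrary point of the space. *)
  by exists (\int[leb]_y (`|scaled U h (vsub y h)| * f y)); exists h.
by move=> _ [y _ <-]; rewrite -row_absE'.
Qed.

Lemma W_ge0 : 0 <= W U f h.
Proof. by apply: le_trans (row_abs_le_W h); exact: row_abs_ge0. Qed.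

Lemma JE : J U f h = total_abs mu (kern clip).
Proof.
have br := bdm_row_abs mu mk' k'B.
rewrite /total_abs /Rintegral (ge0_integral_density mf f0 muE); last 2 first.
- by apply/measurable_EFinP; exact: br.1.
- by move=> x; rewrite lee_fin; exact: row_abs_ge0.
rewrite /J /Rintegral; congr fine; apply: eq_integral => y _.
rewrite -EFinM mulrC; congr (_%:E).
transitivity (fine (\int[leb]_z ((f y)%:E * (`|kern U (y, z)| * f z)%:E))%E).
  congr fine; apply: eq_integral => z _.
  rewrite -EFinM; congr (_%:E); rewrite mulrCA -mulrA; congr (_ * _).
  by rewrite -[scaled _ _ _]/(kern U (z, y)) kern_sym// mulrCA mulrC -mulrA.
rewrite ge0_integralZl_EFin//; last first.
- apply/measurable_EFinP; apply: measurable_funM => //.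
  by apply: measurableT_comp => //; exact: measurableT_comp.
- by move=> z _; rewrite lee_fin mulr_ge0.
by rewrite -row_absE.
Qed.

Lemma J_ge0 : 0 <= J U f h.
Proof. by rewrite JE; apply: bdm_int_ge0 => x; exact: row_abs_ge0. Qed.

Lemma J_le K : (forall x, row_abs mu (kern clip) x <= K) -> J U f h <= K.
Proof.
by move=> rK; rewrite JE; apply: bdm_int_le_cst => //; exact: bdm_row_abs mk' k'B.
Qed.

End kernel.

Section monotone.
Context {dS : measure_display} {S : measurableType dS} {R : realType}.

(** The integral of a nonnegative function is a supremum over the simple functions below it, hence
    monotone without measurability. It is applied to [sup_deviation]. *)
Lemma ge0_le_integral_nonmeas (mu : {measure set S -> \bar R})
    (F G : S -> \bar R) :
  (forall x, 0 <= F x)%E -> (forall x, F x <= G x)%E ->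
  (\int[mu]_x F x <= \int[mu]_x G x)%E.
Proof.
move=> F0 FG; have G0 x : (0 <= G x)%E by exact: le_trans (FG x).
rewrite !ge0_integralTE//; apply: le_ereal_sup => /= _ [g gF <-].
exists g => // x.
exact: le_trans (gF x) (FG x).
Qed.

Lemma Rintegral_indic (P : probability S R) (A : set S) : measurable A ->
  \int[P]_x \1_A x = fine (P A).
Proof. by move=> mA; rewrite /Rintegral integral_indic// setIT. Qed.

Lemma bdm_indicator (A : set S) : measurable A ->
  bounded_measurable (\1_A : S -> R).
Proof.
move=> mA; apply: (@bdm_ge0_le _ _ _ _ 1); first exact: measurable_indic.
by move=> x; rewrite indicE; case: (_ \in _); rewrite /= lexx ler01.
Qed.

End monotone.

(** * Means of the kernel sums under the given random vectors *)

Section sample_bounds.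
Context {R : realType} {d : nat} {dO : measure_display}
  {Omega : measurableType dO} (P : probability Omega R) (m : nat).
Variables (mu : probability (d.-tuple R) R).
Variables (X Y : 'I_m -> {RV P >-> d.-tuple R}).
Hypothesis XYi : mutually_independent
  (fun k : 'I_m + 'I_m => match k with inl i => X i | inr i => Y i end).
Hypothesis Xmu : forall i A, measurable A -> distribution P (X i) A = mu A.
Hypothesis Ymu : forall i A, measurable A -> distribution P (Y i) A = mu A.

Lemma Rintegral_sample1 i j (k : d.-tuple R * d.-tuple R -> R) :
  bounded_measurable k ->
  \int[P]_w k (sample1 X Y i j w) = total_mean mu k.
Proof.
move=> bk.
have bkS := bdm_comp (measurable_sample1 X Y i j) bk.
have ik : (mu \x mu)%E.-integrable setT (EFin \o k).
  exact: (@bdm_integrable _ _ _ (mu \x mu)%E k bk).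
rewrite /total_mean /row_mean [in RHS]/Rintegral [in LHS]/Rintegral; congr fine.
transitivity (\int[distribution P (sample1 X Y i j)]_z (k z)%:E)%E.
  rewrite integral_distribution//; first by apply/measurable_EFinP; case: bk.
  exact: (bdm_integrable P bkS).
transitivity (\int[(mu \x mu)%E]_z (k z)%:E)%E.
  by apply: eq_measure_integral => A mA _; exact: (sample1_law XYi Xmu Ymu).
rewrite -(integral12_prod_meas1 ik); apply: eq_integral => x _.
by rewrite /fubini_F -bdm_EFin//; exact: bdm_comp (pair1_measurable x) bk.
Qed.

Lemma UhatE (U : d.-tuple R -> R) h w : Uhat U h (fun i => X i w) (fun i => Y i w) =
  (m%:R ^+ 2)^-1 * \sum_(i < m) \sum_(j < m) kern h U (sample1 X Y i j w).
Proof. by []. Qed.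

Lemma expectation_Uhat (U : d.-tuple R -> R) (h : d.-tuple R) (K : R) :
  (0 < m)%N -> (forall i, 0 < tnth h i) ->
  measurable_fun setT U -> (forall x, `|U x| <= K) ->
  fine 'E_P[fun w => Uhat U h (fun i => X i w) (fun i => Y i w)] =
  total_mean mu (kern h U).
Proof.
move=> m0 h0 mU UK.
have bk : bounded_measurable (kern h U).
  split; first exact: measurable_kern.
  by exists (K / vol h) => p; exact: kern_bound.
have bk1 i j : bounded_measurable (fun w => kern h U (sample1 X Y i j w)).
  exact: bdm_comp (measurable_sample1 X Y i j) bk.
rewrite unlock -[LHS]/(\int[P]_w Uhat U h (fun i => X i w) (fun i => Y i w)).
under eq_Rintegral do rewrite UhatE.
rewrite bdm_intZ; last by apply: bdm_sum => i; exact: bdm_sum.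
rewrite bdm_int_sum; last by move=> i; exact: bdm_sum.
under eq_bigr => i _.
  rewrite bdm_int_sum; last by move=> j; exact: bk1.
  under eq_bigr do rewrite Rintegral_sample1//.
  rewrite sumr_const card_ord.
  over.
rewrite sumr_const card_ord -mulrnA -[X in _ * X]mulr_natl natrM mulrA -expr2.
by rewrite mulVf ?mul1r// expf_neq0// pnatr_eq0 -lt0n.
Qed.

End sample_bounds.

Lemma Gamma_ge0 {R : realType} (a : R) : 0 <= Gamma a.
Proof.
by apply: Rintegral_ge0 => x _; rewrite mulr_ge0 ?powR_ge0 ?expR_ge0.
Qed.

(** The leading powers combine into [2^(q-1) * 2^(q+1) = 4^q >= 4], and every other contribution is
    nonnegative. *)
Lemma Lambda_star_ge {R : realType} {d : nat} (q : R) (U : d.-tuple R -> R) :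
  1 <= q -> 4 * varpi U `^ q <= Lambda_star q U.
Proof.
move=> q1; rewrite /Lambda_star -[leLHS]addr0; apply: lerD; last first.
  by rewrite mulr_ge0 ?Gamma_ge0 ?powR_ge0.
rewrite /Lambda; set a := 2 `^ (2 * q - 1) * _; set b := 2 `^ (2 * q - 2) * _ * _.
have a0 : 0 <= a.
  by rewrite mulr_ge0 ?powR_ge0// addr_ge0// mulr_ge0 ?powR_ge0// Gamma_ge0.
have b0 : 0 <= b.
  rewrite mulr_ge0 ?addr_ge0// ?mulr_ge0 ?powR_ge0 ?Gamma_ge0//.
have v0 := powR_ge0 (varpi U) q.
rewrite -!mulrA mulrA -powRD; last by rewrite pnatr_eq0 implybT.
apply: (@le_trans _ _ (4 * (varpi U `^ q * (1 + a + b)))).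
  rewrite ler_wpM2l// -[leLHS]mulr1 ler_wpM2l//; lra.
apply: ler_wpM2r; first by rewrite mulr_ge0//; lra.
rewrite (_ : 4 = 2 `^ 2%:R :> R); last by rewrite powR_mulrn//; ring.
by apply: ler_powR; lra.
Qed.

(** * The moment bound for one bandwidth *)

Section single_bandwidth.
Context {R : realType} {d : nat}.
Notation leb := (@lebesgue_tuple R d).
Variables (U f : d.-tuple R -> R) (M : R) (alpha : nat -> R) (m : nat) (q : R).
Hypothesis mU : measurable_fun setT U.
Hypothesis UM : forall x, `|U x| <= M.
Hypothesis U_sym : symmetric_kernel U.
Hypothesis varpi1 : 1 <= varpi U.
Hypothesis U_ae : leb [set x | varpi U < `|U x|] = 0%E.
Hypothesis U_L1 : (\int[leb]_x `|(U x)%:E| <= (varpi U)%:E)%E.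
Hypothesis m9 : (9 <= m)%N.
Hypothesis q1 : 1 <= q.
Hypothesis alpha0 : 0 < alpha m.
Hypothesis alpha3 : alpha m <= 3^-1.
Hypothesis mf : measurable_fun setT f.
Hypothesis f0 : forall x, 0 <= f x.
Hypothesis f_ae : leb [set x | (alpha m)^-1 < `|f x|] = 0%E.
Variable mu : probability (d.-tuple R) R.
Hypothesis muE : forall A, measurable A -> mu A = (\int[leb]_(x in A) (f x)%:E)%E.
Variable h : d.-tuple R.
Hypothesis Hh : frakH m h.

Let N : R := m%:R.
Let h0 i : 0 < tnth h i. Proof. by have [/(_ i)/andP[]] := Hh. Qed.
Let V0 : 0 < vol h. Proof. exact: vol_gt0. Qed.
Let u := (6 * q + 1) * ln N.
Let k := kern h (clip U).
Let mk : measurable_fun setT k.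
Proof. by apply: measurable_kern => //; exact: measurable_clip. Qed.
Let kB p : `|k p| <= varpi U / vol h.
Proof. by apply: kern_bound => // x; exact: clip_le. Qed.

Definition bad_samples : set (m.-tuple (d.-tuple R) * m.-tuple (d.-tuple R)) :=
  [set z : m.-tuple (d.-tuple R) * m.-tuple (d.-tuple R) |
     N ^+ 2 * Umajorant alpha m q U f h <
     `|\sum_(y <- z.2) Gsum k z.1 y - N ^+ 2 * total_mean mu k|].

Lemma measurable_bad_samples : measurable bad_samples.
Proof.
apply: measurable_gt_set; apply: measurableT_comp => //.
apply: measurable_funB => //.
exact: (bdm_tuple_sumr m (bdm_tuple_sum m (bdm_k mk kB))).1.
Qed.

Lemma bad_samples_le :
  ((power mu m \x power mu m) bad_samples <= (3 * N * expR (- u))%:E)%E.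
Proof.
have N9 : 9 <= N by rewrite ler_nat.
have L2 : 2 <= ln N by exact: ln9_ge2.
have B0 : 0 < varpi U / vol h by apply: divr_gt0 => //; exact: lt_le_trans ltr01 varpi1.
have ai0 : 0 <= (alpha m)^-1 by rewrite invr_ge0 ltW.
have rW := row_abs_le_W h0 mU varpi1 U_ae mf f0 muE.
have W0 := W_ge0 h0 mU varpi1 U_ae mf f0 muE.
have WB : W U f h <= varpi U / vol h.
  apply: (W_le h0 mU varpi1 U_ae mf f0 muE) => x.
  exact: (row_abs_le h0 mU varpi1 mu).
have Wa : W U f h <= varpi U / alpha m.
  apply: (W_le h0 mU varpi1 U_ae mf f0 muE) => x.
  exact: (row_abs_le_density h0 mU varpi1 U_ae U_L1 mf f0 f_ae ai0 muE).
have JEq := JE h0 mU U_sym varpi1 U_ae mf f0 muE.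
have J0 := J_ge0 h0 mU U_sym varpi1 U_ae mf f0 muE.
have JB : J U f h <= varpi U / vol h.
  apply: (J_le h0 mU U_sym varpi1 U_ae mf f0 muE) => x.
  exact: (row_abs_le h0 mU varpi1 mu).
have W01 : 0 <= W U f h <= varpi U / vol h by rewrite W0.
have J01 : 0 <= J U f h <= varpi U / vol h by rewrite J0.
have [tau [th lev]] : exists tau th, levels_spec alpha m q U f h tau th.
  have [star|nstar] := pselect (frakH_star alpha m h).
    by do 2 eexists; exact: levels_star.
  by do 2 eexists; exact: levels_regular.
(* The two [erefl] instantiate [S0] and [v] with the bodies of [rowsum_bound] and [variance_bound],
   so that the left side is [deviation_bound] up to conversion. *)
have dev := deviation_le_majorant m9 q1 Hh varpi1 W01 J01 lev erefl erefl.
have [tau0 th0 thtau lvl _] := lev.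
have e0 : 0 < varpi U / vol h / N ^+ 3.
  by rewrite divr_gt0// exprn_gt0//; lra.
have u0 : 0 < u by apply: mulr_gt0; [move: q1|]; lra.
have w0 : 0 < W U f h + varpi U / vol h / N ^+ 3 by rewrite ltr_wpDl.
have j0 : 0 < J U f h + varpi U / vol h / N ^+ 3 by rewrite ltr_wpDl.
have row_w x : row_abs mu k x <= W U f h + varpi U / vol h / N ^+ 3.
  by apply: le_trans (rW x) _; rewrite lerDl ltW.
have tail := two_sample_tail B0 w0 j0 tau0 u0 mk kB row_w _ _
  (leq_trans (isT : 0 < 9)%N m9) th0 thtau lvl.
apply: le_trans (_ : ((6 + 2 * N) * expR (- u))%:E <= _)%E; last first.
  by rewrite lee_fin ler_wpM2r ?expR_ge0//; lra.
apply: le_trans (tail _ _).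
- apply: le_measure; rewrite ?inE.
  + exact: measurable_bad_samples.
  + apply: measurable_gt_set; apply: measurableT_comp => //.
    apply: measurable_funB => //.
    exact: (bdm_tuple_sumr m (bdm_tuple_sum m (bdm_k mk kB))).1.
  + by move=> z /=; apply: le_lt_trans; exact: dev.
- by move=> y; rewrite (col_abs h U_sym); exact: row_w.
- by rewrite -JEq lerDl ltW.
Qed.

Lemma Umajorant_ge0 : 0 <= Umajorant alpha m q U f h.
Proof.
have L0 : 0 <= ln N by apply: le_trans (ln9_ge2 m9).
have s0 : 0 <= 12 * q + 2 by move: q1; lra.
have W0 := W_ge0 h0 mU varpi1 U_ae mf f0 muE.
have U0 : 0 <= Upsilon alpha m h.
  by rewrite /Upsilon addr_ge0// ?mulr_ge0// ?invr_ge0.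
have vp0 : 0 <= varpi U := le_trans ler01 varpi1.
rewrite /Umajorant /= !addr_ge0// ?sqrtr_ge0//.
- by rewrite divr_ge0// !mulr_ge0.
- by rewrite divr_ge0// !mulr_ge0// ?exprn_ge0// ltW.
Qed.

Context {dO : measure_display} {Omega : measurableType dO}
  (P : probability Omega R).
Variables (X Y : 'I_m -> {RV P >-> d.-tuple R}).
Hypothesis XYi : mutually_independent
  (fun k : 'I_m + 'I_m => match k with inl i => X i | inr i => Y i end).
Hypothesis Xmu : forall i A, measurable A -> distribution P (X i) A = mu A.
Hypothesis Ymu : forall i A, measurable A -> distribution P (Y i) A = mu A.

Definition deviation (w : Omega) : R :=
  `|Uhat U h (fun i => X i w) (fun i => Y i w) -
    fine 'E_P[fun w' => Uhat U h (fun i => X i w') (fun i => Y i w')]|.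

Definition clipped (i j : 'I_m) : set Omega :=
  sample1 X Y i j @^-1` [set p | kern h U p != k p].

Lemma measurable_clipped i j : measurable (clipped i j).
Proof.
rewrite -[clipped i j]setTI; apply: (measurable_sample1 X Y i j) => //.
rewrite (_ : mkset _ = [set p | 0 < `|kern h U p - k p|]).
  apply: measurable_gt_set; apply: measurableT_comp => //.
  by apply: measurable_funB => //; exact: measurable_kern.
by apply/seteqP; split=> y /=; rewrite normr_gt0 subr_eq0.
Qed.

Lemma clipped_null i j : P (clipped i j) = 0%E.
Proof.
have mA : measurable [set p | kern h U p != k p].
  rewrite (_ : mkset _ = [set p | 0 < `|kern h U p - k p|]).
    apply: measurable_gt_set; apply: measurableT_comp => //.
    by apply: measurable_funB => //; exact: measurable_kern.
  by apply/seteqP; split=> y /=; rewrite normr_gt0 subr_eq0.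
have := sample1_law XYi Xmu Ymu i j mA.
rewrite /distribution /pushforward -/(clipped i j) => ->.
apply/eqP; rewrite eq_le measure_ge0 andbT.
apply: product_le_xsection => // x.
by rewrite (kern_clip_null h0 mU U_ae mf muE).
Qed.

Definition bad_event : set Omega := sample2 X Y @^-1` bad_samples.

Lemma measurable_bad_event : measurable bad_event.
Proof.
rewrite -[bad_event]setTI; apply: (measurable_sample2 X Y) => //.
exact: measurable_bad_samples.
Qed.

Lemma bad_event_le : (P bad_event <= (3 * N * expR (- u))%:E)%E.
Proof.
have := sample2_law XYi Xmu Ymu measurable_bad_samples.
rewrite /distribution /pushforward -/bad_event => ->.
exact: bad_samples_le.
Qed.

Let expectationE : fine 'E_P[fun w' => Uhat U h (fun i => X i w') (fun i => Y i w')]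
  = total_mean mu k.
Proof.
rewrite (expectation_Uhat XYi Xmu Ymu (leq_trans (isT : 0 < 9)%N m9) h0 mU UM).
apply: eq_Rintegral => x _.
exact: (row_meanE_clip h0 mU U_ae mf muE).
Qed.

Let avg_le (K : R) (F : 'I_m -> 'I_m -> R) : (forall i j, `|F i j| <= K) ->
  `|(N ^+ 2)^-1 * \sum_(i < m) \sum_(j < m) F i j| <= K.
Proof.
move=> FK; have N0 : 0 < N by rewrite ltr0n (leq_trans _ m9).
rewrite normrM gtr0_norm ?invr_gt0 ?exprn_gt0// ler_pdivrMl ?exprn_gt0//.
apply: le_trans (ler_norm_sum _ _ _) _.
apply: (@le_trans _ _ (\sum_(i < m) \sum_(j < m) K)).
  apply: ler_sum => i _; apply: le_trans (ler_norm_sum _ _ _) _.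
  by apply: ler_sum => j _; exact: FK.
under eq_bigr do rewrite sumr_const card_ord.
by rewrite sumr_const card_ord -mulrnA -mulr_natl natrM expr2.
Qed.

(** A crude bound valid at every outcome, including the null events where a summand is affected by
    clipping; there only the pointwise bound [M] on [U] is available. *)
Lemma deviation_le w : deviation w <= (M + varpi U) / vol h.
Proof.
rewrite /deviation expectationE mulrDl; apply: le_trans (ler_normB _ _) _.
apply: lerD.
  by rewrite UhatE; apply: avg_le => i j; exact: kern_bound.
apply: le_trans (bdm_int_norm _ (bdm_row_mean mu mk kB)) _.
apply: bdm_int_le_cst.
  exact: bdm_norm (bdm_row_mean mu mk kB).
by move=> x; apply: le_trans (row_meanE mu mk kB x) (row_abs_le h0 mU varpi1 mu x).
Qed.

Lemma deviation_unclipped w : (forall i j, ~ clipped i j w) ->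
  deviation w = (N ^+ 2)^-1 *
    `|\sum_(y <- sample Y w) Gsum k (sample X w) y - N ^+ 2 * total_mean mu k| /\
  deviation w <= 2 * (varpi U / vol h).
Proof.
move=> nclip; have N0 : 0 < N by rewrite ltr0n (leq_trans _ m9).
have kk i j : kern h U (sample1 X Y i j w) = k (sample1 X Y i j w).
  by apply/eqP; apply: contra_notT (nclip i j).
have UE : Uhat U h (fun i => X i w) (fun i => Y i w) =
    (N ^+ 2)^-1 * \sum_(i < m) \sum_(j < m) k (sample1 X Y i j w).
  rewrite UhatE; congr (_ * _); apply: eq_bigr => i _.
  by apply: eq_bigr => j _; exact: kk.
split.
  rewrite /deviation expectationE UE.
  rewrite -[X in X * `|_|](gtr0_norm (x := (N ^+ 2)^-1)) ?invr_gt0 ?exprn_gt0//.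
  rewrite -normrM mulrBr mulKf ?gt_eqF ?exprn_gt0//; congr (`|_ * _ - _|).
  rewrite big_tuple; apply: eq_bigr => i _.
  rewrite /Gsum big_tuple; apply: eq_bigr => j _.
  by rewrite !tnth_mktuple.
rewrite /deviation expectationE mulr2n mulrDl mul1r.
apply: le_trans (ler_normB _ _) _; apply: lerD.
  by rewrite UE; apply: avg_le => i j; exact: kB.
apply: le_trans (bdm_int_norm _ (bdm_row_mean mu mk kB)) _.
apply: bdm_int_le_cst.
  exact: bdm_norm (bdm_row_mean mu mk kB).
by move=> x; apply: le_trans (row_meanE mu mk kB x) (row_abs_le h0 mU varpi1 mu x).
Qed.

Let B := varpi U / vol h.
Let K := (M + varpi U) / vol h.

(** A measurable majorant valid pointwise. The second summand integrates to 0; it is present so that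
    the domination holds everywhere and not merely almost everywhere. *)
Definition moment_bound (w : Omega) : R :=
  (2 * B) `^ q * \1_bad_event w +
  K `^ q * \sum_(i < m) \sum_(j < m) \1_(clipped i j) w.

Lemma deviation_le_moment_bound w :
  Num.max (deviation w - Umajorant alpha m q U f h) 0 `^ q <= moment_bound w.
Proof.
have N0 : 0 < N by rewrite ltr0n (leq_trans _ m9).
have q0 : 0 <= q by exact: le_trans q1.
have Um := Umajorant_ge0.
have dev0 : 0 <= deviation w by exact: normr_ge0.
have i0 (A : set Omega) : 0 <= \1_A w :> R by rewrite indicE.
have B0 : 0 <= B by rewrite divr_ge0 ?(le_trans ler01 varpi1)// ltW.
have max_le c : deviation w <= c -> 0 <= c ->
    Num.max (deviation w - Umajorant alpha m q U f h) 0 `^ q <= c `^ q.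
  move=> dc c0; apply: ge0_ler_powR; rewrite ?nnegrE//.
    by rewrite le_max lexx orbT.
  by rewrite ge_max c0 andbT; lra.
have [[i [j cij]]|nclip] := pselect (exists i j, clipped i j w).
  apply: (@le_trans _ _ (K `^ q)).
    apply: max_le; first exact: deviation_le.
    exact: le_trans dev0 (deviation_le w).
  rewrite /moment_bound -[leLHS]add0r; apply: lerD.
    by rewrite mulr_ge0 ?powR_ge0.
  rewrite -[leLHS]mulr1; apply: ler_wpM2l; first exact: powR_ge0.
  rewrite (bigD1 i)//= (bigD1 j)//= indicE mem_set//= -!addrA lerDl.
  by rewrite addr_ge0// sumr_ge0// => i' _; exact: sumr_ge0.
have {}nclip i j : ~ clipped i j w by move=> cij; apply: nclip; exists i, j.
have [devE dev2] := deviation_unclipped nclip.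
rewrite /moment_bound indicE; have [wb|wnb] := boolP (w \in bad_event).
  rewrite mulr1; apply: (@le_trans _ _ ((2 * B) `^ q)).
    by apply: max_le => //; rewrite mulr_ge0.
  by rewrite lerDl mulr_ge0 ?powR_ge0// !sumr_ge0// => i' _; exact: sumr_ge0.
rewrite (_ : Num.max _ 0 = 0).
  rewrite powR0; last by rewrite gt_eqF// (lt_le_trans ltr01 q1).
  rewrite addr_ge0 ?mulr_ge0 ?powR_ge0// sumr_ge0// => i' _; exact: sumr_ge0.
apply/max_idPr; rewrite subr_le0 devE ler_pdivrMl ?exprn_gt0// leNgt.
by apply: contraNN wnb => wb; rewrite inE.
Qed.

Lemma bdm_moment_bound : bounded_measurable moment_bound.
Proof.
apply: bdmD; (apply: bdmM; first exact: bdm_cst).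
  apply: bdm_indicator; exact: measurable_bad_event.
apply: bdm_sum => i; apply: bdm_sum => j.
exact/bdm_indicator/measurable_clipped.
Qed.

Lemma moment_bound_ge0 w : 0 <= moment_bound w.
Proof.
rewrite addr_ge0// mulr_ge0 ?powR_ge0// ?indicE//.
by rewrite sumr_ge0// => i' _; apply: sumr_ge0 => j' _; rewrite indicE.
Qed.

(** As [m^2 V >= ln m >= 2], one has [2 B <= varpi m^2], so the factor on the bad event is at most
    [varpi^q m^(2q)]. Its probability is at most [3 m * m^(-(6q + 1))], and the product is
    [3 varpi^q m^(-4q)]. *)
Lemma int_moment_bound :
  \int[P]_w moment_bound w <= 4 * varpi U `^ q * N `^ (- (4 * q)).
Proof.
have N9 : 9 <= N by rewrite ler_nat.
have N0 : 0 < N by lra.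
have L2 : 2 <= ln N by exact: ln9_ge2.
have bi := bdm_indicator measurable_bad_event.
have bc i j := bdm_indicator (measurable_clipped i j).
have bs i : bounded_measurable (fun w => \sum_(j < m) \1_(clipped i j) w : R).
  by apply: bdm_sum => j; exact: bc.
rewrite /moment_bound bdm_intD; last 2 first.
- by apply: bdmM => //; exact: bdm_cst.
- by apply: bdmM; [exact: bdm_cst|exact: bdm_sum].
rewrite !bdm_intZ//; last exact: bdm_sum.
rewrite bdm_int_sum// big1 ?mulr0 ?addr0; last first.
  move=> i _; rewrite bdm_int_sum// big1// => j _.
  by rewrite Rintegral_indic ?clipped_null//; exact: measurable_clipped.
rewrite Rintegral_indic; last exact: measurable_bad_event.
have vp0 : 0 <= varpi U := le_trans ler01 varpi1.
apply: (@le_trans _ _ ((2 * B) `^ q * (3 * N * expR (- u)))).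
  apply: ler_wpM2l; first exact: powR_ge0.
  rewrite -lee_fin fineK; first exact: bad_event_le.
  by rewrite fin_num_measure//; exact: measurable_bad_event.
have B2 : 2 * B <= varpi U * N ^+ 2.
  rewrite /B mulrCA; apply: ler_wpM2l => //.
  rewrite ler_pdivrMr//; have [_] := Hh; rewrite -/N; lra.
have BN : (2 * B) `^ q <= varpi U `^ q * expR (2 * q * ln N).
  apply: (@le_trans _ _ ((varpi U * N ^+ 2) `^ q)).
    apply: ge0_ler_powR; rewrite ?nnegrE//; first exact: le_trans q1.
    - by rewrite mulr_ge0// divr_ge0// ltW.
    - by rewrite mulr_ge0// exprn_ge0// ltW.
  rewrite powRM ?exprn_ge0 ?(ltW N0)//; apply: ler_wpM2l; first exact: powR_ge0.
  rewrite /powR expf_eq0/= gt_eqF// lnXn// (_ : q * (ln N *+ 2) = 2 * q * ln N)//.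
  by rewrite -mulr_natl; ring.
apply: (@le_trans _ _ (varpi U `^ q * expR (2 * q * ln N) * (3 * N * expR (- u)))).
  apply: ler_wpM2r => //; rewrite !mulr_ge0 ?expR_ge0// ltW//.
have -> : N `^ (- (4 * q)) = expR (2 * q * ln N) * N * expR (- u).
  have NE : expR (ln N) = N by rewrite lnK// posrE.
  rewrite -[X in _ = _ * X * _]NE -!expRD /powR gt_eqF//; congr expR.
  by rewrite /u; ring.
have h0' : 0 <= varpi U `^ q * (expR (2 * q * ln N) * N * expR (- u)).
  by rewrite !mulr_ge0 ?powR_ge0 ?expR_ge0// ltW.
rewrite (_ : _ * (3 * N * _) =
    3 * (varpi U `^ q * (expR (2 * q * ln N) * N * expR (- u))));
  last by ring.
rewrite -[4 * _ * _]mulrA; lra.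
Qed.

End single_bandwidth.

(** * Union bound over the grid of bandwidths *)

Theorem theorem6 (R : realType) (d : nat) (d_gt0 : (0 < d)%N)
  (U : d.-tuple R -> R) (t : R) (t_gt0 : 0 < t)
  (U_measurable : measurable_fun [set: d.-tuple R] U)
  (U_symmetric : symmetric_kernel U)
  (U_bounded : exists M : R, forall x, `|U x| <= M)
  (U_support : supported_on_cube t U)
  (alpha : nat -> R)
  (alpha_noninc : nonincreasing_seq alpha)
  (alpha_cvg0 : alpha n @[n --> \oo] --> (0 : R))
  (m : nat) (m_ge9 : (9 <= m)%N)
  (alpha_ln : 1 <= alpha m * ln m%:R)
  (alpha_le : alpha m <= 3^-1)
  (q : R) (q_ge1 : 1 <= q)
  (f : d.-tuple R -> R)
  (f_density : probability_density f)
  (f_bounded : ('N[lebesgue_tuple d]_+oo[EFin \o f] <= ((alpha m)^-1)%:E)%E)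
  (dO : measure_display) (Omega : measurableType dO) (P : probability Omega R)
  (X Y : 'I_m -> {RV P >-> d.-tuple R})
  (XY_iid : iid_pair X Y f) :
  ('E_P[sup_deviation alpha q U f X Y]
     <= (Lambda_star q U * (2 * ln m%:R) ^+ d * m%:R `^ (- (4 * q)))%:E)%E.
Proof.
have m_gt0 : (0 < m)%N by exact: leq_trans m_ge9.
have L2 : 2 <= ln m%:R :> R by exact: ln9_ge2.
have L0 : 0 < ln m%:R :> R by exact: lt_le_trans L2.
have alpha0 : 0 < alpha m.
  by rewrite -(pmulr_lgt0 _ L0); exact: lt_le_trans alpha_ln.
have [M UM] := U_bounded; have [mf f0 _] := f_density.
have [varpi1 U_ae U_L1] := varpi_bounds U_measurable UM U_support.
have f_ae := ae_le_Lnormy mf f_bounded.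
have [XYi Xf Yf] := XY_iid.
(* Taking [mu] as the law of one of the vectors provides a probability measure with density [f]. *)
pose mu : probability (d.-tuple R) R := distribution P (X (Ordinal m_gt0)).
have muE A : measurable A -> mu A = (\int[lebesgue_tuple d]_(x in A) (f x)%:E)%E.
  exact: Xf.
have Xmu i A : measurable A -> distribution P (X i) A = mu A.
  by move=> mA; rewrite muE// Xf.
have Ymu i A : measurable A -> distribution P (Y i) A = mu A.
  by move=> mA; rewrite muE// Yf.
pose K := (2 * Num.truncn (ln m%:R : R))%N.
(* The exponents run from 1 to [K] while ordinals start at 0, hence the successor. *)
pose grid (p : {ffun 'I_d -> 'I_K}) : d.-tuple R :=
  [tuple expR (- (p i).+1%:R) | i < d].
(* Grid points outside [frakH m] receive the zero function, so the sum can run over all [K ^ d]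
   index functions. *)
have /choice[Phi PhiP] : forall p, exists F : Omega -> R,
    [/\ bounded_measurable F, forall w, 0 <= F w,
      frakH m (grid p) -> forall w,
        Num.max (deviation U (grid p) X Y w
          - Umajorant alpha m q U f (grid p)) 0 `^ q <= F w &
      \int[P]_w F w <= 4 * varpi U `^ q * m%:R `^ (- (4 * q))].
  move=> p; have [Hp|nHp] := pselect (frakH m (grid p)).
    exists (moment_bound U f M alpha q mu (grid p) X Y); split.
    - exact: bdm_moment_bound.
    - exact: moment_bound_ge0.
    - by move=> _ w; exact: deviation_le_moment_bound.
    - exact: int_moment_bound.
  exists (fun=> 0); split => //; first exact: bdm_cst.
  by rewrite bdm_intcst !mulr_ge0 ?powR_ge0.
have supP w : 0 <= sup_deviation alpha q U f X Y w <= \sum_p Phi p w.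
  rewrite /sup_deviation; set S := [set _ | _ in _].
  have Sum0 : 0 <= \sum_p Phi p w by apply: sumr_ge0 => p _; have [] := PhiP p.
  (* If [calH m] is empty, the real [sup] takes its default value 0. *)
  have [->|/set0P[x Sx]] := eqVneq S set0; first by rewrite sup0 lexx.
  have Sub : ubound S (\sum_p Phi p w).
    move=> _ [h [Hh hK] <-].
    have /choice[g gE] : forall j, exists g : 'I_K, tnth h j = expR (- g.+1%:R).
      move=> j; have [i /andP[i1 iK] ->] := hK j.
      have iK' : (i.-1 < K)%N by rewrite prednK.
      by exists (Ordinal iK'); rewrite /= prednK.
    have hE : h = grid (finfun g).
      by apply: eq_from_tnth => j; rewrite tnth_mktuple ffunE.
    have [_ P0 Pd _] := PhiP (finfun g).
    rewrite hE in Hh *; apply: le_trans (Pd Hh w) _.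
    rewrite (bigD1 (finfun g))//= lerDl; apply: sumr_ge0 => p _.
    by have [] := PhiP p.
  apply/andP; split; last by apply: ge_sup => //; exists x.
  apply: (@le_trans _ _ x); first by case: Sx => h _ <-; exact: powR_ge0.
  by apply: ub_le_sup => //; exists (\sum_p Phi p w).
rewrite unlock; apply: (@le_trans _ _ (\int[P]_w (\sum_p Phi p w)%:E)%E).
  by apply: ge0_le_integral_nonmeas => w; rewrite lee_fin; have /andP[] := supP w.
have bPhi p : bounded_measurable (Phi p) by have [] := PhiP p.
rewrite bdm_EFin; last exact: bdm_sum.
rewrite lee_fin bdm_int_sum//.
have m0 : 0 <= m%:R `^ (- (4 * q)) by exact: powR_ge0.
have v0 : 0 <= varpi U `^ q by exact: powR_ge0.
apply: (@le_trans _ _ (\sum_(p : {ffun 'I_d -> 'I_K})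
    4 * varpi U `^ q * m%:R `^ (- (4 * q)))).
  by apply: ler_sum => p _; have [] := PhiP p.
rewrite sumr_const card_ffun !card_ord -[leLHS]mulr_natl.
rewrite mulrA; apply: ler_wpM2r => //; rewrite mulrC natrX.
apply: ler_pM.
- by rewrite mulr_ge0.
- exact: exprn_ge0.
- exact: Lambda_star_ge.
- apply: lerXn2r; rewrite ?nnegrE//; first by rewrite mulr_ge0// ltW.
  by rewrite /K natrM ler_pM2l// truncn_le ltW.
Qed.
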